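(* Let $\tilde T$ be a map of the almost periodic phase space $\tilde X$ preserving the measure $\mu$, where $\tilde X$, $\mathcal B$, $\mu$ and their standing assumptions are as described in the context. (a) If $\tilde T$ satisfies the almost mixing local limit theorem (AMLLT), then it enjoys local global mixing with respect to $\mathbb{G}_O$. (b) If $\tilde T$ satisfies the AMLLT, then it enjoys global global mixing with respect to $\mathbb{G}_{AO}$.
   Context: Phase space. $d_1,d_2\ge0$ are integers, $d=d_1+d_2\ge1$, $\mathbb{Z}_+=\{1,2,\dots\}$, $\mathcal Z=\mathbb{Z}_+^{d_1}\times\mathbb{Z}^{d_2}$, $\mathcal B\subset\mathcal Z$; $M$ and $D_z$ ($z\in\mathcal B$) are compact metric spaces; put $D_z=M$ for $z\in\mathcal Z\setminus\mathcal B$ and $$\tilde X=\bigcup_{z\in\mathcal Z}D_z\times\{z\}.$$ $\mathcal B$ is small: for every $\eta>0$ there are $\xi=\xi(\eta)>0$ and $Q_0=Q_0(\eta)$ such that for all $Q\ge Q_0$ $$Q^{-d}\,\big|\{k\in([0,Q]^{d_1}\times[-Q/2,Q/2]^{d_2})\cap\mathbb{Z}^{d}:\ \mathrm{dist}(k,\mathcal B)\le\xi Q\}\big|<\eta .$$ $\tilde T:\tilde X\to\tilde X$ preserves the $\sigma$-finite measure $\mu=\sum_{z\in\mathcal Z}\nu_z$, where there is a probability measure $\nu$ on $M$ such that for $z\notin\mathcal B$, $\nu_z$ is the copy of $\nu$ on $M\times\{z\}$, and there is $A>1$ such that for all $z\in\mathcal B$, $\nu_z$ is a finite measure on $D_z\times\{z\}$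 of mass less than $A$. Let $(y(x),z(x))=(\mathbf y,\mathbf z)$ if $x=(\mathbf y,\mathbf z)$ with $\mathbf z\notin\mathcal B$, and $(y(x),z(x))=(\infty,\infty)$ (a label) if the cell of $x$ is in $\mathcal B$. For $w\in\mathcal Z$ and a Lipschitz $\phi:D_w\to\mathbb{R}$ let $\bar\nu_{\phi,w}$ be the (signed) measure $\phi\,d\nu_w$ on $D_w\times\{w\}$. $\lceil\cdot\rceil$ is the coordinatewise upper integer part; $\|\cdot\|_{Lip}$ is the Lipschitz norm. AMLLT: there are $L_n>0$, $L_n\to\infty$, and a bounded continuous $p:\mathbb{R}_+^{d_1}\times\mathbb{R}^{d_2}\to[0,\infty)$ with $\int p=1$ such that (A) and (B) hold. (A) For every $\varepsilon>0$ and $R\in\mathbb{R}$, $$\lim_{n\to\infty}\sup\Big|L_n^{d}\,\bar\nu_{\phi,w}\big(\psi(y(\tilde T^nx))\mathbf 1_{z(\tilde T^nx)=\lceil \mathbf zL_n\rceil}\big)-p(\mathbf z-w/L_n)\nu(\psi)\nu(\phi)\Big|=0,$$ the supremum being over quadruples $(\phi,\psi,w,\mathbf z)$ with $\phi,\psi$ Lipschitz on $M$, $\|\phi\|_{Lip},\|\psi\|_{Lip}\le R$, $w\in\mathcal Z\setminus\mathcal B$, $\mathbf z\in[0,\infty)^{d_1}\times\mathbb{R}^{d_2}$, $|\mathbf z-w/L_n|<R$, $\mathrm{dist}(L_n\mathbf z,\mathcal B)>\varepsilon L_n$ (and $\mathbf z-w/L_n$ in the domain of $p$). (B) For every $w\in\mathcal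 B$, every Lipschitz $\phi:D_w\to\mathbb{R}$, every $\varepsilon>0$ and $R\in\mathbb{R}$, $$\lim_{n\to\infty}\sup\Big|L_n^{d}\,\bar\nu_{\phi,w}\big(\psi(y(\tilde T^nx))\mathbf 1_{z(\tilde T^nx)=\lceil \mathbf zL_n\rceil}\big)-p(\mathbf z)\nu(\psi)\nu_w(\phi)\Big|=0,$$ the supremum being over pairs $(\psi,\mathbf z)$ with $\psi$ Lipschitz on $M$, $\|\psi\|_{Lip}\le R$, $\mathbf z\in[0,\infty)^{d_1}\times\mathbb{R}^{d_2}$, $|\mathbf z|<R$, $\mathrm{dist}(L_n\mathbf z,\mathcal B)>\varepsilon L_n$. Cubes: for $z\in\mathbb{Z}^d$, $w\in\mathbb{Z}_+$ such that $(z+(-\lfloor w/2\rfloor,w-\lfloor w/2\rfloor]^d)\cap\mathbb{Z}^d\subset\mathcal Z$, the cube centered at $z$ of size $w$ is the union of the cells $D_{z'}\times\{z'\}$ over $z'$ in this set. $\mathbb{G}_O$: bounded uniformly continuous $\Phi:\tilde X\to\mathbb{R}$ for which there is $\bar\Phi\in\mathbb{R}$ such that for all real $a_j<b_j$ ($j\le d$) with $a_1,\dots,a_{d_1}\ge0$, $\lim_{N\to\infty}\frac1{\prod_j(b_jN-a_jN)}\int_{\{\text{cells }z\in\prod_j[a_jN,b_jN]\}}\Phi\,d\mu=\bar\Phi$. $\mathbb{G}_{AO}$: bounded uniformly continuous $\Phi:\tilde X\to\mathbb{R}$ for which there is $\bar\Phi\in\mathbb{R}$ such that for every $\varepsilon>0$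 there are $b,B_0\in\mathbb{Z}_+$ such that for all $B>B_0$ the number of $z\in((-b/2,B-b/2]^{d_1}\times(-B/2,B/2]^{d_2})\cap\mathbb{Z}^d$ for which the cube $V$ centered at $z$ of size $b$ is contained in $\tilde X$ and satisfies $|\frac1{\mu(V)}\int_V\Phi\,d\mu-\bar\Phi|\le\varepsilon$ is greater than $(1-\varepsilon)B^d$. Local global mixing with respect to $\mathbb{G}_O$: for all $\phi\in L^1(\mu)$, $\Phi\in\mathbb{G}_O$, $\int\phi\,(\Phi\circ\tilde T^n)\,d\mu\to\mu(\phi)\bar\Phi$ as $n\to\infty$. Global global mixing with respect to $\mathbb{G}_{AO}$: for all $\Phi_1,\Phi_2\in\mathbb{G}_{AO}$, $$\lim_{n\to\infty}\limsup_{V\in\mathcal V,\mu(V)\to\infty}\frac1{\mu(V)}\int_V\Phi_1\,(\Phi_2\circ\tilde T^n)\,d\mu=\lim_{n\to\infty}\liminf_{V\in\mathcal V,\mu(V)\to\infty}\frac1{\mu(V)}\int_V\Phi_1\,(\Phi_2\circ\tilde T^n)\,d\mu=\bar\Phi_1\bar\Phi_2,$$ where $\mathcal V$ is the collection of cubes containing the cell closest to the origin, i.e. the cell $(1,\dots,1,0,\dots,0)$ ($d_1$ ones), which is the cell $0$ when $d_1=0$. *)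

(* Defs.v *)
From HB Require Import structures.
From mathcomp Require Import all_boot all_order all_algebra finmap.
From mathcomp Require Import zify ring lra.
From mathcomp Require Import all_classical all_reals all_analysis.

Set Implicit Arguments.
Unset Strict Implicit.
Unset Printing Implicit Defensive.

Import Order.TTheory GRing.Theory Num.Theory.
Import numFieldNormedType.Exports.

Local Open Scope classical_set_scope.
Local Open Scope ring_scope.

(* Non-empty metric spaces: measurable types are pointed in the library. *)
#[short(type="pmetricType")]
HB.structure Definition PointedMetric (K : numDomainType) :=
  { M of Metric K M & Pointed M }.

Notation borel T := (g_sigma_algebraType (@open T)).

Section lipschitz.
Context (R : realType) (M : metricType R).

Definition is_lipschitz (f : M -> R) : Prop :=
  exists K : R, forall x y, `|f x - f y| <= K * mdist x y.

(* Sup norm plus best Lipschitz constant; the pairs with x = y contribute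
   0 / 0 = 0. *)
Definition lip_norm (f : M -> R) : \bar R :=
  (ereal_sup [set `|f x|%:E | x in [set: M]] +
   ereal_sup [set (`|f xy.1 - f xy.2| / mdist xy.1 xy.2)%:E
             | xy in [set: M * M]])%E.

Definition lip_ball (r : R) : set (M -> R) :=
  [set f | is_lipschitz f /\ (lip_norm f <= r%:E)%E].

End lipschitz.

(* Supremum of a set of nonnegative numbers, equal to 0 on the empty set. *)
Definition sup0 (R : realType) (S : set R) : \bar R :=
  ereal_sup [set e%:E | e in 0 |` S].

(* Lebesgue integral over R^n of a nonnegative Borel function, as an iterated
   integral (Tonelli). *)
Fixpoint integral_Rn (R : realType) (n : nat) :
    ('rV[R]_n -> \bar R) -> \bar R :=
  match n return ('rV[R]_n -> \bar R) -> \bar R with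
  | 0 => fun f => f 0
  | m.+1 => fun f => (\int[@lebesgue_measure R]_t integral_Rn
      (fun v : 'rV[R]_m => f (row_mx (const_mx (t : R) : 'rV[R]_1) v)))%E
  end.

Section lattice.
Context (R : realType) (d1 d2 : nat).
Local Notation Zd := 'rV[int]_(d1 + d2).
Local Notation Rd := 'rV[R]_(d1 + d2).

Definition cells : set Zd := [set z : Zd | forall i : 'I_d1, 0 < z 0 (lshift d2 i)].

Definition origin_cell : Zd := row_mx (const_mx 1) 0.

Definition orthant : set Rd :=
  [set x : Rd | forall i : 'I_d1, 0 <= x 0 (lshift d2 i)].

Definition toR (z : Zd) : Rd := map_mx intr z.

Definition ceil_vec (x : Rd) : Zd := map_mx Num.ceil x.

(* `|_| is the sup norm of R^d; every condition below in which it occurs is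
   quantified over all radii, hence does not depend on the norm.
   The distance to the empty set is +oo. *)
Definition dist_set (x : Rd) (B : set Zd) : \bar R :=
  ereal_inf [set `|x - toR b|%:E | b in B].

Definition nb_points (S : set Zd) : nat := #|` fset_set S|.

Definition big_box (Q : R) : set Zd :=
  [set k : Zd | (forall i : 'I_d1, 0 <= toR k 0 (lshift d2 i) <= Q) /\
           (forall j : 'I_d2, - (Q / 2) <= toR k 0 (rshift d1 j) <= Q / 2)].

Definition small_set (B : set Zd) : Prop :=
  forall eta : R, 0 < eta -> exists xi Q0 : R, 0 < xi /\
    forall Q : R, Q0 <= Q ->
      Q ^- (d1 + d2) *
      (nb_points (big_box Q `&`
         [set k | (dist_set (toR k) B <= (xi * Q)%:E)%E]))%:R < eta.

Definition cube_cells (z : Zd) (w : nat) : set Zd :=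
  [set z' : Zd | forall j, z 0 j - (w./2)%:Z < z' 0 j <= z 0 j + w%:Z - (w./2)%:Z].

Definition scaled_box (a b : Rd) (N : nat) : set Zd :=
  [set z : Zd | forall j, a 0 j * N%:R <= toR z 0 j <= b 0 j * N%:R].

Definition window (b B : nat) : set Zd :=
  [set z : Zd | (forall i : 'I_d1, - (b%:R / 2) < toR z 0 (lshift d2 i)
                              <= B%:R - b%:R / 2) /\
           (forall j : 'I_d2, - (B%:R / 2) < toR z 0 (rshift d1 j)
                              <= B%:R / 2)].

End lattice.
Arguments cells {d1 d2}.
Arguments origin_cell {d1 d2}.
Arguments orthant {R d1 d2}.
Arguments window R {d1 d2}.

Section lattice_facts.
Context (R : realType) (d1 d2 : nat).
Local Notation Zd := 'rV[int]_(d1 + d2).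

Lemma finite_bounded_row (N : nat) :
  finite_set [set z : Zd | forall j, - N%:Z <= z 0 j <= N%:Z].
Proof.
pose f (g : {ffun 'I_(d1 + d2) -> 'I_(N + N).+1}) : Zd :=
  \row_j ((g j)%:Z - N%:Z).
apply: (@sub_finite_set _ _ (f @` setT)); last exact/finite_image/finite_finset.
move=> z /= zN.
exists [ffun j => inord (absz (z 0 j + N%:Z))] => //.
apply/rowP => j; rewrite !mxE ffunE.
have /andP[zl zr] := zN j; rewrite inordK; last by lia.
by rewrite gez0_abs; lia.
Qed.

Lemma cells_not_small (B : set Zd) : cells `<=` B -> ~ small_set R B.
Proof.
move=> cB sB; have [xi [Q0 [xi0 /=]]] := sB 1 ltr01.
pose N := (Num.bound `|Q0|).+1.
pose Q : R := (N + N)%:R.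
have Q0Q : Q0 <= Q.
  rewrite (le_trans (ler_norm _))// (le_trans (ltW (archi_boundP _)))//.
  by rewrite /Q ler_nat (leq_trans (leqnSn _)) ?leq_addr.
have Qgt0 : 0 < Q by rewrite ltr0n.
have Q2 : Q / 2 = N%:R by rewrite /Q natrD; lra.
move=> /(_ _ Q0Q); apply/negP; rewrite -leNgt.
rewrite mulrC ler_pdivlMr ?exprn_gt0// mul1r /Q -natrX ler_nat.
set S := (X in nb_points X).
have Sfin : finite_set S.
  apply: sub_finite_set (finite_bounded_row (N + N)) => z [[z1 z2] _] j.
  suff : - Q <= toR R z 0 j <= Q.
    by rewrite mxE /Q -[(N + N)%:R]/((N + N)%:Z%:~R) -mulrNz !ler_int.
  rewrite -[j]fintype.splitK; case: (fintype.split j) => i /=.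
    by have := z1 i; rewrite -/Q; lra.
  by have := z2 i; rewrite -/Q; lra.
pose f (g : {ffun 'I_(d1 + d2) -> 'I_(N + N)}) : Zd :=
  \row_j (match fintype.split j with inl _ => (g j).+1%:Z | inr _ => (g j)%:Z - N%:Z end).
have finj : injective f.
  move=> g h /rowP gh; apply/ffunP => j; apply/val_inj => /=.
  by have := gh j; rewrite !mxE; case: fintype.split => _; lia.
have fS g : S (f g).
  have lti j : (g j)%:R <= Q - 1.
    by rewrite lerBrDr /Q natr1 ler_nat; exact: ltn_ord.
  rewrite /S -/Q; split; first split.
  - move=> i; rewrite !mxE (fintype.unsplitK (inl i)) /=.
    have := lti (lshift d2 i); have := ler0n R (g (lshift d2 i)).
    by rewrite -pmulrn -natr1; lra.
  - move=> i; rewrite !mxE (fintype.unsplitK (inr i)) /= Q2.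
    have := lti (rshift d1 i); have := ler0n R (g (rshift d1 i)).
    by rewrite rmorphB /= -!pmulrn; lra.
  - apply: (@le_trans _ _ 0%E); last by rewrite lee_fin ltW// mulr_gt0.
    apply: ereal_inf_lbound; exists (f g); last by rewrite subrr normr0.
    by apply: cB => i; rewrite mxE (fintype.unsplitK (inl i)).
rewrite /nb_points.
have -> : ((N + N) ^ (d1 + d2))%N = size (map f (enum {ffun 'I_(d1 + d2) -> 'I_(N + N)})).
  by rewrite size_map -cardE card_ffun !card_ord.
apply: uniq_leq_size; first by rewrite map_inj_uniq ?enum_uniq.
by move=> z /mapP[g _ ->]; rewrite in_fset_set// inE.
Qed.

End lattice_facts.

Record phase_space (R : realType) (d1 d2 : nat) := PhaseSpace {
  exc : set 'rV[int]_(d1 + d2);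
  exc_cells : exc `<=` cells;
  exc_small : small_set R exc;
  regular_fiber : pmetricType R;
  exc_fiber : exc -> pmetricType R;
  regular_fiber_compact : compact [set: regular_fiber];
  exc_fiber_compact : forall z : exc, compact [set: exc_fiber z];
  nu : probability (borel regular_fiber) R;
  nu_exc : forall z : exc,
    {finite_measure set (borel (exc_fiber z)) -> \bar R};
  nu_exc_mass : exists A : R, 1 < A /\
    forall z : exc, (nu_exc z [set: exc_fiber z] < A%:E)%E
}.
Arguments nu {R d1 d2}.
Arguments nu_exc {R d1 d2}.

Section total_space.
Context (R : realType) (d1 d2 : nat) (P : phase_space R d1 d2).

Definition regular_cell : choiceType := (cells `\` exc P : set _).
Definition exc_cell : choiceType := (exc P : set _).
Definition cell : choiceType := (regular_cell + exc_cell)%type.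

Definition fiber (i : cell) : pmetricType R :=
  match i with inl _ => regular_fiber P | inr z => exc_fiber z end.

Definition cell_measure (i : cell) :
    {measure set (borel (fiber i)) -> \bar R} :=
  match i with inl _ => nu P | inr z => nu_exc P z end.

(* The disjoint union of the cells, with the disjoint union topology. *)
Definition total_space := {i : cell & fiber i}.

HB.instance Definition _ := Topological.copy total_space {i : cell & fiber i}.

Lemma regular_cell_inhabited : exists z, (cells `\` exc P) z.
Proof.
apply: contrapT => nz; apply: (@cells_not_small R d1 d2 (exc P)) (@exc_small _ _ _ P).
by move=> z cz; apply: contrapT => ez; apply: nz; exists z.
Qed.

Definition base_point : total_space :=
  let: exist z cz := cid regular_cell_inhabited in
  existT fiber (inl (exist _ z (mem_set cz))) (point : regular_fiber P).

HB.instance Definition _ := isPointed.Build total_space base_point.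

Definition mu (A : set (borel total_space)) : \bar R :=
  (\esum_(i in [set: cell]) cell_measure i (existT fiber i @^-1` A))%E.

Lemma measurable_section (i : cell) (A : set (borel total_space)) :
  measurable A -> measurable (existT fiber i @^-1` A : set (borel (fiber i))).
Proof.
move=> mA; rewrite -[X in measurable X]setTI.
have : measurable_fun [set: borel (fiber i)]
    (existT fiber i : borel (fiber i) -> borel total_space).
  apply: (@measurability _ _ (borel (fiber i)) (borel total_space) setT
    (existT fiber i) (@open total_space) erefl).
  move=> _ [U oU <-].
  rewrite setTI; apply: sub_sigma_algebra.
  by apply: open_comp oU => x _; exact: existT_continuous.
by move/(_ measurableT); apply.
Qed.

Let mu0 : mu set0 = 0%E.
Proof. by rewrite /mu esum1// => i _; rewrite preimage_set0 measure0. Qed.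

Let mu_ge0 A : (0 <= mu A)%E.
Proof. exact: esum_ge0. Qed.

Let mu_sigma_additive : semi_sigma_additive mu.
Proof.
move=> F mF tF mUF; rewrite [X in _ --> X](_ : _ =
    lim ((fun n => \sum_(0 <= i < n) mu (F i))%E @ \oo)).
  by apply: is_cvg_ereal_nneg_natsum => k _; exact: mu_ge0.
rewrite nneseries_esumT; last by move=> n; exact: mu_ge0.
rewrite /mu esum_esum//.
under eq_esum => i _.
  rewrite preimage_bigcup measure_semi_bigcup; first last.
  - by rewrite -preimage_bigcup; exact: measurable_section.
  - apply/trivIsetP => /= m n _ _ mn; rewrite -preimage_setI.
    by move/trivIsetP : tF => /(_ _ _ I I mn) ->; rewrite preimage_set0.
  - by move=> n; exact: measurable_section.
  rewrite nneseries_esumT//.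
  over.
rewrite esum_esum//.
apply: (@reindex_esum _ _ _ _ _ (fun k : nat * cell => (k.2, k.1))
  (fun k : cell * nat => cell_measure k.1 (existT fiber k.1 @^-1` F k.2))).
split => //; first by move=> [i n] [j m] _ _ [-> ->].
by move=> [n i] _; exists (i, n).
Qed.

HB.instance Definition _ :=
  isMeasure.Build _ _ _ mu mu0 mu_ge0 mu_sigma_additive.

End total_space.

Section dynamics.
Context (R : realType) (d1 d2 : nat) (P : phase_space R d1 d2).
Local Notation Zd := 'rV[int]_(d1 + d2).
Local Notation Rd := 'rV[R]_(d1 + d2).
Local Notation X := (borel (total_space P)).
Local Notation M := (regular_fiber P).
Local Notation mu := (@mu R d1 d2 P).

Definition preserves_mu (T : X -> X) : Prop :=
  measurable_fun [set: X] T /\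
  forall A : set X, measurable A -> mu (T @^-1` A) = mu A.

Definition cell_index (x : X) : Zd :=
  match projT1 x with inl z => val z | inr z => val z end.

Definition region (S : set Zd) : set X := cell_index @^-1` S.

(* The pair (y(x), z(x)); None is the label (oo, oo). *)
Definition coord (x : X) : option (M * Zd) :=
  let: existT i y := x in
  match i return fiber i -> option (M * Zd) with
  | inl z => fun y => Some (y, val z)
  | inr _ => fun _ => None
  end y.

(* psi(y(x)) 1_{z(x) = k} *)
Definition cell_obs (psi : M -> R) (k : Zd) (x : X) : R :=
  if coord x is Some (y, z) then psi y * (z == k)%:R else 0.

(* The measure phi d nu_i, on the cell i, evaluated at F. *)
Definition nubar (i : cell P) (phi : fiber i -> R) (F : X -> R) : R :=
  \int[cell_measure i]_y (phi y * F (existT _ i y)).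

Definition mean (i : cell P) (phi : fiber i -> R) : R :=
  \int[cell_measure i]_y phi y.

Definition nu_mean (psi : M -> R) : R := \int[nu P]_y psi y.

(* A bounded continuous probability density on R_+^d1 x R^d2. *)
Definition limit_density (p : Rd -> R) : Prop :=
  [/\ {within orthant, continuous p},
      exists K : R, forall x, orthant x -> p x <= K,
      forall x, orthant x -> 0 <= p x &
      integral_Rn (EFin \o (p \_ orthant)) = 1%E].

Definition errorA (T : X -> X) (L : nat -> R) (p : Rd -> R) (eps r : R)
    (n : nat) : set R :=
  [set e | exists (phi psi : M -> R) (w : regular_cell P) (z : Rd),
    let u := z - (L n)^-1 *: toR R (val w) in
    [/\ lip_ball r phi, lip_ball r psi,
        [/\ orthant z, orthant u & `|u| < r],
        ((eps * L n)%:E < dist_set (L n *: z) (exc P))%E &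
        e = `| L n ^+ (d1 + d2) *
               @nubar (inl w) phi
                 (cell_obs psi (ceil_vec (L n *: z)) \o iter n T)
               - p u * nu_mean psi * nu_mean phi |] ].

Definition errorB (T : X -> X) (L : nat -> R) (p : Rd -> R)
    (w : exc_cell P) (phi : exc_fiber w -> R) (eps r : R)
    (n : nat) : set R :=
  [set e | exists (psi : M -> R) (z : Rd),
    [/\ lip_ball r psi, orthant z, `|z| < r,
        ((eps * L n)%:E < dist_set (L n *: z) (exc P))%E &
        e = `| L n ^+ (d1 + d2) *
               @nubar (inr w) phi
                 (cell_obs psi (ceil_vec (L n *: z)) \o iter n T)
               - p z * nu_mean psi * @mean (inr w) phi |] ].

Definition AMLLT (T : X -> X) : Prop :=
  exists (L : nat -> R) (p : Rd -> R),
  [/\ forall n, 0 < L n,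
      L n @[n --> \oo] --> +oo,
      limit_density p,
      forall eps r : R, 0 < eps ->
        sup0 (errorA T L p eps r n) @[n --> \oo] --> 0%E &
      forall (w : exc_cell P) (phi : exc_fiber w -> R), is_lipschitz phi ->
      forall eps r : R, 0 < eps ->
        sup0 (errorB T L p phi eps r n) @[n --> \oo] --> 0%E].

Definition cube (z : Zd) (w : nat) : set X := region (cube_cells z w).

Definition central_cubes : set (set X) :=
  [set V | exists (z : Zd) (w : nat),
    [/\ (0 < w)%N, cube_cells z w `<=` cells,
        cube_cells z w origin_cell & V = cube z w]].

Definition average (V : set X) (F : X -> R) : R :=
  (fine (mu V))^-1 * \int[mu]_(x in V) F x.

(* Distinct cells are at distance bounded below, so uniform continuity only
   involves pairs of points of a same cell. *)
Definition bounded_unif_continuous (Phi : X -> R) : Prop :=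
  (exists K : R, forall x, `|Phi x| <= K) /\
  forall e : R, 0 < e -> exists2 delta : R, 0 < delta &
    forall (i : cell P) (x y : fiber i), mdist x y < delta ->
      `|Phi (existT _ i x) - Phi (existT _ i y)| < e.

Definition G_O (Phi : X -> R) (Phibar : R) : Prop :=
  bounded_unif_continuous Phi /\
  forall a b : Rd, (forall j, a 0 j < b 0 j) -> orthant a ->
    (\prod_j (b 0 j * N%:R - a 0 j * N%:R))^-1 *
      \int[mu]_(x in region (scaled_box a b N)) Phi x @[N --> \oo] --> Phibar.

Definition G_AO (Phi : X -> R) (Phibar : R) : Prop :=
  bounded_unif_continuous Phi /\
  forall eps : R, 0 < eps -> exists b B0 : nat, [/\ (0 < b)%N, (0 < B0)%N &
    forall B : nat, (B0 < B)%N ->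
      (1 - eps) * B%:R ^+ (d1 + d2) <
      (nb_points (window R b B `&`
         [set z | cube_cells z b `<=` cells /\
                  `|average (cube z b) Phi - Phibar| <= eps]))%:R].

Definition local_global_mixing_GO (T : X -> X) : Prop :=
  forall (phi Phi : X -> R) (Phibar : R),
    mu.-integrable [set: X] (EFin \o phi) -> G_O Phi Phibar ->
    \int[mu]_x (phi x * Phi (iter n T x)) @[n --> \oo] -->
      (\int[mu]_x phi x) * Phibar.

(* Upper and lower limits as mu(V) --> oo over a family of sets V. *)
Definition limsup_large (VV : set (set X)) (F : set X -> R) : \bar R :=
  ereal_inf [set ereal_sup [set (F V)%:E | V in VV `&` [set V | K%:E < mu V]%E]
            | K in [set: R]].

Definition liminf_large (VV : set (set X)) (F : set X -> R) : \bar R :=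
  ereal_sup [set ereal_inf [set (F V)%:E | V in VV `&` [set V | K%:E < mu V]%E]
            | K in [set: R]].

Definition global_global_mixing_GAO (T : X -> X) : Prop :=
  forall (Phi1 Phi2 : X -> R) (Phibar1 Phibar2 : R),
    G_AO Phi1 Phibar1 -> G_AO Phi2 Phibar2 ->
    let corr n V := average V (fun x => Phi1 x * Phi2 (iter n T x)) in
    limsup_large central_cubes (corr n) @[n --> \oo] -->
      (Phibar1 * Phibar2)%:E /\
    liminf_large central_cubes (corr n) @[n --> \oo] -->
      (Phibar1 * Phibar2)%:E.

End dynamics.

(* Main.v *)
Require Import Defs.
From mathcomp Require Import all_boot all_order all_algebra finmap.
From mathcomp Require Import zify ring lra.
From mathcomp Require Import all_classical all_reals all_analysis.
From mathcomp Require Import measurable_realfun sigT_topology.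

Set Implicit Arguments.
Unset Strict Implicit.
Unset Printing Implicit Defensive.

Import Order.TTheory GRing.Theory Num.Theory.
Import numFieldNormedType.Exports.

Local Open Scope classical_set_scope.
Local Open Scope ring_scope.

(** Only lower bounds need proof.  If [Phi] is nonnegative, bounded by [K], and
    has mean [gamma], a lower bound for the limit of the integrals of
    [phi * Phi \o T^n] in terms of [gamma], applied both to [Phi] and to
    [K - Phi], gives the limit itself; no estimate of the mass that escapes to
    infinity or to the exceptional cells is needed.

    The density [p] has lower Darboux sums close to [1]: there are finitely many
    cubes [h (m + [0, 1)^d)] in the orthant, with constants [c m] below [p] on
    them, such that [h^d * \sum c m > 1 - e] ([density_lower_step], by monotone
    convergence for the iterated integral).  Summing the local limit estimate
    over the integer points [k] of the cubes scaled by [L n], and away from the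
    exceptional cells, bounds the integral of [phi * Phi \o T^n] on one cell
    from below by the sum over [m] of [c m] times the mean of [phi] times the
    average of the cell means of [Phi] over the corresponding box of side about
    [L n * h] ([core_lower_average]).  The restrictions of [Phi] to the cells
    are first replaced by uniformly Lipschitz minorants, which are
    inf-convolutions, since the estimate is uniform on Lipschitz balls.

    Local global mixing: for an averaging [Phi] those box averages converge to
    [h^d * gamma] ([box_limit_GO]); discarding the points close to the
    exceptional cells costs little, by the smallness of that set.  This settles
    the case of a Lipschitz [phi] on one cell ([cell_limit]).  The integrable
    functions on a cell are reached through a Dynkin class argument
    ([null_limit_integrable]), and those on the whole space by cutting off
    ([null_limit_total]).

    Global global mixing: the lower bound is summed over the cells [w] of a cube
    of side [W], [n] being fixed.  For a fixed side [b], most boxes of side [b]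
    consist of regular cells far from the exceptional ones and carry an average
    of [Phi2] close to [gamma2] ([almost_average_GAO]); exchanging the sum over
    [w] with the sum inside the box of side [L n * h] brings in all the
    translates of that box, so that the bad boxes have a negligible weight when
    [W] is large ([double_sum]).  The same covering argument handles the average
    of [Phi1] ([density_sum]).  *)

(** * Lipschitz approximation and boxes of integer points *)

Section infconv.
Context (R : realType) (M : metricType R).
Implicit Types (f : M -> R) (x y : M).

(** The inf-convolution of [f] with [K] times the distance: the largest
    [K]-Lipschitz function below [f], when [f] is bounded below. *)
Definition infconv (K : R) f x : R :=
  inf [set f y + K * mdist x y | y in [set: M]].

Section nonneg.
Variables (K : R) (f : M -> R).
Hypotheses (K0 : 0 <= K) (f0 : forall x, 0 <= f x).

Lemma infconv_lbound x y : infconv K f x <= f y + K * mdist x y.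
Proof.
apply: ge_inf; last by exists y.
by exists 0 => _ [z _ <-]; rewrite addr_ge0// mulr_ge0// mdist_ge0.
Qed.

Lemma infconv_glb x c :
  (forall y, c <= f y + K * mdist x y) -> c <= infconv K f x.
Proof.
move=> h; apply: lb_le_inf; first by exists (f x + K * mdist x x), x.
by move=> _ [y _ <-].
Qed.

Lemma infconv_ge0 x : 0 <= infconv K f x.
Proof. by apply: infconv_glb => y; rewrite addr_ge0// mulr_ge0// mdist_ge0. Qed.

Lemma infconv_le x : infconv K f x <= f x.
Proof. by have := infconv_lbound x x; rewrite mdistxx mulr0 addr0. Qed.

Lemma infconv_lipschitz x y :
  `|infconv K f x - infconv K f y| <= K * mdist x y.
Proof.
wlog suff h : x y / infconv K f x <= infconv K f y + K * mdist x y.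
  have := h x y; have := h y x; rewrite (metric_sym y x) ler_norml; lra.
rewrite -lerBlDr; apply: infconv_glb => z; rewrite lerBlDr.
apply: (le_trans (infconv_lbound x z)); rewrite -addrA lerD2l -mulrDr.
by rewrite ler_wpM2l// addrC metric_triangle.
Qed.

(** For a function with values in [[0, C]], the inf-convolution with slope at
    least [C / delta] only sees the points at distance less than [delta]. *)
Lemma infconv_approx (e delta : R) (C : R) x : 0 <= e -> 
  (forall x, f x <= C) -> C <= K * delta ->
  (forall y, mdist x y < delta -> `|f x - f y| < e) ->
  f x <= infconv K f x + e.
Proof.
move=> e0 fC CK uc; rewrite -lerBlDr; apply: infconv_glb => y.
have [xy|xy] := ltP (mdist x y) delta.
  have := uc _ xy; rewrite ltr_norml => /andP[_ h].
  have : 0 <= K * mdist x y by rewrite mulr_ge0// mdist_ge0.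
  by move: h; lra.
have : K * delta <= K * mdist x y by rewrite ler_wpM2l.
by have := fC x; have := f0 y; lra.
Qed.

End nonneg.

Lemma lip_ballP (f : M -> R) (C K : R) : 0 <= K ->
  (forall x, `|f x| <= C) -> (forall x y, `|f x - f y| <= K * mdist x y) ->
  lip_ball (C + K) f.
Proof.
move=> K0 fC fK; split; first by exists K.
rewrite /lip_norm EFinD; apply: leeD; apply: ge_ereal_sup.
  by move=> _ [x _ <-]; rewrite lee_fin.
move=> _ [[x y] _ <-] /=; rewrite lee_fin.
have [->|xy] := eqVneq x y; first by rewrite subrr normr0 mul0r.
by rewrite ler_pdivrMr ?mdist_gt0.
Qed.

Lemma lip_ball_le (f : M -> R) (r s : R) : r <= s ->
  lip_ball r f -> lip_ball s f.
Proof. by move=> rs [lf nf]; split => //; rewrite (le_trans nf)// lee_fin. Qed.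

Lemma is_lipschitz_continuous (f : M -> R) : is_lipschitz f -> continuous f.
Proof.
move=> [K fK] x; apply/cvgrPdist_lt => e e0.
have K1 : 0 < `|K| + 1 by rewrite ltr_wpDl.
apply/metricType_numDomainType.nbhs_mdistP.
exists (e / (`|K| + 1)); first by rewrite /= divr_gt0.
move=> y /=; rewrite ltr_pdivlMr// => xy.
apply: le_lt_trans (fK x y) _; apply: le_lt_trans xy.
rewrite mulrC ler_wpM2l ?mdist_ge0//.
by rewrite (le_trans (ler_norm K))// lerDl.
Qed.

End infconv.

(** [box0 n l] lists the integer points [v] of dimension [n] with
    [0 <= v_j < l]. *)
Fixpoint box0 (n l : nat) : seq 'rV[int]_n :=
  match n return seq 'rV[int]_n with
  | 0 => [:: 0]
  | m.+1 => [seq row_mx (const_mx i%:Z : 'rV[int]_1) v : 'rV[int]_m.+1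
            | i <- iota 0 l, v <- box0 m l]
  end.

Lemma size_box0 n l : size (box0 n l) = (l ^ n)%N.
Proof.
elim: n => [|n IH]; first by rewrite expn0.
by rewrite /= size_allpairs size_iota IH expnS.
Qed.

Lemma row_mx_const0 (A : Type) n (t : A) (v : 'rV[A]_n) :
  (row_mx (const_mx t : 'rV_1) v : 'rV[A]_n.+1) 0 0 = t.
Proof.
have -> : (0 : 'I_n.+1) = lshift n (0 : 'I_1) by exact/val_inj.
by rewrite (@row_mxEl _ 1 1 n) mxE.
Qed.

Lemma row_mx_constS (A : Type) n (t : A) (v : 'rV[A]_n) (j : 'I_n) :
  (row_mx (const_mx t : 'rV_1) v : 'rV[A]_n.+1) 0 (lift 0 j) = v 0 j.
Proof.
have -> : lift 0 j = rshift 1 j by exact/val_inj.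
by rewrite (@row_mxEr _ 1 1 n).
Qed.

Lemma row_mx_const_inj (A : Type) n (t s : A) (v w : 'rV[A]_n) :
  (row_mx (const_mx t : 'rV_1) v : 'rV[A]_n.+1) = row_mx (const_mx s : 'rV_1) w ->
  t = s /\ v = w.
Proof.
move=> e; split; first by rewrite -(row_mx_const0 t v) e row_mx_const0.
by apply/rowP => j; rewrite -(row_mx_constS t v) e row_mx_constS.
Qed.

Lemma mem_box0 n l (v : 'rV[int]_n) :
  (v \in box0 n l) = [forall j, (0 <= v 0 j < l%:Z)].
Proof.
elim: n v => [|n IH] v.
  rewrite /= inE; have -> : v = 0 by apply/rowP => -[].
  by rewrite eqxx; symmetry; apply/forallP => -[].
apply/idP/forallP.
  case/allpairsP => -[i w] /= [] /[!mem_iota] /= il /[!IH] /forallP wl ->.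
  move=> j; have [k|] := unliftP 0 j => ->.
    by rewrite row_mx_constS.
  by rewrite row_mx_const0; lia.
move=> h; apply/allpairsP; exists (absz (v 0 0), \row_j v 0 (lift 0 j)) => /=.
split.
- by rewrite mem_iota/=; have := h 0; lia.
- by rewrite IH; apply/forallP => j; rewrite mxE.
- apply/rowP => j; have [k|] := unliftP 0 j => ->.
    by rewrite row_mx_constS mxE.
  by rewrite row_mx_const0; have := h 0; lia.
Qed.

Lemma box0P n l (v : 'rV[int]_n) :
  reflect (forall j, 0 <= v 0 j < l%:Z) (v \in box0 n l).
Proof. by rewrite mem_box0; apply: (iffP forallP). Qed.

Lemma box0_uniq n l : uniq (box0 n l).
Proof.
elim: n => [//|n IH] /=; rewrite allpairs_uniq ?iota_uniq//.
move=> [i v] [j w] _ _ e.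
by have [[->] ->] := @row_mx_const_inj int n i%:Z j%:Z v w e.
Qed.

(** The box of side [l] with lower corner [a]. *)
Definition zbox n (a : 'rV[int]_n) l := [seq a + v | v <- box0 n l].

Lemma zboxP n (a : 'rV[int]_n) l (v : 'rV[int]_n) :
  reflect (forall j, a 0 j <= v 0 j < a 0 j + l%:Z) (v \in zbox a l).
Proof.
apply: (iffP mapP) => [[w /box0P wl ->] j|h].
  rewrite mxE; move: (wl j); move: (a 0 j) (w 0 j) => s t; lia.
exists (v - a); last by rewrite addrC subrK.
by apply/box0P => j; rewrite !mxE; move: (h j); move: (a 0 j) (v 0 j) => s t; lia.
Qed.

Lemma zbox_uniq n (a : 'rV[int]_n) l : uniq (zbox a l).
Proof. by rewrite map_inj_uniq ?box0_uniq// => x y /addrI. Qed.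

Lemma size_zbox n (a : 'rV[int]_n) l : size (zbox a l) = (l ^ n)%N.
Proof. by rewrite size_map size_box0. Qed.

Lemma big_zbox (R : nmodType) n (a : 'rV[int]_n) l (f : 'rV[int]_n -> R) :
  \sum_(k <- zbox a l) f k = \sum_(u <- box0 n l) f (a + u).
Proof. by rewrite big_map. Qed.

Section sums.
Context (R : realDomainType) (I : eqType).
Implicit Types (s t : seq I) (f : I -> R).

Lemma ler_sum_subset s t f : uniq s -> uniq t -> {subset s <= t} ->
  (forall i, i \in t -> 0 <= f i) ->
  \sum_(i <- s) f i <= \sum_(i <- t) f i.
Proof.
move=> us ut st f0.
have -> : \sum_(i <- s) f i = \sum_(i <- t | i \in s) f i.
  rewrite -[RHS]big_filter; apply: perm_big; apply: uniq_perm => //.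
    exact: filter_uniq.
  by move=> i; rewrite mem_filter; case: (boolP (i \in s)) => // /st ->.
rewrite [leRHS](bigID (mem s))/= lerDl big_seq_cond sumr_ge0//.
by move=> i /andP[it _]; exact: f0.
Qed.

Lemma sumr_const_seq s (c : R) : \sum_(i <- s) c = c * (size s)%:R.
Proof. by rewrite big_const_seq count_predT iter_addr addr0 mulr_natr. Qed.

Lemma sumr_count s (p : pred I) : \sum_(i <- s) (p i)%:R = (count p s)%:R :> R.
Proof.
elim: s => [|i s IH]; first by rewrite big_nil.
by rewrite big_cons IH natrD.
Qed.

Lemma count_size_le s t (p : pred I) : uniq s ->
  (forall i, i \in s -> p i -> i \in t) -> (count p s <= size t)%N.
Proof.
move=> us st; rewrite -size_filter; apply: uniq_leq_size.
  exact: filter_uniq.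
by move=> i; rewrite mem_filter => /andP[pi is_]; exact: st.
Qed.

End sums.

(** Averaging over the translates of a box of side [b] inside a box of side [l]:
    each of the [b ^ n] translation vectors maps the smaller set of corners into
    the box. *)
Lemma sum_box_average (R : realDomainType) n l b (f : 'rV[int]_n -> R)
    (x : 'rV[int]_n) :
  (b <= l)%N -> (forall k, 0 <= f k) ->
  \sum_(u <- box0 n (l - b)) \sum_(v <- box0 n b) f (x + u + v) <=
  (b ^ n)%:R * \sum_(u <- box0 n l) f (x + u).
Proof.
move=> bl f0; rewrite exchange_big/=.
rewrite mulrC -size_box0 -(sumr_const_seq (box0 n b)).
rewrite big_seq [leRHS]big_seq; apply: ler_sum => v /box0P vb.
have -> : \sum_(u <- box0 n (l - b)) f (x + u + v) =
    \sum_(u <- [seq u + v | u <- box0 n (l - b)]) f (x + u).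
  by rewrite big_map; apply: eq_bigr => u _; rewrite addrA.
apply: ler_sum_subset; rewrite ?box0_uniq//.
  by rewrite map_inj_uniq ?box0_uniq// => ? ? /addIr.
move=> _ /mapP[u /box0P ul ->]; apply/box0P => j; rewrite mxE.
by move: (ul j) (vb j); move: (u 0 j) (v 0 j) => s t; lia.
Qed.

(** * Lower Darboux sums of the limit density *)

Section iterated_integral.
Context (R : realType).

(** The section of [f] at first coordinate [t]. *)
Definition slice n (T : Type) (f : 'rV[R]_n.+1 -> T) (t : R) (v : 'rV[R]_n) : T :=
  f (row_mx (const_mx t : 'rV[R]_1) v).

(** All the partial iterated integrals of [f] are measurable. *)
Fixpoint Rn_measurable n : ('rV[R]_n -> \bar R) -> Prop :=
  match n return ('rV[R]_n -> \bar R) -> Prop with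
  | 0 => fun=> True
  | m.+1 => fun f =>
      measurable_fun [set: R] (fun t => integral_Rn (slice f t)) /\
      forall t, Rn_measurable (slice f t)
  end.

Lemma integral_Rn_ge0 n (f : 'rV[R]_n -> \bar R) :
  (forall x, (0 <= f x)%E) -> (0 <= integral_Rn f)%E.
Proof.
elim: n f => [|n IH] f f0 //=.
by apply: integral_ge0 => t _; apply: IH.
Qed.

Lemma le_integral_Rn n (f g : 'rV[R]_n -> \bar R) :
  Rn_measurable f -> Rn_measurable g -> (forall x, (0 <= f x)%E) ->
  (forall x, (f x <= g x)%E) -> (integral_Rn f <= integral_Rn g)%E.
Proof.
elim: n f g => [|n IH] f g mf mg f0 fg //=.
apply: ge0_le_integral => //.
- by move=> t _; apply: integral_Rn_ge0.
- exact: mf.1.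
- exact: mg.1.
- by move=> t _; apply: IH => //; [exact: mf.2 | exact: mg.2].
Qed.

(** Monotone convergence for iterated integrals. *)
Lemma integral_Rn_monotone n (u : nat -> 'rV[R]_n -> \bar R) f :
  (forall k, Rn_measurable (u k)) -> (forall k x, (0 <= u k x)%E) ->
  (forall x, {homo u^~ x : k l / (k <= l)%N >-> (k <= l)%E}) ->
  (forall x, u^~ x @ \oo --> f x) ->
  Rn_measurable f /\ integral_Rn (u k) @[k --> \oo] --> integral_Rn f.
Proof.
elim: n u f => [|n IH] u f mu u0 ndu uf; first by split => //=; exact: uf.
have hS t : Rn_measurable (slice f t) /\
    integral_Rn (slice (u k) t) @[k --> \oo] --> integral_Rn (slice f t).
  apply: IH => [k|k x|x|x]; rewrite /slice.
  - exact: (mu k).2.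
  - exact: u0.
  - exact: ndu.
  - exact: uf.
have nd t : {homo (fun k => integral_Rn (slice (u k) t)) :
    k l / (k <= l)%N >-> (k <= l)%E}.
  move=> k l kl; apply: le_integral_Rn => [||x|x].
  - exact: (mu k).2.
  - exact: (mu l).2.
  - exact: u0.
  - exact: ndu.
have lf : (fun t => integral_Rn (slice f t)) =
    (fun t => limn (fun k => integral_Rn (slice (u k) t))).
  by apply/funext => t; apply/esym/cvg_lim => //; exact: (hS t).2.
have mG k : measurable_fun [set: R] (fun t => integral_Rn (slice (u k) t)).
  exact: (mu k).1.
split; first split.
- apply: (emeasurable_fun_cvg (fun k t => integral_Rn (slice (u k) t))).
    exact: mG.
  by move=> t _; exact: (hS t).2.
- by move=> t; exact: (hS t).1.
- rewrite /= -/(slice f _) lf.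
  apply: cvg_monotone_convergence => [//|k|k t _|t _].
  + exact: mG.
  + exact: integral_Rn_ge0.
  + exact: nd.
Qed.


(** The point of [h Z^n] indexing the half-open cube of side [h] around [x]. *)
Definition grid n (h : R) (x : 'rV[R]_n) : 'rV[int]_n :=
  \row_j Num.floor (x 0 j / h).

(** The sum of [c] over the integer points of [[-N, N)^n]. *)
Definition sumbox n N (c : 'rV[int]_n -> R) : R :=
  \sum_(v <- box0 n (N + N)) c (const_mx (- N%:Z) + v).

Lemma slice_grid n (h : R) (c : 'rV[int]_n.+1 -> R) t :
  slice (fun x => (c (grid h x))%:E) t =
  (fun v => (c (row_mx (const_mx (Num.floor (t / h)) : 'rV[int]_1) (grid h v)
               : 'rV[int]_n.+1))%:E).
Proof.
apply/funext => v; rewrite /slice; congr (c _)%:E.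
apply/rowP => j; rewrite mxE.
have [k|] := unliftP 0 j => ->; last by rewrite !row_mx_const0.
by rewrite !row_mx_constS mxE.
Qed.

Lemma row_mx_const_add n (s : int) (t : nat) (v : 'rV[int]_n) :
  (const_mx s + row_mx (const_mx t%:Z : 'rV[int]_1) v : 'rV[int]_n.+1) =
  row_mx (const_mx (s + t%:Z) : 'rV[int]_1) (const_mx s + v).
Proof.
apply/rowP => j; rewrite mxE mxE.
have [k|] := unliftP 0 j => ->; last by rewrite !row_mx_const0.
by rewrite !row_mx_constS !mxE.
Qed.

Lemma sumbox_row n N (c : 'rV[int]_n.+1 -> R) :
  sumbox N c = \sum_(i <- iota 0 (N + N))
    sumbox N (fun v => c (row_mx (const_mx (- N%:Z + i%:Z) : 'rV[int]_1) v)).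
Proof.
rewrite /sumbox /= big_allpairs_dep; apply: eq_bigr => i _.
by apply: eq_bigr => v _; rewrite row_mx_const_add.
Qed.

(** The indicator of an interval of the grid. *)
Lemma floor_indic (h t : R) (j : int) : 0 < h ->
  (Num.floor (t / h) == j)%:R =
  \1_(`[(j%:~R * h), ((j + 1)%:~R * h)[ : set R) t :> R.
Proof.
move=> h0; rewrite indicE mem_setE in_itv/= floor_eq.
by rewrite ler_pdivlMr// ltr_pdivrMr.
Qed.

(** The iterated integral of a function that is constant on each cube of a grid. *)
Lemma integral_Rn_grid n (h : R) N (c : 'rV[int]_n -> R) : 0 < h ->
  (forall m, 0 <= c m) ->
  (forall m, c m != 0 -> m \in zbox (const_mx (- N%:Z)) (N + N)) ->
  Rn_measurable (fun x => (c (grid h x))%:E) /\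
  integral_Rn (fun x => (c (grid h x))%:E) = (h ^+ n * sumbox N c)%:E.
Proof.
move=> h0; elim: n c => [|n IH] c c0 cN.
  split => //=; rewrite expr0 mul1r /sumbox/= big_seq1; congr (c _)%:E.
  by apply/rowP => -[].
pose C (j : int) := sumbox N (fun v => c (row_mx (const_mx j : 'rV[int]_1) v)).
have hS t : Rn_measurable (slice (fun x => (c (grid h x))%:E) t) /\
    integral_Rn (slice (fun x => (c (grid h x))%:E) t) =
    (h ^+ n * C (Num.floor (t / h)))%:E.
  rewrite slice_grid; apply: IH => [m|m /cN /zboxP mN]; first exact: c0.
  by apply/zboxP => j; have := mN (lift 0 j); rewrite row_mx_constS !mxE.
have CN j : ~~ (- N%:Z <= j < N%:Z) -> C j = 0.
  move=> jN; rewrite /C /sumbox big1// => v _; apply/eqP; apply: contraNT jN.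
  by move=> /cN /zboxP /(_ 0); rewrite row_mx_const0 mxE; lia.
pose s := iota 0 (N + N).
have CE t : (h ^+ n * C (Num.floor (t / h)))%:E = (\sum_(i <- s)
    (h ^+ n * C (- N%:Z + i%:Z))%:E *
    (\1_(`[((- N%:Z + i%:Z)%:~R * h), ((- N%:Z + i%:Z + 1)%:~R * h)[ : set R) t)%:E)%E.
  rewrite sumEFin; congr EFin; under eq_bigr do rewrite -floor_indic//.
  set f := Num.floor _.
  have [fN|fN] := boolP (- N%:Z <= f < N%:Z); last first.
    rewrite CN// mulr0 big_seq big1// => i /[!mem_iota] iN.
    by rewrite (_ : (f == _) = false) ?mulr0//; apply/eqP; lia.
  rewrite (bigD1_seq (absz (f + N%:Z))) ?iota_uniq//=; last first.
    by rewrite mem_iota; lia.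
  have -> : - N%:Z + `|(f + N%:Z)%R|%N = f by lia.
  rewrite eqxx mulr1 big1 ?addr0// => i iN.
  by rewrite (_ : (f == _) = false) ?mulr0//; apply/eqP; lia.
have hn0 : 0 <= h ^+ n by rewrite exprn_ge0// ltW.
have C0 j : 0 <= C j by apply: sumr_ge0 => v _; exact: c0.
have fE : (fun t => integral_Rn (slice (fun x => (c (grid h x))%:E) t)) =
  (fun t => \sum_(i <- s)
    (h ^+ n * C (- N%:Z + i%:Z))%:E *
    (\1_(`[((- N%:Z + i%:Z)%:~R * h), ((- N%:Z + i%:Z + 1)%:~R * h)[ : set R) t)%:E)%E.
  by apply/funext => t; rewrite (hS t).2 CE.
have mI (i : nat) : measurable_fun [set: R] (fun t =>
    (h ^+ n * C (- N%:Z + i%:Z))%:E *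
    (\1_(`[((- N%:Z + i%:Z)%:~R * h), ((- N%:Z + i%:Z + 1)%:~R * h)[ : set R) t)%:E)%E.
  apply: emeasurable_funM => //.
  by apply/measurable_EFinP; exact: measurable_indic.
split; first split.
- by rewrite fE; exact: emeasurable_sum.
- by move=> t; exact: (hS t).1.
rewrite /= -/(slice (fun x => (c (grid h x))%:E) _) fE ge0_integral_sum//; last first.
  by move=> i t _; rewrite mule_ge0// lee_fin mulr_ge0.
transitivity (\sum_(i <- s) (h ^+ n * C (- N%:Z + i%:Z) * h)%:E)%E.
  apply: eq_bigr => i _; rewrite ge0_integralZl_EFin//.
  all: try by apply/measurable_EFinP; exact: measurable_indic.
  all: try by move=> t _; rewrite lee_fin.
  all: try exact: mulr_ge0.
  rewrite integral_indic// setIT.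
  have := @lebesgue_measure_itv R
    `[((- N%:Z + i%:Z)%:~R * h), ((- N%:Z + i%:Z + 1)%:~R * h)[.
  rewrite /= lte_fin ltr_pM2r// ltr_int ltrDl ltr01 -EFinB => ->.
  rewrite -EFinM; congr EFin.
  by rewrite [(_ + 1)%:~R]rmorphD/=; ring.
rewrite sumEFin; congr EFin; rewrite sumbox_row exprSr mulr_sumr.
by apply: eq_bigr => i _; rewrite /C; ring.
Qed.

Definition dyad (k : nat) : R := (2 ^+ k)^-1.

(** The infimum of [f] on the dyadic cube of side [2^-k] with index [m], replaced
    by [0] outside [[-k, k)^n]. *)
Definition lower_coef n (f : 'rV[R]_n -> R) k (m : 'rV[int]_n) : R :=
  if m \in zbox (const_mx (- (k * 2 ^ k)%N%:Z)) (k * 2 ^ k + k * 2 ^ k)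
  then inf [set f y | y in [set y | grid (dyad k) y = m]] else 0.

Lemma dyad_gt0 k : 0 < dyad k.
Proof. by rewrite /dyad invr_gt0 exprn_gt0. Qed.

Lemma grid_dyadS n k (x y : 'rV[R]_n) :
  grid (dyad k.+1) x = grid (dyad k.+1) y -> grid (dyad k) x = grid (dyad k) y.
Proof.
move=> /rowP e; apply/rowP => j; move: (e j); rewrite !mxE /dyad !invrK.
rewrite exprS !(mulrCA _ 2); move: (x 0 j * _) (y 0 j * _) => s t st.
apply: floor_def; have /andP[l u] := floor_itv t.
have h1 : (Num.floor t * 2 <= Num.floor (2 * s)).
  by rewrite st floor_ge_int rmorphM/= mulrC; lra.
have h2 : (Num.floor (2 * s) < (Num.floor t + 1) * 2).
  by rewrite st floor_lt_int rmorphM/= mulrC; lra.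
move: h1 h2; rewrite floor_ge_int floor_lt_int !rmorphM/=; lra.
Qed.

Lemma grid_dyad_in n k (x : 'rV[R]_n) :
  (grid (dyad k) x \in zbox (const_mx (- (k * 2 ^ k)%N%:Z)) (k * 2 ^ k + k * 2 ^ k))
  = [forall j, (- k%:R <= x 0 j < k%:R)].
Proof.
apply/zboxP/forallP => h j; have {h} := h j; rewrite !mxE /dyad invrK.
  all: rewrite floor_ge_int [_ + (_ + _)%N%:Z](_ : _ = (k * 2 ^ k)%N%:Z); try lia.
  all: rewrite floor_lt_int rmorphN/= -!pmulrn natrM natrX -mulNr.
  all: by rewrite ler_pM2r ?exprn_gt0// ltr_pM2r ?exprn_gt0.
Qed.


Section lower_sums.
Variables (n : nat) (f : 'rV[R]_n -> R).
Hypothesis f0 : forall x, 0 <= f x.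

Lemma lower_coef_ge0 k m : 0 <= lower_coef f k m.
Proof.
rewrite /lower_coef; case: ifPn => // _.
set S := [set f y | y in _].
have [->|S0] := eqVneq S set0; first by rewrite inf0.
by apply: lb_le_inf; [exact/set0P|move=> _ [y _ <-]].
Qed.

Lemma lower_coef_le k x : lower_coef f k (grid (dyad k) x) <= f x.
Proof.
rewrite /lower_coef; case: ifPn => // _; apply: ge_inf; last by exists x.
by exists 0 => _ [y _ <-].
Qed.

Lemma lower_coefS k x : lower_coef f k (grid (dyad k) x) <=
  lower_coef f k.+1 (grid (dyad k.+1) x).
Proof.
rewrite {1}/lower_coef; case: ifPn => [kx|_]; last exact: lower_coef_ge0.
rewrite /lower_coef ifT; last first.
  move: kx; rewrite !grid_dyad_in => /forallP kx; apply/forallP => j.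
  by have := kx j; rewrite -natr1; lra.
apply: lb_le_inf; first by exists (f x), x.
move=> _ [y yx <-]; apply: ge_inf; first by exists 0 => _ [z _ <-].
by exists y => //; exact: grid_dyadS.
Qed.

(** A nonnegative function that is, at each point, lower semicontinuous along
    the dyadic cubes that contain it, is approximated from below by its lower Darboux
    sums. *)
Lemma lower_sum_gt (a : R) :
  (a%:E < integral_Rn (EFin \o f))%E ->
  (forall x e, 0 < e -> exists k0, forall k y, (k0 <= k)%N ->
     grid (dyad k) y = grid (dyad k) x -> f x - e <= f y) ->
  exists k, a < dyad k ^+ n * sumbox (k * 2 ^ k) (lower_coef f k).
Proof.
move=> ai lsc; pose u k x := (lower_coef f k (grid (dyad k) x))%:E.
have hu k : Rn_measurable (u k) /\ integral_Rn (u k) =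
    (dyad k ^+ n * sumbox (k * 2 ^ k) (lower_coef f k))%:E.
  apply: integral_Rn_grid => [|m|m]; first exact: dyad_gt0.
    exact: lower_coef_ge0.
  by rewrite /lower_coef; case: ifPn => //; rewrite eqxx.
have [] := @integral_Rn_monotone n u (EFin \o f).
- by move=> k; exact: (hu k).1.
- by move=> k x; rewrite lee_fin lower_coef_ge0.
- move=> x; apply/nondecreasing_seqP => k; rewrite lee_fin; exact: lower_coefS.
- move=> x; apply: cvg_EFin; first by near=> k.
  apply/cvgrPdist_le => e e0; have [k0 hk] := lsc x e e0.
  near=> k; rewrite ger0_norm ?subr_ge0 ?lower_coef_le//=.
  rewrite /lower_coef ifT; last first.
    rewrite grid_dyad_in; apply/forallP => j.
    suff : `|x 0 j| < k%:R by rewrite ltr_norml => /andP[/ltW -> ->].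
    apply: lt_le_trans (archi_boundP (normr_ge0 _)) _; rewrite ler_nat.
    apply: leq_trans (@leq_bigmax _ (fun j : 'I_n => Num.bound `|x 0 j|%R) j) _.
    by near: k; exists (\max_(j < n) Num.bound `|x ord0 j|)%R.
  rewrite lerBlDr addrC -lerBlDr; apply: lb_le_inf; first by exists (f x), x.
  move=> _ [y yx <-]; apply: (hk k) => //.
  by near: k; exists k0.
move=> _ cu; apply: contrapT => /forallNP h; move: ai; apply/negP.
rewrite -leNgt -(cvg_lim _ cu)//; apply: lime_le; first by apply/cvg_ex; eexists; exact: cu.
by apply: nearW => k; rewrite (hu k).2 lee_fin leNgt; apply/negP; exact: h.
Unshelve. all: by end_near. Qed.

End lower_sums.

End iterated_integral.

Section density.
Context (R : realType) (d1 d2 : nat).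
Local Notation Rd := 'rV[R]_(d1 + d2).
Local Notation Zd := 'rV[int]_(d1 + d2).

(** The indices of the grid cubes contained in the orthant. *)
Definition zorthant (m : Zd) := [forall i : 'I_d1, 0 <= m 0 (lshift d2 i)].

Lemma dyad_le (delta : R) : 0 < delta ->
  exists k0, forall k, (k0 <= k)%N -> dyad R k <= delta.
Proof.
move=> d0; exists (Num.bound delta^-1) => k k0k.
rewrite /dyad -[leRHS]invrK lef_pV2 ?posrE ?invr_gt0 ?exprn_gt0//.
have di0 : 0 <= delta^-1 by rewrite invr_ge0 ltW.
apply: (le_trans (ltW (archi_boundP di0))).
by rewrite -natrX ler_nat (leq_trans k0k)// ltnW// ltn_expl.
Qed.

Lemma grid_bounds n (h : R) (x : 'rV[R]_n) j : 0 < h ->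
  (grid h x 0 j)%:~R * h <= x 0 j < (grid h x 0 j)%:~R * h + h.
Proof.
move=> h0; have /andP[l u] := floor_itv (x 0 j / h).
rewrite mxE -ler_pdivlMr// l/= -[X in _ < _ + X]mul1r -mulrDl -ltr_pdivrMr//.
by move: u; rewrite rmorphD.
Qed.

Lemma grid_close n (h : R) (x y : 'rV[R]_n) j : 0 < h ->
  grid h y = grid h x -> `|x 0 j - y 0 j| < h.
Proof.
move=> h0 yx; have := grid_bounds x j h0; have := grid_bounds y j h0.
rewrite yx; move: (_ * h) => q; rewrite ltr_norml; lra.
Qed.

Lemma grid_scale n (h : R) (m : 'rV[int]_n) : 0 < h ->
  grid h (h *: map_mx intr m) = m.
Proof.
move=> h0; apply/rowP => j; rewrite !mxE mulrAC divff ?mul1r ?gt_eqF//.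
exact: intrKfloor.
Qed.

Lemma orthant_grid (h : R) (x : Rd) : 0 < h ->
  zorthant (grid h x) <-> orthant x.
Proof.
move=> h0; split=> [/forallP m0 i|x0]; last first.
  by apply/forallP => i; rewrite mxE floor_ge0 divr_ge0 ?(ltW h0)//; exact: x0.
by have := m0 i; rewrite mxE floor_ge0 pmulr_lge0// invr_gt0.
Qed.

(** The half-open cubes of a grid lie inside the orthant or do not meet it; on the
    latter the extension of [p] by [0] vanishes somewhere, and the coefficient
    is [0]. *)
Lemma density_lower_step (p : Rd -> R) (e : R) : limit_density p -> 0 < e ->
  exists (h : R) (ms : seq Zd) (c : Zd -> R),
  [/\ 0 < h, uniq ms /\ forall m, 0 <= c m, forall m, m \in ms -> zorthant m,
      forall x, grid h x \in ms -> c (grid h x) <= p x &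
      1 - e < h ^+ (d1 + d2) * \sum_(m <- ms) c m].
Proof.
move=> [pcont _ p0 pint] e0; pose f := p \_ orthant.
have f0 x : 0 <= f x.
  by rewrite /f patchE; case: ifPn => // /[!inE] /p0.
have [||k] := @lower_sum_gt R _ f f0 (1 - e).
- by rewrite pint lte_fin ltrBlDr ltrDl.
- move=> x eps eps0.
  have [xO|xO] := pselect (orthant x); last first.
    exists 0%N => k y _ _; rewrite {1}/f patchE memNset// sub0r.
    by rewrite (le_trans _ (f0 y))// oppr_le0 ltW.
  have /subspace_continuousP /(_ x xO) /cvgrPdist_lt /(_ _ eps0) := pcont.
  rewrite near_withinE => /nbhs_ballP[delta /= delta0 px].
  have [k0 hk0] := dyad_le delta0; exists k0 => k y k0k yx.
  have dk := dyad_gt0 R k.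
  have yO : orthant y by apply/(orthant_grid y dk); rewrite yx; apply/orthant_grid.
  rewrite /f !patchE !mem_set//.
  have : ball x delta y.
    split=> // i j; rewrite ord1.
    by apply: (lt_le_trans (grid_close j dk _)) (hk0 _ k0k).
  move/px => /(_ yO); rewrite ltr_norml => /andP[_ /ltW].
  by rewrite lerBlDr lerBlDl addrC.
set N := (k * 2 ^ k)%N; set h := dyad R k; set c := lower_coef f k => hc.
have h0 : 0 < h by exact: dyad_gt0.
pose ms := [seq m <- zbox (const_mx (- N%:Z)) (N + N) | zorthant m].
exists h, ms, c; split => //.
- by split; [exact/filter_uniq/zbox_uniq|exact: lower_coef_ge0].
- by move=> m; rewrite mem_filter => /andP[].
- move=> x; rewrite mem_filter => /andP[/(orthant_grid _ h0) xO _].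
  by apply: (le_trans (lower_coef_le f0 k x)); rewrite /f patchE mem_set.
- rewrite (lt_le_trans hc)// ler_pM2l ?exprn_gt0//.
  rewrite big_filter [leRHS]big_mkcond/= big_zbox /sumbox.
  rewrite le_eqVlt; apply/orP; left; apply/eqP; apply: eq_bigr => v _.
  case: ifPn => // mO; apply/eqP; rewrite eq_le lower_coef_ge0// andbT.
  set m := _ + v in mO *; have := lower_coef_le f0 k (h *: map_mx intr m).
  rewrite grid_scale// {2}/f patchE memNset//.
  by move/(orthant_grid _ h0); rewrite grid_scale//; exact/negP.
Qed.

End density.

(** * Testing weak convergence on Lipschitz functions *)

Lemma continuous_borel (R : realType) (T : ptopologicalType) (f : T -> R) :
  continuous f -> measurable_fun [set: borel T] (f : borel T -> R).
Proof.
move=> /continuousP cf; apply: (measurability _ (RGenOpens.measurableE R)).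
move=> _ [_ [a [b ->] <-]]; rewrite setTI; apply: sub_sigma_algebra.
by apply: cf; exact: interval_open.
Qed.

Section bounded_integrands.
Context d (T : measurableType d) (R : realType) (m : {measure set T -> \bar R}).
Implicit Types (f g : T -> R) (D : set T).

Lemma integrable_mul_bounded D f g (K : R) : measurable D ->
  m.-integrable D (EFin \o f) ->
  measurable_fun D g -> (forall x, `|g x| <= K) ->
  m.-integrable D (EFin \o (fun x => f x * g x)).
Proof.
move=> mD fi mg gK.
have mf : measurable_fun D f by apply/measurable_EFinP; exact: measurable_int fi.
have := integrableZl mD K fi; apply: le_integrable => //.
  by apply/measurable_EFinP; exact: measurable_funM.
move=> x _ /=; rewrite lee_fin !normrM mulrC ler_wpM2r//.
by rewrite (le_trans (gK x))// ler_norm.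
Qed.

Lemma integrable_bounded D g (K : R) : measurable D -> (m D < +oo)%E ->
  measurable_fun D g -> (forall x, `|g x| <= K) ->
  m.-integrable D (EFin \o g).
Proof.
move=> mD Dfin mg gK.
have c1 : m.-integrable D (EFin \o cst 1 : T -> \bar R).
  apply/integrableP; split; first exact/measurable_EFinP.
  by rewrite /comp /=; under eq_integral do rewrite normr1; rewrite integral_cst// mul1e.
have := integrable_mul_bounded mD c1 mg gK.
by under [X in integrable _ _ (_ \o X) -> _]eq_fun do rewrite mul1r.
Qed.


Lemma norm_Rintegral_mul_le D f g (K : R) : measurable D ->
  m.-integrable D (EFin \o f) -> measurable_fun D g ->
  (forall x, `|g x| <= K) ->
  `|\int[m]_(x in D) (f x * g x)| <= K * \int[m]_(x in D) `|f x|.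
Proof.
move=> mD fi mg gK; have fgi := integrable_mul_bounded mD fi mg gK.
have fi' : m.-integrable D (EFin \o (fun x => `|f x|)) by exact: integrable_norm.
rewrite (le_trans (le_normr_Rintegral mD fgi))// -RintegralZl//.
apply: le_Rintegral => //.
- exact: (integrable_norm fgi).
- exact: (integrableZl mD K fi').
- by move=> x _; rewrite normrM mulrC ler_wpM2r.
Qed.

End bounded_integrands.

Section weak_convergence.
Context d (T : measurableType d) (R : realType) (m : {measure set T -> \bar R}).
Variables (g : nat -> T -> R) (K : R).
Hypotheses (mfin : (m setT < +oo)%E) (mg : forall n, measurable_fun setT (g n)).
Hypothesis gK : forall n x, `|g n x| <= K.

(** [f] integrates to zero, in the limit, against the sequence [g]. *)
Definition null_limit (f : T -> R) : Prop :=
  m.-integrable setT (EFin \o f) /\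
  \int[m]_x (f x * g n x) @[n --> \oo] --> (0 : R).

(** The class of the functions [f] with [null_limit f] is closed in L^1, since the
    sequence [g] is uniformly bounded. *)
Lemma null_limit_approx f : m.-integrable setT (EFin \o f) ->
  (forall e, 0 < e -> exists2 f', null_limit f' & \int[m]_x `|f x - f' x| <= e) ->
  null_limit f.
Proof.
move=> fi fapp; split => //; apply/cvgrPdist_le => e e0.
have K0 : 0 <= K by apply: le_trans (gK 0%N point); exact: normr_ge0.
have e2 : 0 < e / 2 / (K + 1) by rewrite !divr_gt0// ltr_wpDl.
have [f' [f'i f'cv] f'e] := fapp _ e2.
have e3 : 0 < e / 2 by rewrite divr_gt0.
move/cvgrPdist_le : f'cv => /(_ _ e3); apply: filterS => n.
rewrite !sub0r !normrN => f'n.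
have ffi : m.-integrable setT (EFin \o (fun x => f x - f' x)).
  exact: (integrableB measurableT fi f'i).
have -> : \int[m]_x (f x * g n x) =
    \int[m]_x ((f x - f' x) * g n x) + \int[m]_x (f' x * g n x).
  rewrite -RintegralD//.
  - by apply: eq_Rintegral => x _; rewrite -mulrDl subrK.
  - exact: (integrable_mul_bounded measurableT ffi (mg n) (gK n)).
  - exact: (integrable_mul_bounded measurableT f'i (mg n) (gK n)).
rewrite (splitr e) (le_trans (ler_normD _ _))// lerD//.
apply: (le_trans (norm_Rintegral_mul_le measurableT ffi (mg n) (gK n))).
apply: (@le_trans _ _ ((K + 1) * (e / 2 / (K + 1)))).
  by apply: ler_pM => //; [exact: Rintegral_ge0|rewrite lerDl].
by rewrite mulrC divfK// gt_eqF// ltr_wpDl.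
Qed.

Lemma null_limitD f h : null_limit f -> null_limit h ->
  null_limit (fun x => f x + h x).
Proof.
move=> [fi fcv] [hi hcv]; split; first exact: (integrableD measurableT fi hi).
have -> : (fun n => \int[m]_x ((f x + h x) * g n x)) =
    (fun n => \int[m]_x (f x * g n x) + \int[m]_x (h x * g n x)).
  apply/funext => n; rewrite -RintegralD//.
  - by apply: eq_Rintegral => x _; rewrite mulrDl.
  - exact: (integrable_mul_bounded measurableT fi (mg n) (gK n)).
  - exact: (integrable_mul_bounded measurableT hi (mg n) (gK n)).
by rewrite -[0 : R]addr0; exact: cvgD.
Qed.

Lemma null_limitZ c f : null_limit f -> null_limit (fun x => c * f x).
Proof.
move=> [fi fcv]; split; first exact: (integrableZl measurableT c fi).
have -> : (fun n => \int[m]_x (c * f x * g n x)) =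
    (fun n => c * \int[m]_x (f x * g n x)).
  apply/funext => n; rewrite -RintegralZl//.
    by apply: eq_Rintegral => x _; rewrite mulrA.
  exact: (integrable_mul_bounded measurableT fi (mg n) (gK n)).
by rewrite -[0 : R](mulr0 c); apply: cvgM => //; exact: cvg_cst.
Qed.

Lemma null_limit_sum (I : Type) (s : seq I) (f : I -> T -> R) :
  (forall i, null_limit (f i)) -> null_limit (fun x => \sum_(i <- s) f i x).
Proof.
move=> fcv; elim: s => [|i s IH].
  split.
    rewrite (_ : _ \o _ = cst 0%E); first exact: integrable0.
    by apply/funext => x; rewrite /= big_nil.
  apply: cvg_near_cst; apply: nearW => n.
  under eq_Rintegral do rewrite big_nil mul0r.
  by rewrite Rintegral_cst// mul0r.
under eq_fun do rewrite big_cons; exact: null_limitD.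
Qed.

(** Bounded pointwise limits preserve [null_limit], by dominated convergence. *)
Lemma null_limit_lim (u : nat -> T -> R) (f : T -> R) : measurable_fun setT f ->
  (forall k, measurable_fun setT (u k)) -> (forall k x, `|u k x| <= 1) ->
  (forall k, null_limit (u k)) -> (forall x, u^~ x @ \oo --> f x) ->
  null_limit f.
Proof.
move=> mf mu u1 unull uf.
have c1 : m.-integrable setT (EFin \o cst 1).
  by apply: (@integrable_bounded _ _ _ m setT (cst 1) 1) => // x; rewrite normr1.
have [||||fi dl _] := @dominated_convergence _ _ _ m setT measurableT
  (fun k => EFin \o u k) (EFin \o f) (EFin \o cst 1) _ _ _ c1 _.
- by move=> k; exact/measurable_EFinP.
- exact/measurable_EFinP.
- by apply: aeW => x _; apply: cvg_EFin; [exact: nearW|exact: uf].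
- by apply: aeW => x k _ /=; rewrite lee_fin.
apply: null_limit_approx => // e e0.
have := dl; move=> /fine_cvgP [_ /cvgrPdist_le /(_ _ e0)] [k _ /(_ k (leqnn _))] /=.
rewrite sub0r normrN => h; exists (u k) => //.
apply: le_trans h; apply: le_trans (ler_norm _).
by rewrite le_eqVlt; apply/orP; left; apply/eqP; congr fine;
  apply: eq_integral => x _; rewrite /= distrC.
Qed.

End weak_convergence.

Import HBSimple.

Section weak_convergence_metric.
Context (R : realType) (F : pmetricType R).
Variables (m : {measure set (borel F) -> \bar R}) (g : nat -> borel F -> R) (K : R).
Hypotheses (mfin : (m setT < +oo)%E) (mg : forall n, measurable_fun setT (g n)).
Hypothesis gK : forall n x, `|g n x| <= K.
Hypothesis g_lip : forall f : F -> R, is_lipschitz f ->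
  (forall x, 0 <= f x <= 1) ->
  \int[m]_x (f x * g n x) @[n --> \oo] --> (0 : R).

Local Notation null := (null_limit m g).

Lemma null_limit_lipschitz (f : F -> R) : is_lipschitz f ->
  (forall x, 0 <= f x <= 1) -> null f.
Proof.
move=> lf f01; split; last exact: g_lip.
apply: (@integrable_bounded _ _ _ m setT f 1) => //.
  by apply: (@continuous_borel R F); exact: is_lipschitz_continuous.
by move=> x; have /andP[f0 f1] := f01 x; rewrite ger0_norm.
Qed.

Lemma indic_le1 (T : Type) (A : set T) (x : T) : `|\1_A x : R| <= 1.
Proof. by rewrite indicE; case: (x \in A); rewrite ?normr1 ?normr0. Qed.

(** The indicator of an open set is the limit of its inf-convolutions. *)
Lemma null_limit_open (U : set F) : open U -> null (\1_U).
Proof.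
move=> oU; pose u (k : nat) := infconv k%:R (\1_U : F -> R).
have i0 x : 0 <= (\1_U x : R) by rewrite indicE.
have u01 k x : 0 <= u k x <= 1.
  rewrite infconv_ge0//=; apply: (le_trans (infconv_le (ler0n R k) i0 x)).
  by rewrite indicE; case: (x \in U).
have lu k : is_lipschitz (u k).
  by exists k%:R => x y; exact: infconv_lipschitz.
apply: (null_limit_lim mfin mg gK (u := u)).
- by apply: measurable_indic; exact: sub_sigma_algebra.
- by move=> k; apply: (@continuous_borel R F); exact: is_lipschitz_continuous.
- by move=> k x; have /andP[? ?] := u01 k x; rewrite ger0_norm.
- by move=> k; exact: null_limit_lipschitz.
move=> x; have [xU|xU] := pselect (U x); last first.
  rewrite indicE memNset//; apply: cvg_near_cst; apply: nearW => k.
  apply/eqP; rewrite eq_le infconv_ge0// andbT.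
  by apply: (le_trans (infconv_le (ler0n R k) i0 x)); rewrite indicE memNset.
have : nbhs x U by exact: open_nbhs_nbhs.
move=> /metricType_numDomainType.nbhs_mdistP[delta /= delta0 xdU].
rewrite indicE mem_set//; apply: cvg_near_cst.
near=> k; apply/eqP; rewrite eq_le (andP (u01 k x)).2 /=.
apply: infconv_glb => // y; have [xy|xy] := ltP (mdist x y) delta.
  by rewrite indicE mem_set ?lerDl ?mulr_ge0 ?mdist_ge0//; exact: xdU.
apply: (@le_trans _ _ (k%:R * delta)).
  by rewrite -ler_pdivrMr// mul1r; near: k; exact: nbhs_infty_ger.
by rewrite ler_wpDl// ler_wpM2l.
Unshelve. all: by end_near. Qed.

(** Dynkin's theorem extends the previous lemma from open to Borel sets. *)
Lemma null_limit_indic (A : set (borel F)) : measurable A -> null (\1_A).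
Proof.
apply: (@dynkin_induction _ (borel F) (@open F) (fun A => null (\1_A))) => //.
- exact: openI.
- exact/null_limit_open/openT.
- exact: null_limit_open.
- move=> S mS nS.
  have -> : \1_(~` S) = (fun x => \1_(setT) x + -1 * \1_S x) :> (_ -> R).
    by apply/funext => x; rewrite !indicE in_setC in_setT/=; case: (x \in S) => /=; lra.
  apply: (null_limitD mg gK); first exact/null_limit_open/openT.
  exact: (null_limitZ mg gK).
- move=> E mE tE nE.
  apply: (null_limit_lim mfin mg gK
    (u := fun k => \1_(\big[setU/set0]_(i < k) E i))).
  + by apply: measurable_indic; exact: bigcup_measurable.
  + by move=> k; apply: measurable_indic; exact: bigsetU_measurable.
  + by move=> k x; exact: indic_le1.
  + elim=> [|k IH].
      rewrite big_ord0; exact/null_limit_open/open0.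
    have -> : \1_(\big[setU/set0]_(i < k.+1) E i) =
       (fun x => \1_(\big[setU/set0]_(i < k) E i) x + \1_(E k) x) :> (_ -> R).
      apply/funext => x; rewrite big_ord_recr/= !indicE in_setU.
      case: (boolP (x \in _)) => //= xE; rewrite ?add0r//.
      rewrite memNset ?addr0// => Ekx; move: xE; rewrite inE -bigcup_mkord.
      move=> [i /= ik Eix]; move/trivIsetP : tE => /(_ i k I I).
      by rewrite neq_ltn ik => /(_ isT)/seteqP[+ _] => /(_ x); apply.
    exact: (null_limitD mg gK).
  + move=> x; have [[i _ xi]|xE] := pselect ((\bigcup_k E k) x).
      rewrite indicE mem_set; last by exists i.
      apply: cvg_near_cst; exists i.+1 => // k /= ik.
      by rewrite indicE mem_set// -bigcup_mkord; exists i.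
    rewrite indicE memNset//; apply: cvg_near_cst; apply: nearW => k.
    rewrite indicE memNset// -bigcup_mkord => -[i _ xi]; apply: xE.
    by exists i.
Qed.

(** Convergence to zero against the Lipschitz functions with values in [[0,1]]
    extends to all integrable functions. *)
Lemma null_limit_integrable (f : borel F -> R) :
  m.-integrable setT (EFin \o f) -> null f.
Proof.
move=> fi; apply: (null_limit_approx mg gK) => // e e0.
have [s [si _ sf]] := approximation_sfun_integrable measurableT fi.
move: sf => /fine_cvgP[_ /cvgrPdist_le /(_ _ e0)] [k _ /(_ k (leqnn _))] /=.
rewrite sub0r normrN => h; exists (s k); last by apply: le_trans h; exact: ler_norm.
have -> : s k = (fun x => \sum_(y <- fset_set (range (s k)))
    y * \1_(s k @^-1` [set y]) x) :> (borel F -> R).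
  by apply/funext => x; rewrite {1}fimfunE fsbig_finite.
apply: (null_limit_sum mg gK) => y; apply: (null_limitZ mg gK).
exact: null_limit_indic.
Qed.

End weak_convergence_metric.

(** * Integration over the phase space, cell by cell *)

Section cellwise.
Context (R : realType) (d1 d2 : nat) (P : phase_space R d1 d2).
Local Notation Zd := 'rV[int]_(d1 + d2).
Local Notation X := (borel (total_space P)).
Local Notation mu := (@mu R d1 d2 P).
Local Notation region := (@region R d1 d2 P).

(** The lattice points of the cells outside the exceptional set. *)
Definition regular (k : Zd) : Prop := (cells `\` exc P) k.

(** The lattice point of a cell. *)
Definition site (i : cell P) : Zd :=
  match i with inl z => val z | inr z => val z end.

Lemma cell_indexE (i : cell P) (y : fiber i) : cell_index (existT _ i y) = site i.
Proof. by []. Qed.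

Lemma regular_val (w : regular_cell P) : regular (val w).
Proof. by have := valP w; rewrite inE. Qed.

Lemma exc_val (w : exc_cell P) : exc P (val w).
Proof. by have := valP w; rewrite inE. Qed.

Lemma regularP k : regular k -> exists w : regular_cell P, val w = k.
Proof. by move=> rk; exists (exist _ k (mem_set rk)). Qed.

Lemma excP k : exc P k -> exists w : exc_cell P, val w = k.
Proof. by move=> ek; exists (exist _ k (mem_set ek)). Qed.

Lemma site_cells i : cells (site i).
Proof.
case: i => w /=; first by have [] := regular_val w.
exact/exc_cells/exc_val.
Qed.

Lemma site_inj : injective site.
Proof.
move=> [v|v] [w|w] /= vw.
- by congr inl; exact: val_inj.
- by have [_] := regular_val v; rewrite [val v]vw => /(_ (exc_val w)).
- by have [_] := regular_val w; rewrite -[val w]vw => /(_ (exc_val v)).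
- by congr inr; exact: val_inj.
Qed.

Lemma site_surj k : cells k -> exists i, site i = k.
Proof.
move=> ck; have [ek|nek] := pselect (exc P k).
  by have [w <-] := excP ek; exists (inr w).
by have [w <-] := regularP (conj ck nek); exists (inl w).
Qed.

Lemma measurable_existT (i : cell P) :
  measurable_fun [set: borel (fiber i)] (existT _ i : borel (fiber i) -> X).
Proof. by move=> _ A mA; rewrite setTI; exact: measurable_section. Qed.

Lemma measurable_region (S : set Zd) : measurable (region S).
Proof.
apply: sub_sigma_algebra; apply/sigT_openP => i.
rewrite (_ : _ @^-1` _ = [set y | S (site i)]) //.
have [Si|Si] := pselect (S (site i)).
  by rewrite (_ : [set _ | _] = setT); [exact: openT|by apply/seteqP; split].
by rewrite (_ : [set _ | _] = set0); [exact: open0|by apply/seteqP; split].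
Qed.

Lemma measurable_unif_continuous (Phi : X -> R) :
  bounded_unif_continuous Phi -> measurable_fun setT Phi.
Proof.
move=> [_ uc]; apply: (@continuous_borel R (total_space P)).
move=> -[i x]; apply/cvgrPdist_lt => e e0.
suff : \forall y \near x, `|Phi (existT _ i x) - Phi (existT _ i y)| < e by [].
have [delta delta0 xd] := uc e e0.
apply/metricType_numDomainType.nbhs_mdistP; exists delta => // y /=.
exact: xd.
Qed.

(** On the cell [i] the measure [mu] is the image of the measure of the fibre. *)
Lemma mu_cell (i : cell P) (A : set X) : A `<=` region [set site i] ->
  mu A = cell_measure i (existT _ i @^-1` A).
Proof.
move=> Ai; pose a j := cell_measure j (existT _ j @^-1` A).
rewrite /Defs.mu -[RHS]/(a i) -(@esum_set1 _ _ i a)//.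
rewrite [RHS]esum_mkcond; apply: eq_esum => j _; case: ifPn => // /negP ji.
rewrite (_ : _ @^-1` _ = set0) ?measure0//; apply/seteqP; split => // y.
move=> /Ai; rewrite /Defs.region/= cell_indexE => /site_inj ij; apply: ji.
by rewrite inE ij.
Qed.

Lemma mu_region1 (i : cell P) : mu (region [set site i]) = cell_measure i setT.
Proof.
by rewrite (@mu_cell i)//; congr (cell_measure i _); apply/seteqP; split.
Qed.

Lemma region_notin k : ~ cells k -> region [set k] = set0.
Proof.
move=> nk; apply/seteqP; split => // -[i y]; rewrite /Defs.region/= cell_indexE => ik.
by apply: nk; rewrite -ik; exact: site_cells.
Qed.

Lemma cell_mass : exists A : R, 1 < A /\
  forall k, (mu (region [set k]) <= A%:E)%E.
Proof.
have [A [A1 hA]] := @nu_exc_mass _ _ _ P; exists A; split => // k.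
have [ck|ck] := pselect (cells k); last first.
  by rewrite region_notin// measure0 lee_fin ltW// (lt_trans ltr01).
have [[w|w] <-] := site_surj ck; rewrite mu_region1 /=.
  by rewrite probability_setT lee_fin ltW.
exact/ltW/hA.
Qed.

Lemma mu_region1_fin k : (mu (region [set k]) < +oo)%E.
Proof. by have [A [_ /(_ k)/le_lt_trans]] := cell_mass; apply; exact: ltry. Qed.

Lemma cell_measure_fin (i : cell P) : (cell_measure i setT < +oo)%E.
Proof. by rewrite -mu_region1 mu_region1_fin. Qed.

Lemma ge0_integral_cell (i : cell P) (f : X -> \bar R) : measurable_fun setT f ->
  (forall x, 0 <= f x)%E ->
  (\int[mu]_(x in region [set site i]) f x)%E =
  (\int[cell_measure i]_y f (existT _ i y))%E.
Proof.
move=> mf f0.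
have pre : existT _ i @^-1` region [set site i] = setT.
  by apply/seteqP; split.
have := @ge0_integral_pushforward _ _ _ _ _ _ (@measurable_existT i) (cell_measure i)
  (region [set site i]) f (measurable_region _) (measurable_funTS mf) (fun x _ => f0 x).
rewrite pre => <-.
by apply: eq_measure_integral => [|mT A mA Ai]; [exact: (@measurable_existT i)|exact: (mu_cell Ai)].
Qed.

Lemma integrable_cell (i : cell P) (f : X -> R) :
  mu.-integrable setT (EFin \o f) ->
  (cell_measure i).-integrable setT (EFin \o (f \o existT _ i)).
Proof.
move=> fi; have mf : measurable_fun setT (EFin \o f) := measurable_int _ fi.
apply/integrableP; split.
  apply/measurable_EFinP; apply: measurableT_comp (@measurable_existT i).
  exact/measurable_EFinP.
have mk := measurable_region [set site i].
have /integrableP[_] := integrableS measurableT mk (@subsetT _ _) fi.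
by rewrite ge0_integral_cell//; exact: (measurableT_comp _ mf).
Qed.

Lemma integral_cell (i : cell P) (f : X -> R) : measurable_fun setT f ->
  (cell_measure i).-integrable setT (EFin \o (f \o existT _ i)) ->
  \int[mu]_(x in region [set site i]) f x =
  \int[cell_measure i]_y f (existT _ i y).
Proof.
move=> mf fi; congr fine.
have pre : existT _ i @^-1` region [set site i] = setT.
  by apply/seteqP; split.
have mf' : measurable_fun setT (EFin \o f) by exact/measurable_EFinP.
have := @integral_pushforward _ _ _ _ _ _ (@measurable_existT i) (cell_measure i)
  (region [set site i]) (EFin \o f) mf'.
rewrite pre => /(_ fi (measurable_region _)) <-.
by apply: eq_measure_integral => [|mT A mA Ai]; [exact: (@measurable_existT i)|exact: (mu_cell Ai)].
Qed.

End cellwise.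

Section cell_sums.
Context (R : realType) (d1 d2 : nat) (P : phase_space R d1 d2).
Local Notation Zd := 'rV[int]_(d1 + d2).
Local Notation X := (borel (total_space P)).
Local Notation mu := (@mu R d1 d2 P).
Local Notation region := (@region R d1 d2 P).

(** The integral of [F] over the cell at [k]; it is [0] when there is no such cell. *)
Definition cell_integral (F : X -> R) (k : Zd) : R :=
  \int[mu]_(x in region [set k]) F x.

Lemma region_cons k (s : seq Zd) :
  region [set` k :: s] = region [set k] `|` region [set` s].
Proof.
apply/seteqP; split => x; rewrite /Defs.region/= in_cons.
  by move=> /predU1P[->|]; [left|right].
by move=> [->|xs]; apply/predU1P; [left|right].
Qed.

Lemma mu_region_seq (s : seq Zd) : (mu (region [set` s]) < +oo)%E.
Proof.
elim: s => [|k s IH].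
  by rewrite (_ : region _ = set0) ?measure0//; apply/seteqP; split.
rewrite region_cons (le_lt_trans (measureU2 _ _ _))//; try exact: measurable_region.
by rewrite lte_add_pinfty// mu_region1_fin.
Qed.

Lemma Rintegral_region_seq (s : seq Zd) (f : X -> R) : uniq s ->
  mu.-integrable (region [set` s]) (EFin \o f) ->
  \int[mu]_(x in region [set` s]) f x = \sum_(k <- s) cell_integral f k.
Proof.
elim: s => [_ _|k s IH /= /andP[ks us] fi].
  by rewrite big_nil (_ : region _ = set0) ?Rintegral_set0//; apply/seteqP; split.
have mk := measurable_region (P := P) [set k].
have ms := measurable_region (P := P) [set` s].
rewrite region_cons in fi *; rewrite Rintegral_setU//; last first.
  apply/disj_setPS => x [] /=; rewrite /Defs.region/= => -> ks'.
  by rewrite ks' in ks.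
rewrite big_cons IH//; apply: integrableS fi => //; exact: measurableU.
Qed.

Lemma integrable_region_seq (s : seq Zd) (F : X -> R) (K : R) :
  measurable_fun setT F -> (forall x, `|F x| <= K) ->
  mu.-integrable (region [set` s]) (EFin \o F).
Proof.
move=> mF FK; apply: (integrable_bounded (K := K)) => //.
- exact: measurable_region.
- exact: mu_region_seq.
- exact: measurable_funTS.
Qed.

Lemma integrable_region1 k (F : X -> R) (K : R) :
  measurable_fun setT F -> (forall x, `|F x| <= K) ->
  mu.-integrable (region [set k]) (EFin \o F).
Proof.
move=> mF FK; apply: (integrable_bounded (K := K)) => //.
- exact: measurable_region.
- exact: mu_region1_fin.
- exact: measurable_funTS.
Qed.

Lemma fine_mu_region_seq (s : seq Zd) : uniq s ->
  fine (mu (region [set` s])) = \sum_(k <- s) fine (mu (region [set k])).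
Proof.
move=> us; rewrite -[LHS]mul1r -Rintegral_cst; last exact: measurable_region.
rewrite Rintegral_region_seq//; last first.
  by apply: (@integrable_region_seq _ (fun=> 1) 1) => // x; rewrite normr1.
apply: eq_bigr => k _; rewrite /cell_integral Rintegral_cst ?mul1r//.
exact: measurable_region.
Qed.

Lemma cell_integral_site (i : cell P) (F : X -> R) (K : R) :
  measurable_fun setT F -> (forall x, `|F x| <= K) ->
  cell_integral F (site i) = \int[cell_measure i]_y F (existT _ i y).
Proof.
move=> mF FK; apply: integral_cell => //.
apply: (integrable_bounded (K := K)) => //.
- exact: cell_measure_fin.
- by apply: measurableT_comp => //; exact: measurable_existT.
- by move=> y; exact: FK.
Qed.

Lemma norm_cell_integral k (F : X -> R) (K : R) :
  measurable_fun setT F -> (forall x, `|F x| <= K) ->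
  `|cell_integral F k| <= K * fine (mu (region [set k])).
Proof.
move=> mF FK; have mk := measurable_region (P := P) [set k].
have Fi := integrable_region1 k mF FK.
rewrite (le_trans (le_normr_Rintegral mk Fi))// -Rintegral_cst//.
apply: le_Rintegral => //; first exact: integrable_norm.
by apply: (@integrable_region1 _ (fun=> K) `|K|).
Qed.

Lemma fine_mu_regular k : regular P k -> fine (mu (region [set k])) = 1.
Proof.
move=> /regularP[w <-]; rewrite (@mu_region1 _ _ _ P (inl w)) /=.
by rewrite probability_setT.
Qed.

Lemma norm_cell_integral_regular k (F : X -> R) (K : R) : regular P k ->
  measurable_fun setT F -> (forall x, `|F x| <= K) -> `|cell_integral F k| <= K.
Proof.
move=> rk mF FK; have := norm_cell_integral k mF FK.
by rewrite fine_mu_regular// mulr1.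
Qed.

Lemma norm_cell_integral_le : exists A : R, 0 < A /\
  forall k (F : X -> R) K, measurable_fun setT F -> (forall x, `|F x| <= K) ->
  `|cell_integral F k| <= K * A.
Proof.
have [A [A1 hA]] := cell_mass P; exists A; split; first exact: lt_trans A1.
move=> k F K mF FK; apply: (le_trans (norm_cell_integral k mF FK)).
rewrite ler_wpM2l//; first exact: le_trans (normr_ge0 (F point)) (FK _).
by rewrite -lee_fin fineK// ge0_fin_numE// mu_region1_fin.
Qed.

End cell_sums.

(** * The lower bound given by the local limit estimate *)

Lemma row_norm_lt (R : realType) n (x : 'rV[R]_n) (r : R) : 0 < r ->
  (forall j, `|x 0 j| < r) -> `|x| < r.
Proof.
move=> r0 xr; suff : ball (0 : 'rV[R]_n) r x.
  by rewrite -ball_normE /ball_/= sub0r normrN.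
by split=> // i j; rewrite mxE ord1 -ball_normE /ball_/= sub0r normrN.
Qed.

Lemma row_norm_ge (R : realType) n (x : 'rV[R]_n) j : `|x 0 j| <= `|x|.
Proof.
apply/ler_addgt0Pl => e e0; have r0 : 0 < e + `|x| by rewrite ltr_wpDr.
have : ball (0 : 'rV[R]_n) (e + `|x|) x.
  by rewrite -ball_normE /ball_/= sub0r normrN ltrDr.
move=> [_ /(_ 0 j)].
by rewrite mxE -ball_normE /ball_/= sub0r normrN => /ltW.
Qed.

Section lattice_scaling.
Context (R : realType) (d : nat).
Local Notation Zd := 'rV[int]_d.

(** The lower corner and the side of a box of integer points inside the cube
    [rho * (m + [0, 1)^d)]. *)
Definition corner (rho : R) (m : Zd) : Zd :=
  \row_j Num.ceil (rho * (m 0 j)%:~R).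
Definition side (rho : R) : nat := Num.truncn rho.

Lemma corner_box (rho : R) (m u : Zd) j : 0 < rho -> u \in box0 d (side rho) ->
  rho * (m 0 j)%:~R <= ((corner rho m + u) 0 j)%:~R < rho * (m 0 j)%:~R + rho.
Proof.
move=> rho0 /box0P /(_ j) /andP[u0 us]; rewrite !mxE rmorphD/=.
have := ceil_itv (rho * (m 0 j)%:~R); rewrite rmorphB/=.
have h0 : (0 : R) <= (u 0 j)%:~R by rewrite ler0z.
have h1 : (u 0 j)%:~R + 1 <= (side rho)%:R :> R.
  rewrite -[1]/(1%:~R) -rmorphD/= -[(side rho)%:R]/((side rho)%:Z%:~R) ler_int.
  by rewrite lezD1.
have h2 : (side rho)%:R <= rho by rewrite truncn_le ltW.
by lra.
Qed.

(** The points of the box of [m] belong, after rescaling, to the grid cube of [m]. *)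
Lemma grid_corner (l h : R) (m u : Zd) : 0 < l -> 0 < h ->
  u \in box0 d (side (l * h)) ->
  grid h (l^-1 *: map_mx intr (corner (l * h) m + u)) = m.
Proof.
move=> l0 h0 us; apply/rowP => j; rewrite mxE; apply: floor_def.
have lh0 : 0 < l * h by rewrite mulr_gt0.
have := corner_box m j lh0 us; move: (_ + u) => v.
have -> : (l^-1 *: map_mx intr v) 0 j / h = (v 0 j)%:~R / (l * h) :> R.
  by rewrite !mxE invfM; ring.
move: (v 0 j)%:~R => q; rewrite ler_pdivlMr// ltr_pdivrMr// rmorphD/=.
by rewrite mulrDl mul1r [_ * (l * h)]mulrC.
Qed.

Lemma corner_box_inj (l h : R) (m m' u u' : Zd) : 0 < l -> 0 < h ->
  u \in box0 d (side (l * h)) -> u' \in box0 d (side (l * h)) ->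
  corner (l * h) m + u = corner (l * h) m' + u' -> m = m' /\ u = u'.
Proof.
move=> l0 h0 us us' e; have mm' : m = m'.
  by rewrite -(grid_corner m l0 h0 us) e grid_corner.
by split => //; move: e; rewrite mm' => /addrI.
Qed.

Lemma side_le (rho : R) : 0 <= rho -> (side rho)%:R <= rho.
Proof. by move=> r0; rewrite truncn_le. Qed.

Lemma side_gt (rho : R) : 0 <= rho -> rho - 1 < (side rho)%:R.
Proof. by move=> r0; have := truncn_itv r0; rewrite -natr1 /side; lra. Qed.

End lattice_scaling.

Section local_limit.
Context (R : realType) (d1 d2 : nat) (P : phase_space R d1 d2).
Local Notation d := (d1 + d2)%N.
Local Notation Zd := 'rV[int]_(d1 + d2).
Local Notation Rd := 'rV[R]_(d1 + d2).
Local Notation X := (borel (total_space P)).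
Local Notation M := (regular_fiber P).
Variables (T : X -> X) (L : nat -> R) (p : Rd -> R).
Hypothesis mT : measurable_fun setT T.

Lemma measurable_iter n : measurable_fun setT (iter n T).
Proof.
elim: n => [|n IH]; first exact: measurable_id.
exact: (measurableT_comp mT IH).
Qed.

(** The regular cells at distance more than [D] from the exceptional ones. *)
Definition good (D : R) (k : Zd) : bool :=
  `[< regular P k /\ (D%:E < dist_set (toR R k) (exc P))%E >].

Lemma good_regular (D : R) k : good D k -> regular P k.
Proof. by move=> /asboolP[]. Qed.

(** The local limit estimate at time [n], with error [e], for the measure
    [phi d nu_i], seen from the lattice point [o]. *)
Definition local_limit n (r eps e : R) (i : cell P) (phi : fiber i -> R) (o : Zd) :=
  forall (psi : M -> R) k, lip_ball r psi -> cells k ->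
  let u := (L n)^-1 *: toR R (k - o) in
  orthant u -> `|u| < r -> ((eps * L n)%:E < dist_set (toR R k) (exc P))%E ->
  `| L n ^+ d * nubar phi (cell_obs psi k \o iter n T) -
     p u * nu_mean psi * mean phi | <= e.

(** Errors whose supremum tends to zero are eventually uniformly small. *)
Lemma sup0_le (S : nat -> set R) : Defs.sup0 (S n) @[n --> \oo] --> 0%E ->
  forall e, 0 < e -> \forall n \near \oo, forall x, S n x -> x <= e.
Proof.
move=> /fine_cvgP[fS cS] e e0; move/cvgrPdist_le : cS => /(_ _ e0) cS.
near=> n => x Sx; rewrite -lee_fin (@le_trans _ _ (Defs.sup0 (S n)))//.
  by apply: ereal_sup_ubound; exists x => //; right.
have fn : Defs.sup0 (S n) \is a fin_num by near: n.
rewrite -(fineK fn) lee_fin (le_trans (ler_norm _))//.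
have : `|0 - fine (Defs.sup0 (S n))| <= e by near: n.
by rewrite sub0r normrN.
Unshelve. all: by end_near. Qed.

Hypothesis L0 : forall n, 0 < L n.

Lemma scale_toR n (k : Zd) : L n *: ((L n)^-1 *: toR R k) = toR R k.
Proof. by rewrite scalerA divff ?scale1r// gt_eqF. Qed.

Lemma ceil_toR (k : Zd) : ceil_vec (toR R k) = k.
Proof. by apply/rowP => j; rewrite !mxE intrKceil. Qed.

Lemma orthant_cells n (k : Zd) : cells k -> orthant ((L n)^-1 *: toR R k).
Proof.
move=> ck i; rewrite !mxE mulr_ge0 ?invr_ge0 ?ler0z//; first exact: ltW.
exact/ltW/ck.
Qed.

(** From a regular cell, the estimate is uniform in the starting cell and in
    [phi]. *)
Lemma local_limitA (r eps : R) : 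
  Defs.sup0 (errorA T L p eps r n) @[n --> \oo] --> 0%E ->
  forall e, 0 < e -> \forall n \near \oo,
    forall (w : regular_cell P) (phi : M -> R), lip_ball r phi ->
    @local_limit n r eps e (inl w) phi (val w).
Proof.
move=> /sup0_le hA e e0; near=> n => w phi lphi psi k lpsi ck u uO ur Dk.
have : forall x, errorA T L p eps r n x -> x <= e by near: n; exact: hA.
apply; exists phi, psi, w, ((L n)^-1 *: toR R k).
have <- : u = (L n)^-1 *: toR R k - (L n)^-1 *: toR R (val w).
  by rewrite /u -scalerBr /toR map_mxB.
rewrite scale_toR ceil_toR; split => //; split => //; exact: orthant_cells.
Unshelve. all: by end_near. Qed.

(** An exceptional cell is seen from the origin; the estimate is not uniform
    in [phi]. *)
Lemma local_limitB (w : exc_cell P) (phi : exc_fiber w -> R) (r eps : R) : 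
  Defs.sup0 (errorB T L p phi eps r n) @[n --> \oo] --> 0%E ->
  forall e, 0 < e -> \forall n \near \oo,
    @local_limit n r eps e (inr w) phi 0.
Proof.
move=> /sup0_le hB e e0; near=> n => psi k lpsi ck u uO ur Dk.
have : forall x, errorB T L p phi eps r n x -> x <= e by near: n; exact: hB.
have uE : u = (L n)^-1 *: toR R k by rewrite /u subr0.
move: uO ur; rewrite uE => uO ur; apply; exists psi, ((L n)^-1 *: toR R k).
by rewrite scale_toR ceil_toR; split.
Unshelve. all: by end_near. Qed.

Lemma measurable_fiberwise (f : X -> R) :
  (forall i : cell P, continuous (fun y : fiber i => f (existT _ i y))) ->
  measurable_fun setT f.
Proof.
move=> cf; apply: (@continuous_borel R (total_space P)).
by move=> -[i x] A /cf.
Qed.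

Lemma measurable_cell_obs (psi : M -> R) k : continuous psi ->
  measurable_fun setT (@cell_obs R d1 d2 P psi k).
Proof.
move=> cpsi; apply: measurable_fiberwise => -[w|w] /=; last exact: cst_continuous.
by move=> y; apply: cvgM; [exact: cpsi|exact: cvg_cst].
Qed.

(** The functions [cell_obs (Psi k) k] have disjoint supports. *)
Lemma cell_obs_sum_le (Psi : Zd -> M -> R) (Phi : X -> R) (F : seq Zd) x :
  uniq F -> (forall x, 0 <= Phi x) ->
  (forall (w : regular_cell P) y, Psi (val w) y <= Phi (existT _ (inl w) y)) ->
  \sum_(k <- F) cell_obs (Psi k) k x <= Phi x.
Proof.
move=> uF Phi0 PsiPhi; case: x => -[w|w] y; last first.
  by rewrite (eq_bigr (fun=> 0)) ?big1_eq// => k _.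
rewrite /cell_obs/=; have [wF|wF] := boolP (val w \in F).
  rewrite (bigD1_seq (val w))//= eqxx mulr1 big1 ?addr0; first exact: PsiPhi.
  by move=> k kw; rewrite eq_sym (negbTE kw) mulr0.
rewrite big_seq big1 => [|k kF]; first exact: Phi0.
rewrite (_ : (_ == _) = false) ?mulr0//; apply/negP => /eqP wk.
by move/negP: wF; apply; rewrite [val w]wk.
Qed.

Lemma Rintegral_sum dd (S : measurableType dd) (m : {measure set S -> \bar R})
    (I : Type) (s : seq I) (f : I -> S -> R) :
  (forall i, m.-integrable setT (EFin \o f i)) ->
  m.-integrable setT (EFin \o (fun x => \sum_(i <- s) f i x)) /\
  \int[m]_x (\sum_(i <- s) f i x) = \sum_(i <- s) \int[m]_x f i x.
Proof.
move=> fi; elim: s => [|i s [IHi IH]].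
  rewrite big_nil; under eq_Rintegral do rewrite big_nil.
  rewrite Rintegral_cst// mul0r; split => //.
  rewrite (_ : _ \o _ = cst 0%E); first exact: integrable0.
  by apply/funext => x; rewrite /= big_nil.
rewrite big_cons -IH; under eq_Rintegral do rewrite big_cons.
split; last by rewrite RintegralD.
under [X in integrable _ _ (_ \o X)]eq_fun do rewrite big_cons.
exact: (integrableD measurableT (fi i) IHi).
Qed.

End local_limit.

Section core.
Context (R : realType) (d1 d2 : nat) (P : phase_space R d1 d2).
Local Notation d := (d1 + d2)%N.
Local Notation Zd := 'rV[int]_(d1 + d2).
Local Notation Rd := 'rV[R]_(d1 + d2).
Local Notation X := (borel (total_space P)).
Local Notation M := (regular_fiber P).
Variables (T : X -> X) (L : nat -> R) (p : Rd -> R).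
Hypothesis mT : measurable_fun setT T.
Hypothesis L0 : forall n, 0 < L n.

Section step.
Variables (h : R) (ms : seq Zd) (c : Zd -> R).
Hypotheses (h0 : 0 < h) (c0 : forall m, 0 <= c m) (ums : uniq ms).
Hypothesis ms_orthant : forall m, m \in ms -> zorthant m.
Hypothesis c_le : forall x, grid h x \in ms -> c (grid h x) <= p x.

(** Summing the local limit estimate over the good points of the boxes attached to
    the cubes [m] of the step function below [p].  The boxes are disjoint, so
    that the sum of the observables [Psi k] stays below [Phi]. *)
Lemma core_lower n (r eps e : R) (i : cell P) (phi : borel (fiber i) -> R)
    (o : Zd) (Kphi K : R) (Psi : Zd -> M -> R) (Phi : X -> R) :
  0 <= e -> 0 < r -> (forall m, m \in ms -> forall j, (`|m 0 j|%:~R + 1) * h < r) ->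
  local_limit T L p n r eps e phi o ->
  measurable_fun setT phi -> (forall y, 0 <= phi y <= Kphi) ->
  measurable_fun setT Phi -> (forall x, 0 <= Phi x <= K) ->
  (forall k, lip_ball r (Psi k)) -> (forall k y, 0 <= Psi k y) ->
  (forall (w : regular_cell P) y, Psi (val w) y <= Phi (existT _ (inl w) y)) ->
  (L n ^+ d)^-1 * (\sum_(m <- ms) \sum_(u <- box0 d (side (L n * h)) |
      good P (eps * L n) (o + (corner (L n * h) m + u)))
      (c m * mean phi * nu_mean (Psi (o + (corner (L n * h) m + u))) - e)) <=
  \int[cell_measure i]_y (phi y * Phi (iter n T (existT _ i y))).
Proof.
move=> e0 r0 msr LL mphi phi01 mPhi Phi01 lPsi Psi0 PsiPhi.
set rho := L n * h; have rho0 : 0 < rho by rewrite mulr_gt0.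
pose kk (q : Zd * Zd) := o + (corner rho q.1 + q.2).
pose S := [seq q <- [seq (m, u) | m <- ms, u <- box0 d (side rho)]
          | good P (eps * L n) (kk q)].
have SE (F : Zd * Zd -> R) : \sum_(q <- S) F q =
    \sum_(m <- ms) \sum_(u <- box0 d (side rho) | good P (eps * L n) (kk (m, u))) F (m, u).
  rewrite big_filter big_mkcond big_allpairs_dep; apply: eq_bigr => m _.
  by rewrite -big_mkcond.
rewrite -(SE (fun q => c q.1 * mean phi * nu_mean (Psi (kk q)) - e)).
have SP q : q \in S -> [/\ q.1 \in ms, q.2 \in box0 d (side rho) & good P (eps * L n) (kk q)].
  rewrite mem_filter => /andP[gq /allpairsP[[m u] /= [mms us qE]]].
  by rewrite qE in gq *.
have uS : uniq (map kk S).
  rewrite map_inj_in_uniq; last first.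
    move=> [m u] [m' u'] /SP[/= _ us _] /SP[/= _ us' _] /addrI e1.
    by have [/= -> ->] := corner_box_inj (L0 n) h0 us us' e1.
  apply: filter_uniq; apply: allpairs_uniq => //; first exact: box0_uniq.
  by move=> [m u] [m' u'].
pose obs k y := phi y * cell_obs (Psi k) k (iter n T (existT _ i y)).
have mit : measurable_fun setT (iter n T \o existT _ i : borel (fiber i) -> X).
  by apply: measurableT_comp; [exact: measurable_iter|exact: measurable_existT].
have phii : (cell_measure i).-integrable setT (EFin \o phi).
  apply: (integrable_bounded (K := Kphi)) => //; first exact: cell_measure_fin.
  by move=> y; have /andP[? ?] := phi01 y; rewrite ger0_norm.
have obsi k : (cell_measure i).-integrable setT (EFin \o obs k).
  have [lk nk] := lPsi k.
  apply: (integrable_mul_bounded (K := `|r|)) => //.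
    apply: (measurableT_comp (f := cell_obs (Psi k) k)) mit.
    by apply: measurable_cell_obs; exact: is_lipschitz_continuous.
  have Psir y : `|Psi k y| <= r.
    rewrite -lee_fin; apply: le_trans nk; rewrite /lip_norm.
    rewrite -[leLHS]adde0; apply: leeD.
      by apply: ereal_sup_ubound; exists y.
    apply: ereal_sup_ubound; exists (y, y) => //=.
    by rewrite subrr normr0 mul0r.
  move=> y; case: (iter n T _) => -[w|w] z; rewrite /cell_obs/= ?normr0//.
  rewrite normrM (le_trans _ (ler_norm r))//.
  by case: (_ == _); rewrite ?normr1 ?mulr1// normr0 mulr0 (le_trans (normr_ge0 _) (Psir z)).
have [sumi sumE] := Rintegral_sum (map kk S) obsi.
apply: (@le_trans _ _ (\sum_(k <- map kk S) \int[cell_measure i]_y obs k y)).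
  rewrite big_map mulr_sumr big_seq [leRHS]big_seq; apply: ler_sum => q qS.
  have [mms us gq] := SP q qS; have [[ck nk] Dk] := asboolP _ gq.
  have E : kk q - o = corner rho q.1 + q.2 by rewrite /kk addrC addKr.
  have gE : grid h ((L n)^-1 *: toR R (kk q - o)) = q.1.
    by rewrite E; exact: grid_corner.
  have uO : orthant ((L n)^-1 *: toR R (kk q - o)).
    by apply/(orthant_grid _ h0); rewrite gE; exact: ms_orthant.
  have ur : `|(L n)^-1 *: toR R (kk q - o)| < r.
    apply: row_norm_lt => // j; apply: le_lt_trans (msr _ mms j).
    have := grid_bounds ((L n)^-1 *: toR R (kk q - o)) j h0; rewrite gE.
    rewrite intr_norm; move: (q.1 0 j)%:~R => s.
    move: (((L n)^-1 *: toR R (kk q - o)) 0 j) => t /andP[st ts].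
    have sh : `|s * h| = `|s| * h by rewrite normrM (gtr0_norm h0).
    have := ler_norm (s * h); have := ler_norm (- (s * h)); rewrite normrN sh.
    by rewrite ler_norml mulrDl mul1r; lra.
  have := LL _ _ (lPsi (kk q)) ck uO ur Dk.
  rewrite /nubar -/(obs (kk q)) ler_norml => /andP[+ _].
  have cp : c q.1 <= p ((L n)^-1 *: toR R (kk q - o)).
    by rewrite -{1}gE; apply: c_le; rewrite gE.
  have mean0 : 0 <= mean phi by apply: Rintegral_ge0 => y _; have /andP[] := phi01 y.
  have numean0 : 0 <= nu_mean (Psi (kk q)) by exact: Rintegral_ge0.
  rewrite ler_pdivrMl ?exprn_gt0// lerNl opprB => LLq.
  have := ler_wpM2r (mulr_ge0 mean0 numean0) cp.
  move: LLq; rewrite -!mulrA [mean phi * _]mulrC; move: (_ * (_ * _)) => s.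
  rewrite /comp /obs; lra.
rewrite -sumE; apply: le_Rintegral => //.
  apply: (integrable_mul_bounded (K := K)) => //.
    exact: (measurableT_comp mPhi mit).
  by move=> y; have /andP[? ?] := Phi01 (iter n T (existT _ i y)); rewrite ger0_norm.
move=> y _; rewrite /obs -mulr_sumr ler_wpM2l//; first by have /andP[] := phi01 y.
by apply: cell_obs_sum_le => // x; have /andP[] := Phi01 x.
Qed.

End step.
End core.

Section core_average.
Context (R : realType) (d1 d2 : nat) (P : phase_space R d1 d2).
Local Notation d := (d1 + d2)%N.
Local Notation Zd := 'rV[int]_(d1 + d2).
Local Notation Rd := 'rV[R]_(d1 + d2).
Local Notation X := (borel (total_space P)).
Local Notation M := (regular_fiber P).

(** Uniformly Lipschitz approximations, from below, of the restrictions of a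
    bounded uniformly continuous function to the regular cells. *)
Lemma lower_lipschitz (Phi : X -> R) (K e : R) : bounded_unif_continuous Phi ->
  (forall x, 0 <= Phi x <= K) -> 0 < e ->
  exists (r : R) (Psi : Zd -> M -> R),
  [/\ forall k, lip_ball r (Psi k), forall k y, 0 <= Psi k y,
      forall (w : regular_cell P) y, Psi (val w) y <= Phi (existT _ (inl w) y) &
      forall (w : regular_cell P) y, Phi (existT _ (inl w) y) <= Psi (val w) y + e].
Proof.
move=> [_ uc] Phi01 e0; have [delta delta0 ucd] := uc e e0.
have K0 : 0 <= K by have /andP[a b] := Phi01 point; exact: le_trans b.
(* The slope that makes points at distance at least delta irrelevant. *)
pose J := K / delta; have J0 : 0 <= J by rewrite divr_ge0// ltW.
pose Psi (k : Zd) : M -> R :=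
  if insub k is Some w then infconv J (fun y : M => Phi (existT _ (inl w) y))
  else fun=> 0.
have PsiE (w : regular_cell P) :
    Psi (val w) = infconv J (fun y : M => Phi (existT _ (inl w) y)).
  by rewrite /Psi valK.
have Phi0 (w : regular_cell P) (y : M) : 0 <= Phi (existT _ (inl w) y).
  by have /andP[] := Phi01 (existT _ (inl w) y).
exists (K + J), Psi; split.
- move=> k; rewrite /Psi; case: insubP => [w _ _|_]; last first.
    apply: lip_ballP => // [y|x y]; first by rewrite normr0.
    by rewrite subrr normr0 mulr_ge0// mdist_ge0.
  apply: lip_ballP => // [y|x y]; last exact: infconv_lipschitz.
  rewrite ger0_norm ?infconv_ge0//.
  apply: le_trans (infconv_le J0 (Phi0 w) y) _.
  by have /andP[] := Phi01 (existT _ (inl w) y).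
- move=> k y; rewrite /Psi; case: insubP => // w _ _; exact: infconv_ge0.
- by move=> w y; rewrite PsiE; exact: infconv_le.
- move=> w y; rewrite PsiE; apply: (@infconv_approx _ _ J _ J0 (Phi0 w) e delta K y (ltW e0)).
  + by move=> z; have /andP[] := Phi01 (existT _ (inl w) z).
  + by rewrite /J divfK// gt_eqF.
  + by move=> z; exact: ucd.
Qed.

Lemma lip_ball_norm (F : pmetricType R) (r : R) (psi : F -> R) : lip_ball r psi ->
  forall y, `|psi y| <= r.
Proof.
move=> [_ npsi] y; rewrite -lee_fin; apply: le_trans npsi; rewrite /lip_norm.
rewrite -[leLHS]adde0; apply: leeD.
  by apply: ereal_sup_ubound; exists y.
apply: ereal_sup_ubound; exists (y, y) => //=.
by rewrite subrr normr0 mul0r.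
Qed.

Lemma nu_mean_ge (Phi : X -> R) (psi : M -> R) (K r e : R) (w : regular_cell P) :
  measurable_fun setT Phi -> (forall x, 0 <= Phi x <= K) -> lip_ball r psi ->
  (forall y, Phi (existT _ (inl w) y) <= psi y + e) ->
  cell_integral Phi (val w) - e <= nu_mean psi.
Proof.
move=> mPhi Phi01 lpsi Phipsi.
have PhiK x : `|Phi x| <= K by have /andP[? ?] := Phi01 x; rewrite ger0_norm.
have mM : measurable_fun [set: borel M] psi.
  by apply: (@continuous_borel R M); apply: is_lipschitz_continuous; case: lpsi.
have nuT : nu P [set: M] = 1%E := probability_setT (nu P).
have nufin : (nu P [set: M] < +oo)%E by rewrite nuT ltry.
have ipsi : (nu P).-integrable setT (EFin \o psi).
  by apply: (integrable_bounded (K := r)) => //; exact: lip_ball_norm.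
rewrite (@cell_integral_site _ _ _ P (inl w) Phi K mPhi PhiK) lerBlDr.
have eE : \int[nu P]_(y in [set: borel M]) e = e * fine (nu P [set: M]).
  exact: Rintegral_cst.
rewrite nuT mulr1 in eE; rewrite -[leRHS]/(nu_mean psi + e) -eE.
have ie : (nu P).-integrable setT (EFin \o cst e).
  by apply: (@integrable_bounded _ _ _ (nu P) setT (cst e) `|e|).
rewrite -RintegralD//; apply: le_Rintegral => //.
- apply: (integrable_bounded (K := K)) => //.
    apply: (measurableT_comp mPhi); exact: (@measurable_existT _ _ _ P (inl w)).
- exact: (integrableD measurableT ipsi ie).
Qed.

Variables (T : X -> X) (L : nat -> R) (p : Rd -> R).
Hypothesis mT : measurable_fun setT T.
Hypothesis L0 : forall n, 0 < L n.

(** Normalized sum of [G] over the good points of the box at scale [L n]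
    attached to the lattice point [m], seen from [o]. *)
Definition box_average (h eps : R) (n : nat) (o m : Zd) (G : Zd -> R) : R :=
  (L n ^+ d)^-1 * \sum_(k <- zbox (o + corner (L n * h) m) (side (L n * h)) |
    good P (eps * L n) k) G k.

Lemma box_size (h : R) n : 0 < h ->
  (L n ^+ d)^-1 * (side (L n * h) ^ d)%N%:R <= h ^+ d.
Proof.
move=> h0; have rho0 : 0 < L n * h by rewrite mulr_gt0.
rewrite ler_pdivrMl ?exprn_gt0// -exprMn natrX lerXn2r ?nnegrE//.
  by rewrite ltW.
exact/side_le/ltW.
Qed.

Section step.
Variables (h : R) (ms : seq Zd) (c : Zd -> R).
Hypotheses (h0 : 0 < h) (c0 : forall m, 0 <= c m) (ums : uniq ms).
Hypothesis ms_orthant : forall m, m \in ms -> zorthant m.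
Hypothesis c_le : forall x, grid h x \in ms -> c (grid h x) <= p x.

(** The previous bound in terms of the averages of [Phi] over the boxes; the
    approximation of [Phi] by [Psi] costs [e2]. *)
Lemma core_lower_average n (r eps e e2 : R) (i : cell P) (phi : borel (fiber i) -> R)
    (o : Zd) (Kphi K : R) (Psi : Zd -> M -> R) (Phi : X -> R) :
  0 <= e -> 0 <= e2 -> 0 < r ->
  (forall m, m \in ms -> forall j, (`|m 0 j|%:~R + 1) * h < r) ->
  local_limit T L p n r eps e phi o ->
  measurable_fun setT phi -> (forall y, 0 <= phi y <= Kphi) ->
  measurable_fun setT Phi -> (forall x, 0 <= Phi x <= K) ->
  (forall k, lip_ball r (Psi k)) -> (forall k y, 0 <= Psi k y) ->
  (forall (w : regular_cell P) y, Psi (val w) y <= Phi (existT _ (inl w) y)) ->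
  (forall (w : regular_cell P) y, Phi (existT _ (inl w) y) <= Psi (val w) y + e2) ->
  \sum_(m <- ms) (c m * mean phi * box_average h eps n o m (cell_integral Phi) -
     (c m * mean phi * e2 + e) * h ^+ d) <=
  \int[cell_measure i]_y (phi y * Phi (iter n T (existT _ i y))).
Proof.
move=> e0 e20 r0 msr LL mphi phi01 mPhi Phi01 lPsi Psi0 PsiPhi PhiPsi.
apply: (le_trans _ (core_lower mT L0 h0 ums ms_orthant c_le e0 r0 msr LL mphi phi01
  mPhi Phi01 lPsi Psi0 PsiPhi)).
rewrite mulr_sumr; apply: ler_sum => m _.
have mean0 : 0 <= mean phi by apply: Rintegral_ge0 => y _; have /andP[] := phi01 y.
rewrite /box_average.
set U := zbox _ _; pose cm := c m * mean phi; rewrite -/cm.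
have cm0 : 0 <= cm by exact: mulr_ge0.
have -> : \sum_(u <- box0 d (side (L n * h)) |
     good P (eps * L n) (o + (corner (L n * h) m + u)))
     (cm * nu_mean (Psi (o + (corner (L n * h) m + u))) - e) =
   \sum_(k <- U | good P (eps * L n) k) (cm * nu_mean (Psi k) - e).
  by rewrite /U /zbox big_map; apply: eq_big => u; rewrite addrA.
apply: (@le_trans _ _ ((L n ^+ d)^-1 * \sum_(k <- U | good P (eps * L n) k)
   (cm * cell_integral Phi k - (cm * e2 + e)))); last first.
  rewrite ler_wpM2l ?invr_ge0 ?exprn_ge0 ?(ltW (L0 n))//.
  apply: ler_sum => k /good_regular /regularP[w <-].
  have := nu_mean_ge mPhi Phi01 (lPsi (val w)) (PhiPsi w).
  move/(ler_wpM2l cm0); rewrite mulrBr; lra.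
rewrite sumrB mulrBr -mulr_sumr; apply: lerB; first by rewrite mulrCA.
rewrite -big_filter sumr_const_seq mulrCA ler_wpM2l ?addr_ge0 ?mulr_ge0//.
apply: le_trans (box_size n h0); rewrite ler_wpM2l ?invr_ge0 ?exprn_ge0 ?(ltW (L0 n))//.
by rewrite ler_nat size_filter (leq_trans (count_size _ _))// size_zbox.
Qed.

End step.
End core_average.

(** * Few cells are close to the exceptional ones *)

Section smallness.
Context (R : realType) (d1 d2 : nat) (P : phase_space R d1 d2).
Local Notation d := (d1 + d2)%N.
Local Notation Zd := 'rV[int]_(d1 + d2).

Lemma bounded_finite (S : set Zd) (N : nat) :
  (forall z, S z -> forall j, - N%:Z <= z 0 j <= N%:Z) -> finite_set S.
Proof. by move=> SN; apply: sub_finite_set (finite_bounded_row d1 d2 N) => z /SN. Qed.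

Lemma count_nb_points (S : set Zd) (s : seq Zd) (q : pred Zd) : finite_set S ->
  uniq s -> (forall k, k \in s -> q k -> S k) -> (count q s <= nb_points S)%N.
Proof.
move=> fS us sS; rewrite /nb_points; apply: count_size_le => // k ks qk.
by rewrite in_fset_set// inE; exact: sS.
Qed.

Lemma nb_points_le (S : set Zd) (s : seq Zd) : finite_set S ->
  (forall k, S k -> k \in s) -> (nb_points S <= size s)%N.
Proof.
move=> fS Ss; apply: uniq_leq_size; first exact: fset_uniq.
by move=> k; rewrite in_fset_set// inE; exact: Ss.
Qed.

Lemma big_box_finite (Q : R) : finite_set (@big_box R d1 d2 Q).
Proof.
apply: (@bounded_finite _ (Num.bound `|Q|)) => z [z1 z2] j.
have : - `|Q| <= (z 0 j)%:~R <= `|Q|.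
  have := ler_norm Q; have := ler_norm (- Q); rewrite normrN.
  rewrite -[j]fintype.splitK; case: (fintype.split j) => i /=.
    by have := z1 i; rewrite mxE => /andP[? ?]; lra.
  by have := z2 i; rewrite mxE => /andP[? ?]; lra.
have := archi_boundP (normr_ge0 Q); move: (Num.bound _) => N QN.
move=> /andP[? ?]; rewrite -!(ler_int R) rmorphN/= -pmulrn.
by apply/andP; split; lra.
Qed.

(** Few points of a large box are close to an exceptional cell. *)
Lemma few_near_exc (eta : R) : 0 < eta -> exists xi Q0 : R, 0 < xi /\
  forall Q, Q0 <= Q -> 0 < Q -> forall (s : seq Zd) (D : R), uniq s -> D <= xi * Q ->
  (forall k, k \in s -> big_box Q k) ->
  (count (fun k => `[< (dist_set (toR R k) (exc P) <= D%:E)%E >]) s)%:R <=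
    eta * Q ^+ d.
Proof.
move=> eta0; have [xi [Q0 [xi0 h]]] := @exc_small _ _ _ P eta eta0.
exists xi, Q0; split => // Q Q0Q Qgt0 s D us DQ sQ.
have /ltW := h Q Q0Q; rewrite ler_pdivrMl ?exprn_gt0// [X in _ <= X -> _]mulrC.
apply: le_trans; rewrite ler_nat; apply: count_nb_points => //.
  exact/finite_setIl/big_box_finite.
move=> k ks /asboolP kD; split; first exact: sQ.
by apply: (le_trans kD); rewrite lee_fin.
Qed.

Lemma dist_exc0 k : exc P k -> (dist_set (toR R k) (exc P) <= 0)%E.
Proof.
by move=> ek; apply: ereal_inf_lbound; exists k => //; rewrite subrr normr0.
Qed.

Lemma not_good (D : R) k : 0 <= D -> cells k -> ~~ good P D k ->
  (dist_set (toR R k) (exc P) <= D%:E)%E.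
Proof.
move=> D0 ck /asboolPn ng; rewrite leNgt; apply/negP => Dk; apply: ng.
split => //; split => // ek; move: Dk; apply/negP; rewrite -leNgt.
by rewrite (le_trans (dist_exc0 ek)).
Qed.

End smallness.

Section inner_box.
Context (R : realType) (d1 d2 : nat) (P : phase_space R d1 d2).
Local Notation d := (d1 + d2)%N.
Local Notation Zd := 'rV[int]_(d1 + d2).
Local Notation Rd := 'rV[R]_(d1 + d2).

(** Room for a margin [eta]: three margins change the volume by at most [e]. *)
Lemma shrink_side n (h e : R) : 0 < h -> 0 < e ->
  exists eta, [/\ 0 < eta, 4 * eta <= h & h ^+ n - e <= (h - 3 * eta) ^+ n].
Proof.
move=> h0 e0; have /cvgrPdist_le /(_ e e0) := @exprn_continuous R n h.
move=> /nbhs_ballP[delta /= delta0 hd].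
pose eta := Num.min (delta / 4) (h / 4).
have eta0 : 0 < eta by rewrite /eta lt_min !divr_gt0.
have e1 : eta <= delta / 4 by rewrite /eta ge_min lexx.
have e2 : eta <= h / 4 by rewrite /eta ge_min lexx orbT.
exists eta; split => //; first by lra.
have : ball h delta (h - 3 * eta).
  by rewrite /ball/= opprB addrC subrK ger0_norm; lra.
by move=> /hd; rewrite ler_norml => /andP[_]; lra.
Qed.

Lemma leq_count_in (I : eqType) (s : seq I) (q q' : pred I) :
  (forall i, i \in s -> q i -> q' i) -> (count q s <= count q' s)%N.
Proof.
elim: s => //= i s IH qq'; apply: leq_add.
  by have := qq' i (mem_head _ _); case: (q i) => // ->.
by apply: IH => j js; apply: qq'; rewrite in_cons js orbT.
Qed.

Lemma truncn_bounds (x : R) : 0 < x ->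
  x - 1 < (Num.truncn x)%:R <= x.
Proof.
by move=> /ltW x0; have := truncn_itv x0; rewrite -natr1 => /andP[-> ?]/=; lra.
Qed.

Variables (L : nat -> R).
Hypotheses (L0 : forall n, 0 < L n) (Loo : L n @[n --> \oo] --> +oo).

Lemma L_ge (A : R) : \forall n \near \oo, A <= L n.
Proof. by move/cvgryPge : Loo; apply. Qed.

(** Inside the integer box attached to the cube [h (m + [0, 1)^d)] at scale
    [L n] one finds a scaled real box, of almost the same volume, that does
    not meet the boundary of the orthant. *)
Lemma inner_box (h e : R) (m o : Zd) : 0 < h -> 0 < e -> zorthant m ->
  exists a b : Rd, [/\ forall j, a 0 j < b 0 j, orthant a,
    `|\prod_j (b 0 j - a 0 j) - h ^+ d| <= e &
    exists2 eps0, 0 < eps0 & forall eps, 0 < eps <= eps0 -> \forall n \near \oo,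
      let N := Num.truncn (L n) in
      let U := zbox (o + corner (L n * h) m) (side (L n * h)) in
      let s := [seq z <- U | `[< scaled_box a b N z >]] in
      [/\ forall z, scaled_box a b N z -> z \in U,
          (h ^+ d - e) * L n ^+ d <= (size s)%:R &
          (count (predC (good P (eps * L n))) s)%:R <= e * L n ^+ d]].
Proof.
move=> h0 e0 /forallP m0.
have [eta [eta0 eta4 etae]] := shrink_side d h0 e0.
(* The margin eta absorbs, for large N, both the rounding of the corners and
   the difference between L n and its integral part N. *)
pose a : Rd := \row_j (h * (m 0 j)%:~R + eta).
pose b : Rd := \row_j (h * (m 0 j)%:~R + h - eta).
exists a, b; split.
- by move=> j; rewrite !mxE; lra.
- by move=> i; rewrite !mxE addr_ge0 ?(ltW eta0)// mulr_ge0 ?(ltW h0) ?ler0z.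
- rewrite (eq_bigr (fun=> h - 2 * eta)); last by move=> j _; rewrite !mxE; lra.
  rewrite prodr_const card_ord distrC ger0_norm ?subr_ge0.
    rewrite lerBlDr -lerBlDl (le_trans etae)// lerXn2r ?nnegrE//; lra.
  by rewrite lerXn2r ?nnegrE; lra.
pose Bm := `|toR R m|; pose Bo := `|toR R o|.
have hBm j : - Bm <= (m 0 j)%:~R <= Bm.
  by rewrite -ler_norml; have := row_norm_ge (toR R m) j; rewrite mxE.
have hBo j : - Bo <= (o 0 j)%:~R <= Bo.
  by rewrite -ler_norml; have := row_norm_ge (toR R o) j; rewrite mxE.
have Bm0 : 0 <= Bm by exact: normr_ge0.
have Bo0 : 0 <= Bo by exact: normr_ge0.
(* The scaled box lies in the ball of radius B * N. *)
pose B := h * (Bm + 1); have B0 : 0 < B by rewrite mulr_gt0// ltr_wpDl.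
have B20 : 0 < 2 * B by rewrite mulr_gt0.
have eta'0 : 0 < e / (2 * B) ^+ d by rewrite divr_gt0// exprn_gt0.
have [xi [Q0 [xi0 few]]] := few_near_exc P eta'0.
exists (xi * (2 * B)); first by rewrite mulr_gt0.
move=> eps /andP[eps0 epsxi].
near=> n.
set N := Num.truncn (L n); set U := zbox _ _; set s := [seq z <- U | _].
have [N1 N2] : L n - 1 < N%:R /\ N%:R <= L n.
  by have /andP[] := truncn_bounds (L0 n).
have L2 : 2 <= L n. by near: n; exact: L_ge.
have Leta : B + Bo + 1 + h + 1 <= eta * (L n - 1).
  rewrite mulrC -ler_pdivrMr// lerBrDr; near: n; exact: L_ge.
have LQ : Q0 <= 2 * B * L n.
  by rewrite mulrC -ler_pdivrMr//; near: n; exact: L_ge.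
have rho0 : 0 < L n * h by rewrite mulr_gt0.
have NL (t : R) : 0 <= t * (L n - N%:R) + `|t| /\ t * (L n - N%:R) - `|t| <= 0.
  have : `|t * (L n - N%:R)| <= `|t|.
    rewrite normrM -[leRHS]mulr1 ler_wpM2l// ger0_norm; lra.
  by rewrite ler_norml; lra.
have hm j : `|h * (m 0 j)%:~R| <= h * Bm.
  by rewrite normrM (gtr0_norm h0) ler_pM2l// ler_norml.
have etaN : eta * (L n - 1) <= eta * N%:R by rewrite ler_pM2l// ltW.
have BE : B = h * Bm + h by rewrite /B mulrDr mulr1.
have incl z : scaled_box a b N z -> z \in U.
  move=> zab; apply/zboxP => j; have := zab j; rewrite !mxE => zj.
  have [NL1 NL2] := NL (h * (m 0 j)%:~R); have := hBo j; have := hm j.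
  have := side_gt (ltW rho0).
  have := ceil_itv (L n * h * (m 0 j)%:~R).
  rewrite rmorphB/= -!(ler_int R) -(ltr_int R) !rmorphD/= -pmulrn.
  have NN : eta * N%:R <= h * N%:R by rewrite ler_pM2r//; lra.
  have -> : L n * h * (m 0 j)%:~R = (h * (m 0 j)%:~R) * L n by ring.
  move: zj NL1 NL2; rewrite !mulrBr !mulrBl !mulrDl.
  move: ((Num.ceil _)%:~R : R) ((side (L n * h))%:R : R) ((o 0 j)%:~R : R) ((z 0 j)%:~R : R).
  move=> C S oj zj.
  move: (h * (m 0 j)%:~R) => t /andP[z1 z2] NL1 NL2 /andP[C1 C2] S1 tB /andP[q1 q2].
  have := ler_norm t; have := ler_norm (- t); rewrite normrN => t1 t2.
  move: Leta etaN; rewrite !mulrBr => Leta etaN.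
  have hN : h * N%:R <= h * L n by rewrite ler_pM2l.
  rewrite mulr1z in C1; apply/andP; split; lra.
split => //.
- pose w := side ((h - 2 * eta) * N%:R).
  have h2 : 0 < h - 2 * eta by lra.
  have N0 : 0 < N%:R :> R by lra.
  have hN0 : 0 < (h - 2 * eta) * N%:R by rewrite mulr_gt0.
  have wN := side_gt (ltW hN0); have wN' := side_le (ltW hN0).
  have sw : (w ^ d <= size s)%N.
    rewrite -(size_zbox (ceil_vec (N%:R *: a)) w).
    apply: uniq_leq_size; first exact: zbox_uniq.
    move=> z /zboxP zw; have zab : scaled_box a b N z.
      move=> j; have /andP[] := zw j.
      have CE : ceil_vec (N%:R *: a) 0 j = Num.ceil (N%:R * (h * (m 0 j)%:~R + eta)).
        by rewrite !mxE.
      have := ceil_itv (N%:R * (h * (m 0 j)%:~R + eta)); rewrite -CE !mxE.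
      move: (Num.ceil _) => C /andP[C1 C2]; rewrite -lezD1 => z1 z2.
      move: C1 C2 z1 z2; rewrite rmorphB/= -!(ler_int R) !rmorphD/= -pmulrn mulr1z.
      move: wN'; rewrite -/w => wN' C1 C2 z1 z2.
      by apply/andP; split; lra.
    by rewrite mem_filter incl// andbT; exact/asboolP.
  apply: (@le_trans _ _ (w ^ d)%N%:R); last by rewrite ler_nat.
  rewrite natrX; apply: (@le_trans _ _ ((h - 3 * eta) ^+ d * L n ^+ d)).
    by rewrite ler_wpM2r// exprn_ge0// ltW.
  rewrite -exprMn lerXn2r ?nnegrE//; first by rewrite mulr_ge0 ?(ltW (L0 n))//; lra.
  rewrite (le_trans _ (ltW wN))//.
  have := Leta; have h3 : (h - 2 * eta) * (L n - 1) <= (h - 2 * eta) * N%:R.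
    by rewrite ler_pM2l// ltW.
  by move: h3; rewrite !mulrBl !mulrBr; lra.
- have QE : e / (2 * B) ^+ d * (2 * B * L n) ^+ d = e * L n ^+ d.
    by rewrite [(2 * B * L n) ^+ d]exprMn mulrA divfK// expf_neq0// gt_eqF.
  rewrite -QE; have su : uniq s by exact/filter_uniq/zbox_uniq.
  have sab k : k \in s -> scaled_box a b N k by rewrite mem_filter => /andP[/asboolP].
  have scells k : k \in s -> cells k.
    move=> /sab ks i; have /andP[+ _] := ks (lshift d2 i).
    rewrite !mxE -(ltr_int R); apply: lt_le_trans.
    rewrite mulr_gt0//; last by lra.
    by rewrite ltr_wpDl// mulr_ge0 ?ler0z ?m0// ltW.
  apply: le_trans (few (2 * B * L n) LQ _ s (eps * L n) su _ _).
  + rewrite ler_nat; apply: leq_count_in => k ks /=.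
    move=> kg; apply/asboolP; apply: not_good => //; last exact: scells.
    by rewrite mulr_ge0 ?ltW.
  + by rewrite mulr_gt0.
  + by rewrite mulrA ler_pM2r.
  + move=> k /[dup] /sab ks /scells kc.
    have kB j : - (B * L n) <= (toR R k) 0 j <= B * L n.
      have := ks j; rewrite !mxE; have [NL1 NL2] := NL (h * (m 0 j)%:~R).
      have etaN0 : 0 <= eta * N%:R by rewrite mulr_ge0// ltW.
      have BN : B * N%:R <= B * L n by rewrite ler_pM2l.
      have hmN : `|h * (m 0 j)%:~R * N%:R| <= h * Bm * N%:R.
        by rewrite normrM (ger0_norm (ler0n _ _)) ler_wpM2r.
      have hN0 : 0 <= h * N%:R by rewrite mulr_ge0// ltW.
      have h1N : eta * N%:R <= h * N%:R by rewrite ler_wpM2r//; lra.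
      move: hmN BN; rewrite BE ler_norml !mulrDl mulNr.
      move: (h * _ * N%:R) (h * Bm * N%:R) => s1 s2 /andP[? ?] BN /andP[? ?].
      by apply/andP; split; lra.
    split=> i.
      by have := kB (lshift d2 i); have := kc i; rewrite -(ltr_int R) !mxE; lra.
    by have := kB (rshift d1 i); lra.
Unshelve. all: by end_near. Qed.

End inner_box.

(** * Local global mixing *)

Section box_limits.
Context (R : realType) (d1 d2 : nat) (P : phase_space R d1 d2).
Local Notation d := (d1 + d2)%N.
Local Notation Zd := 'rV[int]_(d1 + d2).
Local Notation X := (borel (total_space P)).
Variables (L : nat -> R).
Hypotheses (L0 : forall n, 0 < L n) (Loo : L n @[n --> \oo] --> +oo).
Local Notation average := (box_average P L).

(** [G] has mean [gamma] over the large boxes, up to an arbitrarily small error,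
    once the points close to the exceptional cells are left out. *)
Definition box_limit (G : Zd -> R) (gamma : R) : Prop :=
  forall h m o e, 0 < h -> zorthant m -> 0 < e -> exists2 eps0, 0 < eps0 &
  forall eps, 0 < eps <= eps0 -> \forall n \near \oo,
    `|average h eps n o m G - h ^+ d * gamma| <= e.

Lemma box_limit_ext G G' gamma : (forall k, regular P k -> G k = G' k) ->
  box_limit G gamma -> box_limit G' gamma.
Proof.
move=> GG' lG h m o e h0 m0 e0; have [eps0 eps00 H] := lG h m o e h0 m0 e0.
exists eps0 => // eps /H; apply: filterS => n.
rewrite /box_average (eq_bigr G')// => k /good_regular; exact: GG'.
Qed.

Lemma box_limit_affine G gamma (a b : R) : box_limit (fun=> 1) 1 ->
  box_limit G gamma -> box_limit (fun k => a + b * G k) (a + b * gamma).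
Proof.
move=> l1 lG h m o e h0 m0 e0.
have C0 : 0 < `|a| + `|b| + 1 by rewrite ltr_wpDl// addr_ge0.
have e' : 0 < e / (`|a| + `|b| + 1) by rewrite divr_gt0.
have [eps1 eps10 H1] := l1 h m o _ h0 m0 e'.
have [eps2 eps20 H2] := lG h m o _ h0 m0 e'.
exists (Num.min eps1 eps2); first by rewrite lt_min eps10.
move=> eps; rewrite le_min andbA => /andP[/andP[eps0 epse1] epse2].
have := H1 eps; rewrite eps0 => /(_ epse1) => N1.
have := H2 eps; rewrite eps0 => /(_ epse2) => N2.
near=> n.
have A1 : `|average h eps n o m (fun=> 1) - h ^+ d * 1| <= e / (`|a| + `|b| + 1).
  by near: n.
have A2 : `|average h eps n o m G - h ^+ d * gamma| <= e / (`|a| + `|b| + 1).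
  by near: n.
have -> : average h eps n o m (fun k => a + b * G k) - h ^+ d * (a + b * gamma) =
  a * (average h eps n o m (fun=> 1) - h ^+ d * 1) +
  b * (average h eps n o m G - h ^+ d * gamma).
  rewrite /box_average big_split/= -mulr_sumr.
  rewrite (eq_bigr (fun=> a * 1)); last by move=> k _; rewrite mulr1.
  by rewrite -mulr_sumr; ring.
rewrite (le_trans (ler_normD _ _))// !normrM.
apply: (@le_trans _ _ (`|a| * (e / (`|a| + `|b| + 1)) + `|b| * (e / (`|a| + `|b| + 1)))).
  by apply: lerD; rewrite ler_wpM2l.
rewrite -mulrDl mulrA ler_pdivrMr// mulrC ler_wpM2l ?(ltW e0)//; lra.
Unshelve. all: by end_near. Qed.

Lemma box_limit_ge0 G gamma : (forall k, regular P k -> 0 <= G k) ->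
  box_limit G gamma -> 0 <= gamma.
Proof.
move=> G0 lG; rewrite leNgt; apply/negP => g0.
have m0 : zorthant (0 : Zd) by apply/forallP => i; rewrite mxE.
have e0 : 0 < - gamma / 2 by lra.
have [eps0 eps00 H] := lG 1 0 0 _ ltr01 m0 e0.
have [n _ /(_ n (leqnn _))] := H eps0 (introT andP (conj eps00 (lexx _))).
rewrite expr1n mul1r; have : 0 <= average 1 eps0 n 0 0 G.
  rewrite mulr_ge0 ?invr_ge0 ?exprn_ge0 ?(ltW (L0 n))//.
  by apply: sumr_ge0 => k /good_regular /G0.
by rewrite ler_norml; lra.
Qed.

Section boxes.
Variables (h e : R) (m o : Zd).
Hypotheses (h0 : 0 < h).

Let U n := zbox (o + corner (L n * h) m) (side (L n * h)).

(** The normalized sums over the good points of the box and over its part [s]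
    differ little when [s] has almost full volume and few points that are not
    good. *)
Lemma box_average_diff (q : pred Zd) (G F : Zd -> R) (K A eps : R) n :
  let s := [seq z <- U n | q z] in
  0 <= K -> 0 <= A -> (h ^+ d - e) * L n ^+ d <= (size s)%:R ->
  (count (predC (good P (eps * L n))) s)%:R <= e * L n ^+ d ->
  (forall k, good P (eps * L n) k -> F k = G k) ->
  (forall k, good P (eps * L n) k -> `|G k| <= K) -> (forall k, `|F k| <= A) ->
  `|average h eps n o m G - (L n ^+ d)^-1 * \sum_(k <- s) F k| <= (K + A) * e.
Proof.
move=> s K0 A0 sU bad FG GK FA; rewrite /box_average -mulrBr normrM.
have Ld : 0 < L n ^+ d by rewrite exprn_gt0.
rewrite ger0_norm ?invr_ge0 ?(ltW Ld)// ler_pdivrMl//.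
rewrite big_filter big_mkcond [X in _ - X]big_mkcond -sumrB.
apply: (le_trans (ler_norm_sum _ _ _)).
apply: (@le_trans _ _ (\sum_(k <- U n) (K * (predC q k)%:R +
    A * (predI (predC (good P (eps * L n))) q k)%:R))).
  apply: ler_sum => k _ /=; have [gk|gk] /= := boolP (good _ _ k).
    case: (q k) => /=; first by rewrite FG// subrr normr0 mulr0 mulr0 addr0.
    by rewrite subr0 mulr1 mulr0 addr0 GK.
  case: (q k) => /=; rewrite sub0r normrN ?mulr0 ?mulr1 ?add0r ?addr0//.
  by rewrite normr0.
rewrite big_split/= -!mulr_sumr !sumr_count.
have -> : L n ^+ d * ((K + A) * e) = K * (e * L n ^+ d) + A * (e * L n ^+ d) by ring.
apply: lerD.
  rewrite ler_wpM2l//.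
  have Us : (count q (U n) + count (predC q) (U n) = side (L n * h) ^ d)%N.
    by rewrite count_predC size_zbox.
  have : (L n ^+ d)^-1 * (side (L n * h) ^ d)%N%:R <= h ^+ d by exact: box_size.
  rewrite ler_pdivrMl// -Us natrD => Us'.
  by move: sU; rewrite /s size_filter; lra.
by rewrite ler_wpM2l// -count_filter.
Qed.

End boxes.
End box_limits.

Section averages.
Context (R : realType) (d1 d2 : nat) (P : phase_space R d1 d2).
Local Notation d := (d1 + d2)%N.
Local Notation X := (borel (total_space P)).
Local Notation mu := (@mu R d1 d2 P).
Variables (L : nat -> R).
Hypotheses (L0 : forall n, 0 < L n) (Loo : L n @[n --> \oo] --> +oo).
Local Notation box_limit := (box_limit P L).

Lemma box_limit_one : box_limit (fun=> 1) 1.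
Proof.
move=> h m o e h0 m0 e0; have e3 : 0 < e / 3 by rewrite divr_gt0.
have [a [b [_ _ _ [eps0 eps00 H]]]] := inner_box P L0 Loo o h0 e3 m0.
exists eps0 => // eps /H; apply: filterS => n [_ + bad].
set s := [seq _ <- _ | _] => sU.
have := @box_average_diff _ _ _ P L L0 h (e / 3) m o h0 _ (fun=> 1) (fun=> 1)
   1 1 eps n ler01 ler01 sU bad.
rewrite -/s !normr1 => /(_ (fun _ _ => erefl) (fun _ _ => lexx _) (fun _ => lexx _)).
rewrite sumr_const_seq mul1r.
have Ld : 0 < L n ^+ d by rewrite exprn_gt0.
have : (L n ^+ d)^-1 * (size s)%:R <= h ^+ d.
  apply: (le_trans _ (box_size d1 d2 L0 n h0)); rewrite ler_pM2l ?invr_gt0// ler_nat.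
  by rewrite -(size_zbox (o + corner (L n * h) m)) size_filter count_size.
have : h ^+ d - e / 3 <= (L n ^+ d)^-1 * (size s)%:R.
  by rewrite ler_pdivlMl// mulrC.
rewrite !ler_norml mulr1; lra.
Qed.

Lemma truncn_cvg : Num.truncn (L n) @[n --> \oo] --> \oo.
Proof.
apply/cvgnyPge => A; have := L_ge Loo (A%:R + 1); apply: filterS => n LA.
rewrite -(ler_nat R); have := truncn_bounds (L0 n); lra.
Qed.

Lemma truncn_pow (e : R) : 0 < e -> \forall n \near \oo,
  `|(Num.truncn (L n))%:R ^+ d - L n ^+ d| <= e * L n ^+ d.
Proof.
move=> e0; have [eta [eta0 eta4 etae]] := shrink_side d ltr01 e0.
rewrite expr1n in etae.
have := L_ge Loo (3 * eta)^-1; apply: filterS => n Ln.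
have /andP[N1 N2] := truncn_bounds (L0 n).
have Leta : 1 <= 3 * eta * L n.
  by rewrite mulrC -ler_pdivrMr ?mulr_gt0// mul1r.
rewrite distrC ger0_norm; last first.
  by rewrite subr_ge0 lerXn2r ?nnegrE// ltW.
have : (1 - 3 * eta) ^+ d * L n ^+ d <= (Num.truncn (L n))%:R ^+ d.
  rewrite -exprMn lerXn2r ?nnegrE//.
    by rewrite mulr_ge0 ?(ltW (L0 n))//; lra.
  by rewrite mulrBl mul1r; lra.
have := ler_wpM2r (ltW (exprn_gt0 d (L0 n))) etae.
rewrite mulrBl mul1r; lra.
Qed.

(** The averages of a function in G_O: the defining property is applied to a real
    box slightly inside each integer box. *)
Lemma box_limit_GO (Phi : X -> R) (gamma : R) : G_O Phi gamma ->
  box_limit (cell_integral Phi) gamma.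
Proof.
move=> [uc lim] h m o e h0 m0 e0.
have mPhi := measurable_unif_continuous uc.
have [[K0 PhiK0] _] := uc; pose K := `|K0|.
have PhiK x : `|Phi x| <= K by rewrite (le_trans (PhiK0 x))// ler_norm.
have K_ge0 : 0 <= K by exact: normr_ge0.
have [A [A0 cellA]] := norm_cell_integral_le P.
(* All the errors below are at most e1 times C. *)
pose C := K + K * A + (h ^+ d + 1) * (1 + `|gamma|) + `|gamma|.
have hd : 0 < h ^+ d by rewrite exprn_gt0.
have C0 : 0 < C.
  have ? : 0 <= K * A by rewrite mulr_ge0// ltW.
  have : 0 < (h ^+ d + 1) * (1 + `|gamma|).
    by apply: mulr_gt0; have := normr_ge0 gamma; lra.
  by have := normr_ge0 gamma; rewrite /C; lra.
pose e1 := Num.min 1 (e / C).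
have e10 : 0 < e1 by rewrite lt_min ltr01 divr_gt0.
have e11 : e1 <= 1 by rewrite ge_min lexx.
have e1C : e1 * C <= e by rewrite -ler_pdivlMr// ge_min lexx orbT.
have [a [b [ab aO Pi [eps0 eps00 H]]]] := inner_box P L0 Loo o h0 e10 m0.
exists eps0 => // eps epse.
pose V := \prod_j (b 0 j - a 0 j).
have V0 : 0 < V by apply: prodr_gt0 => j _; rewrite subr_gt0.
have prodE N : \prod_j (b 0 j * N%:R - a 0 j * N%:R) = V * N%:R ^+ d :> R.
  under eq_bigr do rewrite -mulrBl.
  by rewrite big_split/= prodr_const card_ord.
have /cvgrPdist_le /(_ _ e10) limab := lim a b ab aO.
have limN : \forall n \near \oo, let N := Num.truncn (L n) in
    `|gamma - (\prod_j (b 0 j * N%:R - a 0 j * N%:R))^-1 *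
      \int[mu]_(x in region (scaled_box a b N)) Phi x| <= e1.
  exact: (truncn_cvg limab).
near=> n.
have [incl sU bad] : let N := Num.truncn (L n) in
  let U := zbox (o + corner (L n * h) m) (side (L n * h)) in
  let s := [seq z <- U | `[< scaled_box a b N z >]] in
  [/\ forall z, scaled_box a b N z -> z \in U,
    (h ^+ d - e1) * L n ^+ d <= (size s)%:R &
    (count (predC (good P (eps * L n))) s)%:R <= e1 * L n ^+ d].
  by near: n; exact: H.
have := @box_average_diff _ _ _ P L L0 h e1 m o h0 _ (cell_integral Phi)
   (cell_integral Phi) K (K * A) eps n K_ge0 (mulr_ge0 K_ge0 (ltW A0)) sU bad.
have L2 : 2 <= L n by near: n; exact: L_ge.
set N := Num.truncn (L n) in incl sU bad *.
set s := [seq _ <- _ | _] in sU bad *.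
move=> /(_ (fun _ _ => erefl)).
move=> /(_ (fun k gk => norm_cell_integral_regular (good_regular gk) mPhi PhiK)).
move=> /(_ (fun k => cellA k Phi K mPhi PhiK)) D1.
have /andP[N1 N2] : L n - 1 < N%:R <= L n by exact: truncn_bounds.
have N0 : 0 < N%:R :> R by lra.
have D2 : `|gamma - (\prod_j (b 0 j * N%:R - a 0 j * N%:R))^-1 *
      \int[mu]_(x in region (scaled_box a b N)) Phi x| <= e1.
  by rewrite /N; near: n; exact: limN.
have D3 : `|N%:R ^+ d - L n ^+ d| <= e1 * L n ^+ d.
  by rewrite /N; near: n; exact: truncn_pow.
have sE : scaled_box a b N = [set` s].
  apply/seteqP; split => z /=; rewrite mem_filter.
    by move=> /[dup] /incl -> zs; rewrite andbT; apply/asboolP.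
  by move=> /andP[/asboolP].
have us : uniq s by exact/filter_uniq/zbox_uniq.
move: D2; rewrite sE Rintegral_region_seq//; last first.
  exact: (integrable_region_seq s mPhi PhiK).
rewrite prodE; move: D1; set S := \sum_(k <- s) _; move: (box_average _ _ _ _ _ _ _ _).
move=> B D1 D2.
have Ld : 0 < L n ^+ d by rewrite exprn_gt0.
have Nd : 0 < N%:R ^+ d :> R by rewrite exprn_gt0.
set q := N%:R ^+ d / L n ^+ d; set t := (L n ^+ d)^-1 * S in D1.
have q0 : 0 < q by rewrite divr_gt0.
have q1 : q <= 1.
  by rewrite ler_pdivrMr// mul1r lerXn2r ?nnegrE// ltW.
have Dq : `|q - 1| <= e1.
  have -> : q - 1 = (N%:R ^+ d - L n ^+ d) / L n ^+ d by rewrite mulrBl divff// gt_eqF.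
  by rewrite normrM normfV (gtr0_norm Ld) ler_pdivrMr.
have Dt : `|V * q * gamma - t| <= V * e1.
  have Vq : 0 < V * q by rewrite mulr_gt0.
  have -> : V * q * gamma - t = V * q * (gamma - (V * N%:R ^+ d)^-1 * S).
    rewrite /t /q; field; rewrite !gt_eqF//.
  rewrite normrM gtr0_norm//; apply: (@le_trans _ _ (V * q * e1)).
    by rewrite ler_pM2l.
  by rewrite ler_pM2r// -[leRHS]mulr1 ler_pM2l.
have V1 : V <= h ^+ d + 1.
  by move: Pi; rewrite -/V ler_norml; lra.
(* Error of the sum over the inner box, of its limit, of N^d against (L n)^d, and
   of the volume of the inner box. *)
have -> : B - h ^+ d * gamma = (B - t) - (V * q * gamma - t) + V * gamma * (q - 1)
    + (V - h ^+ d) * gamma by ring.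
have T1 : `|V * gamma * (q - 1)| <= V * `|gamma| * e1.
  by rewrite !normrM (gtr0_norm V0) ler_wpM2l// mulr_ge0// ltW.
have T2 : `|(V - h ^+ d) * gamma| <= e1 * `|gamma|.
  by rewrite normrM ler_wpM2r.
have T3 : V * (e1 * (1 + `|gamma|)) <= (h ^+ d + 1) * (e1 * (1 + `|gamma|)).
  by rewrite ler_wpM2r// mulr_ge0 ?(ltW e10)// addr_ge0.
apply: le_trans e1C; apply: (le_trans (ler_normD _ _)).
apply: (@le_trans _ _ (((K + K * A) * e1 + V * e1 + V * `|gamma| * e1) + e1 * `|gamma|)).
  apply: lerD => //; apply: (le_trans (ler_normD _ _)); apply: lerD => //.
  apply: (le_trans (ler_normD _ _)); apply: lerD => //.
  by rewrite normrN.
rewrite /C; move: T3; rewrite !mulrDr !mulrDl; lra.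
Unshelve. all: by end_near. Qed.

End averages.

Section local_global.
Context (R : realType) (d1 d2 : nat) (P : phase_space R d1 d2).
Local Notation d := (d1 + d2)%N.
Local Notation Zd := 'rV[int]_(d1 + d2).
Local Notation Rd := 'rV[R]_(d1 + d2).
Local Notation X := (borel (total_space P)).

Lemma box_limit_seq (L : nat -> R) G gamma (h e : R) (o : Zd) (ms : seq Zd) :
  box_limit P L G gamma -> 0 < h -> 0 < e -> (forall m, m \in ms -> zorthant m) ->
  exists2 eps0, 0 < eps0 & forall eps, 0 < eps <= eps0 -> \forall n \near \oo,
    forall m, m \in ms -> `|box_average P L h eps n o m G - h ^+ d * gamma| <= e.
Proof.
move=> lG h0 e0; elim: ms => [_|m ms IH msO].
  by exists 1 => // eps _; apply: nearW.
have [|eps1 eps10 H1] := IH; first by move=> k kms; apply: msO; rewrite in_cons kms orbT.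
have [|eps2 eps20 H2] := lG h m o e h0 _ e0; first by apply: msO; rewrite mem_head.
exists (Num.min eps1 eps2); first by rewrite lt_min eps10.
move=> eps; rewrite le_min andbA => /andP[/andP[eps0 epse1] epse2].
have := H1 eps; rewrite eps0 => /(_ epse1) N1.
have := H2 eps; rewrite eps0 => /(_ epse2) N2.
near=> n => k; rewrite in_cons => /predU1P[->|]; first by near: n.
by move: k; near: n.
Unshelve. all: by end_near. Qed.

(** A radius exceeding the sup norms of the points of the scaled cubes. *)
Lemma seq_bound (h : R) (ms : seq Zd) : 0 < h -> exists2 r, 0 < r &
  forall m, m \in ms -> forall j, (`|m 0 j|%:~R + 1) * h < r.
Proof.
move=> h0; elim: ms => [|m ms [r r0 IH]]; first by exists 1.
pose B := (`|toR R m| + 1) * h.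
have B0 : 0 <= B by rewrite mulr_ge0 ?(ltW h0)// addr_ge0.
exists (r + B + 1); first by lra.
move=> k; rewrite in_cons => /predU1P[-> j|/IH + j]; last by move=> /(_ j); lra.
apply: (@le_lt_trans _ _ B); last by lra.
rewrite ler_pM2r// lerD2r intr_norm; apply: le_trans (row_norm_ge _ j).
by rewrite mxE.
Qed.

Variables (T : X -> X) (L : nat -> R) (p : Rd -> R).
Hypothesis mT : measurable_fun setT T.
Hypotheses (L0 : forall n, 0 < L n) (Loo : L n @[n --> \oo] --> +oo).
Hypothesis dp : limit_density p.
Hypothesis hA : forall eps r : R, 0 < eps ->
  Defs.sup0 (errorA T L p eps r n) @[n --> \oo] --> 0%E.
Hypothesis hB : forall (w : exc_cell P) (phi : exc_fiber w -> R), is_lipschitz phi ->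
  forall eps r : R, 0 < eps ->
    Defs.sup0 (errorB T L p phi eps r n) @[n --> \oo] --> 0%E.

Lemma is_lipschitz_ball (F : pmetricType R) (phi : F -> R) : is_lipschitz phi ->
  (forall y, 0 <= phi y <= 1) -> exists r, lip_ball r phi.
Proof.
move=> [K phiK] phi01; exists (1 + `|K|); apply: lip_ballP => // [y|x y].
  by have /andP[a b] := phi01 y; rewrite ger0_norm.
by apply: (le_trans (phiK x y)); rewrite ler_wpM2r ?mdist_ge0// ler_norm.
Qed.

Lemma local_limit_cell (i : cell P) (phi : fiber i -> R) : is_lipschitz phi ->
  (forall y, 0 <= phi y <= 1) -> exists (o : Zd) (r1 : R),
  forall r eps e, r1 <= r -> 0 < eps -> 0 < e ->
  \forall n \near \oo, local_limit T L p n r eps e phi o.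
Proof.
case: i phi => w phi lphi phi01.
  have [r1 r1phi] := is_lipschitz_ball lphi phi01.
  exists (val w), r1 => r eps e r1r eps0 e0.
  have := local_limitA L0 (hA r eps0) e0.
  by apply: filterS => n; apply; exact: lip_ball_le r1phi.
by exists 0, 0 => r eps e _ eps0 e0; exact: (local_limitB L0 (hB lphi r eps0) e0).
Qed.

(** The one-sided limit for a nonnegative observable and a nonnegative Lipschitz
    density on one cell. *)
Lemma cell_lower (Phi : X -> R) (K gamma e : R) (i : cell P) (phi : fiber i -> R) :
  bounded_unif_continuous Phi -> (forall x, 0 <= Phi x <= K) ->
  box_limit P L (cell_integral Phi) gamma -> is_lipschitz phi ->
  (forall y, 0 <= phi y <= 1) -> 0 < e -> \forall n \near \oo,
  mean phi * gamma - e <= \int[cell_measure i]_y (phi y * Phi (iter n T (existT _ i y))).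
Proof.
move=> uc Phi01 lPhi lphi phi01 e0.
have mPhi := measurable_unif_continuous uc.
have gamma0 : 0 <= gamma.
  apply: box_limit_ge0 lPhi => // k _; apply: Rintegral_ge0 => x _.
  by have /andP[] := Phi01 x.
set A := mean phi; have A0 : 0 <= A.
  by apply: Rintegral_ge0 => y _; have /andP[] := phi01 y.
have div4 (s : R) : 0 <= s -> 0 < e / 4 / (s + 1) /\ s * (e / 4 / (s + 1)) <= e / 4.
  move=> s0; have s1 : 0 < s + 1 by lra.
  split; first by rewrite !divr_gt0.
  by rewrite mulrA ler_pdivrMr// mulrC ler_wpM2l; lra.
(* Four errors, each at most e / 4: the Darboux sum, the box averages, the
   Lipschitz approximation, and the local limit estimate. *)
have [e'0 e'e] := div4 (A * gamma) (mulr_ge0 A0 gamma0).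
have [h [ms [c [h0 [ums c0] msO c_le]]]] := density_lower_step dp e'0.
set C := \sum_(m <- ms) c m => hC.
have C0 : 0 <= C by apply: sumr_ge0 => m _.
have hd : 0 < h ^+ d by rewrite exprn_gt0.
have [e30 e3e] := div4 (A * C) (mulr_ge0 A0 C0).
have [e20 e2e] := div4 (A * (h ^+ d * C)) (mulr_ge0 A0 (mulr_ge0 (ltW hd) C0)).
have [e10 e1e] := div4 ((size ms)%:R * h ^+ d) (mulr_ge0 (ler0n _ _) (ltW hd)).
set e' := _ / (A * gamma + 1) in e'0 e'e hC.
set e3 := _ / (A * C + 1) in e30 e3e.
set e2 := _ / (A * (h ^+ d * C) + 1) in e20 e2e.
set e1 := _ / ((size ms)%:R * h ^+ d + 1) in e10 e1e.
have [r2 [Psi [lPsi Psi0 PsiPhi PhiPsi]]] := lower_lipschitz uc Phi01 e20.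
have [ oo [r1 LL]] := local_limit_cell lphi phi01.
have [r3 r30 msr] := seq_bound ms h0.
have [eps0 eps00 avg] := box_limit_seq oo lPhi h0 e30 msO.
pose r := Num.max r1 (Num.max r2 r3).
have r1r : r1 <= r by rewrite le_max lexx.
have r2r : r2 <= r by rewrite !le_max lexx orbT.
have r3r : r3 <= r by rewrite !le_max lexx !orbT.
near=> n.
have LLn : local_limit T L p n r eps0 e1 phi oo by near: n; exact: LL.
have avgn m : m \in ms ->
    `|box_average P L h eps0 n oo m (cell_integral Phi) - h ^+ d * gamma| <= e3.
  by move: m; near: n; apply: avg; rewrite eps00 lexx.
have := @core_lower_average _ _ _ P T L p mT L0 h ms c h0 c0 ums msO c_le n r eps0
  e1 e2 i phi oo 1 K Psi Phi (ltW e10) (ltW e20) (lt_le_trans r30 r3r) _ LLn _ phi01 mPhi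
  Phi01 (fun k => lip_ball_le r2r (lPsi k)) Psi0 PsiPhi PhiPsi.
have msr' m : m \in ms -> forall j : 'I_d, (`|m 0 j|%:~R + 1) * h < r.
  by move=> mms j; apply: lt_le_trans r3r; exact: msr.
have mphi : measurable_fun [set: borel (fiber i)] phi.
  by apply: (@continuous_borel R (fiber i)); exact: is_lipschitz_continuous.
move=> /(_ msr' mphi); apply: le_trans.
apply: (@le_trans _ _ (\sum_(m <- ms) (c m * A * (h ^+ d * gamma - e3) -
     (c m * A * e2 + e1) * h ^+ d))); last first.
  rewrite big_seq [leRHS]big_seq; apply: ler_sum => m /avgn.
  rewrite ler_norml => /andP[am _]; rewrite lerD2r ler_wpM2l//; first exact: mulr_ge0.
  by lra.
have -> : \sum_(m <- ms) (c m * A * (h ^+ d * gamma - e3) -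
     (c m * A * e2 + e1) * h ^+ d) =
   A * gamma * (h ^+ d * C) - A * C * e3 - A * (h ^+ d * C) * e2 - (size ms)%:R * h ^+ d * e1.
  rewrite (eq_bigr (fun m => (A * (h ^+ d * gamma - e3) - A * e2 * h ^+ d) * c m - e1 * h ^+ d)).
    rewrite sumrB -mulr_sumr sumr_const_seq -/C; ring.
  by move=> m _; ring.
have := ler_wpM2l (mulr_ge0 A0 gamma0) (ltW hC).
rewrite mulrBr mulr1; move: e'e e1e e2e e3e; rewrite -/A; lra.
Unshelve. all: by end_near. Qed.

End local_global.

Section affine.
Context (R : realType) (d1 d2 : nat) (P : phase_space R d1 d2).
Local Notation X := (borel (total_space P)).

Lemma unif_continuous_affine (Phi : X -> R) (a b : R) :
  bounded_unif_continuous Phi -> bounded_unif_continuous (fun x => a + b * Phi x).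
Proof.
move=> [[K PhiK] uc]; split.
  exists (`|a| + `|b| * K) => x; rewrite (le_trans (ler_normD _ _))// lerD2l normrM.
  by rewrite ler_wpM2l.
move=> e e0; have b1 : 0 < `|b| + 1 by rewrite ltr_wpDl.
have e1 : 0 < e / (`|b| + 1) by rewrite divr_gt0.
have [delta delta0 H] := uc _ e1; exists delta => // i x y xy.
rewrite opprD addrACA subrr add0r -mulrBr normrM.
have := H i x y xy; rewrite ltr_pdivlMr// mulrC; apply: le_lt_trans.
by rewrite ler_wpM2r// lerDl.
Qed.

Lemma cell_integral_affine (Phi : X -> R) (K a b : R) k : measurable_fun setT Phi ->
  (forall x, `|Phi x| <= K) -> regular P k ->
  cell_integral (fun x => a + b * Phi x) k = a + b * cell_integral Phi k.
Proof.
move=> mPhi PhiK rk; rewrite /cell_integral.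
have mk := measurable_region (P := P) [set k].
have ia := @integrable_region1 _ _ _ P k (fun=> a) `|a|
  (@measurable_cst _ _ _ _ _ a) (fun=> lexx _).
have iPhi := integrable_region1 k mPhi PhiK.
have ib : (@mu R d1 d2 P).-integrable (region [set k]) (EFin \o (fun x => b * Phi x)).
  exact: (integrableZl mk b iPhi).
by rewrite RintegralD// RintegralZl// Rintegral_cst// fine_mu_regular// mulr1.
Qed.

End affine.

Section local_global.
Context (R : realType) (d1 d2 : nat) (P : phase_space R d1 d2).
Local Notation d := (d1 + d2)%N.
Local Notation Zd := 'rV[int]_(d1 + d2).
Local Notation Rd := 'rV[R]_(d1 + d2).
Local Notation X := (borel (total_space P)).
Local Notation mu := (@mu R d1 d2 P).
Variables (T : X -> X) (L : nat -> R) (p : Rd -> R).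
Hypothesis mT : measurable_fun setT T.
Hypotheses (L0 : forall n, 0 < L n) (Loo : L n @[n --> \oo] --> +oo).
Hypothesis dp : limit_density p.
Hypothesis hA : forall eps r : R, 0 < eps ->
  Defs.sup0 (errorA T L p eps r n) @[n --> \oo] --> 0%E.
Hypothesis hB : forall (w : exc_cell P) (phi : exc_fiber w -> R), is_lipschitz phi ->
  forall eps r : R, 0 < eps ->
    Defs.sup0 (errorB T L p phi eps r n) @[n --> \oo] --> 0%E.

Section observable.
Variables (Phi : X -> R) (gamma : R).
Hypothesis GO : G_O Phi gamma.

Let uc : bounded_unif_continuous Phi := GO.1.
Let mPhi : measurable_fun setT Phi := measurable_unif_continuous uc.

Let measurable_orbit n : measurable_fun setT (Phi \o iter n T).
Proof. exact: (measurableT_comp mPhi (measurable_iter mT n)). Qed.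

(** The two-sided limit follows by applying [cell_lower] to [K + Phi] and to
    [K - Phi]. *)
Lemma cell_limit (i : cell P) (phi : fiber i -> R) : is_lipschitz phi ->
  (forall y, 0 <= phi y <= 1) ->
  \int[cell_measure i]_y (phi y * (Phi (iter n T (existT _ i y)) - gamma))
    @[n --> \oo] --> (0 : R).
Proof.
move=> lphi phi01; have [[K PhiK] _] := uc.
have mphi : measurable_fun [set: borel (fiber i)] phi.
  by apply: (@continuous_borel R (fiber i)); exact: is_lipschitz_continuous.
have iphi : (cell_measure i).-integrable setT (EFin \o phi).
  apply: (integrable_bounded (K := 1)) => //; first exact: cell_measure_fin.
  by move=> y; have /andP[? ?] := phi01 y; rewrite ger0_norm.
pose J n := \int[cell_measure i]_y (phi y * Phi (iter n T (existT _ i y))).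
have iphin n : (cell_measure i).-integrable setT
    (EFin \o (fun y => phi y * Phi (iter n T (existT _ i y)))).
  apply: (integrable_mul_bounded (K := K)) => //.
  exact: (measurableT_comp (measurable_orbit n) (@measurable_existT _ _ _ P i)).
have affine n (a b : R) : \int[cell_measure i]_y
    (phi y * (a + b * Phi (iter n T (existT _ i y)))) = a * mean phi + b * J n.
  have ia : (cell_measure i).-integrable setT (EFin \o (fun y => a * phi y)).
    exact: (integrableZl measurableT a iphi).
  have ib : (cell_measure i).-integrable setT
      (EFin \o (fun y => b * (phi y * Phi (iter n T (existT _ i y))))).
    exact: (integrableZl measurableT b (iphin n)).
  rewrite -RintegralZl// -RintegralZl// -RintegralD//.
  by apply: eq_Rintegral => y _; ring.
have box (b : R) : box_limit P L (cell_integral (fun x => K + b * Phi x)) (K + b * gamma).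
  apply: box_limit_ext (box_limit_affine K b (box_limit_one P L0 Loo) (box_limit_GO L0 Loo GO)).
  by move=> k rk; rewrite (cell_integral_affine _ _ mPhi PhiK).
have lower (b : R) e : `|b| = 1 -> 0 < e ->
    \forall n \near \oo, mean phi * (b * gamma) - e <= b * J n.
  move=> b1 e0.
  have bPhi x : 0 <= K + b * Phi x <= K + K.
    by have := PhiK x; rewrite -[X in X <= _]mul1r -b1 -normrM ler_norml; lra.
  have := cell_lower mT L0 dp hA hB (unif_continuous_affine K b uc) bPhi (box b) lphi phi01 e0.
  by apply: filterS => n; rewrite affine; lra.
apply/cvgrPdist_le => e e0.
near=> n; rewrite sub0r normrN.
have -> : \int[cell_measure i]_y (phi y * (Phi (iter n T (existT _ i y)) - gamma)) =
    J n - gamma * mean phi.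
  rewrite -[LHS](_ : \int[cell_measure i]_y
     (phi y * (- gamma + 1 * Phi (iter n T (existT _ i y)))) = _).
    by rewrite affine; ring.
  by apply: eq_Rintegral => y _; ring.
have l1 : mean phi * (1 * gamma) - e <= 1 * J n.
  by near: n; apply: lower => //; rewrite normr1.
have l2 : mean phi * (- 1 * gamma) - e <= - 1 * J n.
  by near: n; apply: lower => //; rewrite normrN normr1.
by rewrite ler_norml; lra.
Unshelve. all: by end_near. Qed.

Let g n (x : X) : R := Phi (iter n T x) - gamma.

Let mg n : measurable_fun setT (g n).
Proof. exact: (measurable_funB (measurable_orbit n) (@measurable_cst _ _ _ _ _ gamma)). Qed.

(** The case of an integrable function supported by one cell. *)
Lemma null_limit_region1 (phi : X -> R) k : mu.-integrable setT (EFin \o phi) ->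
  null_limit mu g (fun x => phi x * \1_(region [set k]) x).
Proof.
move=> iphi; have mk := measurable_region (P := P) [set k].
have [[K PhiK] _] := uc.
have gK n x : `|g n x| <= K + `|gamma|.
  by rewrite (le_trans (ler_normB _ _))// lerD2r.
have ik : mu.-integrable setT (EFin \o (fun x => phi x * \1_(region [set k]) x)).
  apply: (integrable_mul_bounded (K := 1)) => //; exact: indic_le1.
split => //.
have E n : \int[mu]_x (phi x * \1_(region [set k]) x * g n x) =
    \int[mu]_(x in region [set k]) (phi x * g n x).
  rewrite [RHS]Rintegral_mkcond; apply: eq_Rintegral => x _.
  rewrite patchE indicE; case: (x \in _); first by rewrite mulr1.
  by rewrite mulr0 mul0r.
under eq_fun do rewrite E.
have [ck|nck] := pselect (cells k); last first.
  rewrite region_notin//; under eq_fun do rewrite Rintegral_set0; exact: cvg_cst.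
have [i ik'] := site_surj P ck; rewrite -ik'.
have iphii : (cell_measure i).-integrable setT (EFin \o (phi \o existT _ i)).
  exact: integrable_cell.
have mphi : measurable_fun setT phi by apply/measurable_EFinP; exact: measurable_int iphi.
have gi n : \int[mu]_(x in region [set site i]) (phi x * g n x) =
    \int[cell_measure i]_y (phi (existT _ i y) * g n (existT _ i y)).
  apply: (@integral_cell _ _ _ P i (fun x => phi x * g n x)).
    exact: measurable_funM.
  apply: (integrable_mul_bounded (K := K + `|gamma|)) iphii _ _ => //.
    exact: (measurableT_comp (mg n) (@measurable_existT _ _ _ P i)).
under eq_fun do rewrite gi.
have [] := @null_limit_integrable R (fiber i) (cell_measure i)
  (fun n y => g n (existT _ i y)) (K + `|gamma|) (cell_measure_fin i) _ _ _
  (phi \o existT _ i) iphii => //.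
- by move=> n; exact: (measurableT_comp (mg n) (@measurable_existT _ _ _ P i)).
- by move=> f lf f01; exact: cell_limit.
Qed.

Lemma null_limit_total (phi : X -> R) : mu.-integrable setT (EFin \o phi) ->
  null_limit mu g phi.
Proof.
move=> iphi; have [[K PhiK] _] := uc.
have gK n x : `|g n x| <= K + `|gamma|.
  by rewrite (le_trans (ler_normB _ _))// lerD2r.
have mphi : measurable_fun setT phi by apply/measurable_EFinP; exact: measurable_int iphi.
apply: (null_limit_approx mg gK) => // e e0.
pose U (N : nat) : seq Zd := zbox (const_mx (- N%:Z)) (N + N).
(* The restriction of phi to the cells in a box of side 2 * N. *)
pose phiN N x := phi x * \1_(region [set` U N]) x.
have mU N : measurable (region (P := P) [set` U N]) by exact: measurable_region.
have phiNE N : phiN N = (fun x => \sum_(k <- U N) phi x * \1_(region [set k]) x).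
  apply/funext => x; rewrite /phiN -mulr_sumr; congr (_ * _).
  rewrite indicE; have [xU|xU] := boolP (cell_index x \in U N).
    rewrite mem_set// (bigD1_seq (cell_index x)) ?zbox_uniq//= indicE mem_set//.
    by rewrite big1 ?addr0// => k kx; rewrite indicE memNset// => xk; rewrite xk eqxx in kx.
  rewrite memNset; last exact/negP.
  rewrite big_seq big1// => k kU; rewrite indicE memNset// => xk.
  by move: xU; rewrite xk kU.
have iphiN N : mu.-integrable setT (EFin \o phiN N).
  by apply: (integrable_mul_bounded (K := 1)) => //; exact: indic_le1.
have [||||_ dl _] := @dominated_convergence _ _ _ mu setT measurableT
  (fun N => EFin \o phiN N) (EFin \o phi) (EFin \o (fun x => `|phi x|)) _ _ _
  (integrable_norm iphi) _.
- by move=> N; exact: measurable_int (iphiN N).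
- exact/measurable_EFinP.
- apply: aeW => x _; apply: cvg_near_cst.
  near=> N; rewrite /= /phiN indicE mem_set ?mulr1//.
  apply/zboxP => j; rewrite !mxE.
  suff : (\max_(j < d) absz (cell_index x ord0 j) < N)%N.
    have := @leq_bigmax _ (fun j : 'I_d => absz (cell_index x ord0 j)) j.
    by move: (\max_(_ < _) _) (cell_index x _ j) => B z zB BN; lia.
  near: N; exists (\max_(j < d) absz (cell_index x ord0 j)).+1 => //.
- apply: aeW => x N _ /=; rewrite lee_fin normrM.
  by rewrite -[leRHS]mulr1 ler_wpM2l// indic_le1.
move: dl => /fine_cvgP [_ /cvgrPdist_le /(_ _ e0)] [N _ /(_ N (leqnn _))] /=.
rewrite sub0r normrN => h; exists (phiN N); last first.
  apply: le_trans h; apply: le_trans (ler_norm _).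
  rewrite le_eqVlt; apply/orP; left; apply/eqP; congr fine.
  by apply: eq_integral => x _; rewrite /= distrC.
rewrite phiNE; apply: (null_limit_sum mg gK) => k; exact: null_limit_region1.
Unshelve. all: by end_near. Qed.

(** The conclusion for all integrable functions. *)
Lemma local_global_limit (phi : X -> R) : mu.-integrable setT (EFin \o phi) ->
  \int[mu]_x (phi x * Phi (iter n T x)) @[n --> \oo] --> (\int[mu]_x phi x) * gamma.
Proof.
move=> iphi; have [[K PhiK] _] := uc.
have [_ lim0] := null_limit_total iphi.
have gK n x : `|g n x| <= K + `|gamma|.
  by rewrite (le_trans (ler_normB _ _))// lerD2r.
have E n : \int[mu]_x (phi x * Phi (iter n T x)) =
    \int[mu]_x (phi x * g n x) + (\int[mu]_x phi x) * gamma.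
  rewrite -RintegralZr// -RintegralD//.
  - by apply: eq_Rintegral => x _; rewrite /g; ring.
  - exact: (integrable_mul_bounded measurableT iphi (mg n) (gK n)).
  - exact: (integrable_mul_bounded (K := `|gamma|) measurableT iphi).
under eq_fun do rewrite E.
have := cvgD lim0 (@cvg_cst _ ((\int[mu]_x phi x) * gamma) _ \oo _).
by rewrite add0r; apply.
Qed.

End observable.
End local_global.

(** * Averages over the boxes of a fixed side *)

Section almost_averages.
Context (R : realType) (d1 d2 : nat) (P : phase_space R d1 d2).
Local Notation d := (d1 + d2)%N.
Local Notation Zd := 'rV[int]_(d1 + d2).
Local Notation X := (borel (total_space P)).
Local Notation mu := (@mu R d1 d2 P).

(** The box of side [b] with lower corner [y] consists of good points, and the
    average of [G] over it is close to [gamma]. *)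
Definition nice (b : nat) (D eps : R) (G : Zd -> R) (gamma : R) (y : Zd) : bool :=
  all (fun v => good P D (y + v)) (box0 d b) &&
  (`|\sum_(v <- box0 d b) G (y + v) - (b ^ d)%N%:R * gamma| <= eps * (b ^ d)%N%:R).

(** Up to a set of small density, all the boxes of some fixed side are nice. *)
Definition almost_average (G : Zd -> R) (gamma : R) : Prop :=
  forall eps, 0 < eps -> exists2 b, (0 < b)%N & forall D, 0 <= D ->
  exists Q0, forall Q, (Q0 <= Q)%N -> forall s : seq Zd, uniq s ->
  (forall y, y \in s -> cells y /\ forall j, (`|y 0 j| <= Q%:Z)) ->
  (count (predC (nice b D eps G gamma)) s)%:R <= eps * Q%:R ^+ d.

Lemma almost_average_ext G G' gamma : (forall k, regular P k -> G k = G' k) ->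
  almost_average G gamma -> almost_average G' gamma.
Proof.
move=> GG' aG eps /aG [b b0 H]; exists b => // D /H [Q0 {}H]; exists Q0 => Q /H {}H s us sQ.
apply: le_trans (H s us sQ); rewrite ler_nat; apply: leq_count_in => y ys /=.
apply: contraNN; rewrite /nice => /andP[/[dup] gD -> /=].
rewrite big_seq [in X in _ -> X]big_seq (eq_bigr (fun v => G' (y + v)))//.
by move=> v vb; apply: GG'; exact: good_regular (allP gD v vb).
Qed.

Lemma almost_average_affine G gamma (a b : R) : `|b| <= 1 ->
  almost_average G gamma -> almost_average (fun k => a + b * G k) (a + b * gamma).
Proof.
move=> b1 aG eps /aG [w w0 H]; exists w => // D /H [Q0 {}H]; exists Q0 => Q /H {}H s us sQ.
apply: le_trans (H s us sQ); rewrite ler_nat; apply: leq_count_in => y ys /=.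
apply: contraNN; rewrite /nice => /andP[-> /=].
rewrite big_split/= sumr_const_seq size_box0 -mulr_sumr => h.
have -> : a * (w ^ d)%:R + b * (\sum_(v <- box0 d w) G (y + v)) - (w ^ d)%:R * (a + b * gamma)
  = b * (\sum_(v <- box0 d w) G (y + v) - (w ^ d)%:R * gamma) by ring.
by rewrite normrM -[leRHS]mul1r ler_pM.
Qed.

Lemma almost_average_ge0 G gamma : (forall k, regular P k -> 0 <= G k) ->
  almost_average G gamma -> 0 <= gamma.
Proof.
move=> G0 aG; rewrite leNgt; apply/negP => g0.
(* Some box of side b is nice, so that gamma is at least - eps. *)
pose eps := Num.min (1 / 2) (- gamma / 2) : R.
have eps0 : 0 < eps by rewrite /eps lt_min; apply/andP; split; lra.
have eps1 : eps <= 1 / 2 by rewrite /eps ge_min lexx.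
have epsg : eps <= - gamma / 2 by rewrite /eps ge_min lexx orbT.
have [b b0 /(_ 0 (lexx _)) [Q0 H]] := aG eps eps0.
pose Q := Q0.+1; pose s := zbox (const_mx 1 : Zd) Q.
have sQ y : y \in s -> cells y /\ forall j, `|y 0 j| <= Q%:Z.
  move=> /zboxP yQ; split=> [i|j].
    by have := yQ (lshift d2 i); rewrite mxE; lia.
  by have := yQ j; rewrite mxE; move: (y 0 j) => t; lia.
have := H Q (leqnSn _) s (zbox_uniq _ _) sQ => Hs.
have : (count (predC (nice b 0 eps G gamma)) s < size s)%N.
  rewrite -(ltr_nat R); apply: (le_lt_trans Hs).
  rewrite size_zbox natrX gtr_pMl ?exprn_gt0//; lra.
move=> few; suff : (size s <= count (predC (nice b 0 eps G gamma)) s)%N.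
  by rewrite leqNgt few.
rewrite -(count_predT s); apply: leq_count_in => y ys _ /=; apply/negP => /andP[gD].
have S0 : 0 <= \sum_(v <- box0 d b) G (y + v).
  rewrite big_seq; apply: sumr_ge0 => v vb; apply: G0.
  exact: good_regular (allP gD v vb).
have bd : 0 < (b ^ d)%N%:R :> R by rewrite ltr0n expn_gt0 b0.
rewrite ler_norml => /andP[_].
have : (b ^ d)%N%:R * (eps + gamma) < 0 by rewrite pmulr_rlt0//; lra.
by rewrite mulrDr; lra.
Qed.

(** The lower corner of the box of side [B] formed by the points of
    [window R b B]. *)
Definition window_corner (b B : nat) : Zd :=
  \row_j (match fintype.split j with
    | inl _ => Num.floor (- (b%:R / 2) : R) | inr _ => Num.floor (- (B%:R / 2) : R) end
    + 1).

Lemma window_sub (b B : nat) (z : Zd) : window R b B z ->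
  z \in zbox (window_corner b B) B.
Proof.
move=> [z1 z2]; apply/zboxP => j; rewrite mxE.
have key (x : R) (t : int) : x < t%:~R <= x + B%:R ->
    Num.floor x + 1 <= t < Num.floor x + 1 + B%:Z.
  move=> /andP[xt tx]; have /andP[f1 f2] := floor_itv x; apply/andP; split.
    by rewrite lezD1 -(ltr_int R); apply: le_lt_trans f1 xt.
  rewrite -(ltr_int R) !rmorphD/= -pmulrn.
  by move: f2; rewrite rmorphD/=; lra.
rewrite -[j]fintype.splitK; case: (fintype.split j) => i; rewrite fintype.unsplitK /=; apply: key.
  by have := z1 i; rewrite mxE addrC.
have := z2 i; rewrite mxE => /andP[-> zi] /=; apply: (le_trans zi).
by rewrite addrC; lra.
Qed.

Lemma cube_cellsE (y : Zd) (b : nat) (z : Zd) : (0 < b)%N ->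
  z = y + const_mx ((b./2)%:Z - 1) -> cube_cells z b = [set` zbox y b].
Proof.
move=> b0 ->; apply/seteqP; split => k.
  move=> kz; apply/zboxP => j; have := kz j; rewrite !mxE.
  by move: (y 0 j) (k 0 j) (b./2) => t u q; lia.
move=> /zboxP kz j; have := kz j; rewrite !mxE.
by move: (y 0 j) (k 0 j) (b./2) => t u q; lia.
Qed.

(** The distance to the exceptional set is 1-Lipschitz. *)
Lemma dist_set_shift (y v : Zd) (D r : R) : (`|toR R v| <= r) ->
  (dist_set (toR R (y + v)) (exc P) <= D%:E)%E ->
  (dist_set (toR R y) (exc P) <= (D + r)%:E)%E.
Proof.
move=> vr yD; apply/lee_addgt0Pr => e e0.
have : (dist_set (toR R (y + v)) (exc P) < (D + e)%:E)%E.
  by rewrite (le_lt_trans yD)// lte_fin ltrDl.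
move=> /ereal_inf_lt[_ [k ek <-]]; rewrite lte_fin => ykD.
apply: (@le_trans _ _ `|toR R y - toR R k|%:E).
  by apply: ereal_inf_lbound; exists k.
rewrite -EFinD lee_fin; have -> : toR R y - toR R k = (toR R (y + v) - toR R k) - toR R v.
  by rewrite /toR map_mxD addrAC addrK.
by apply: (le_trans (ler_normB _ _)); lra.
Qed.


Lemma bound_ge (x : R) : x <= (Num.bound `|x|)%:R.
Proof. exact: le_trans (ler_norm x) (ltW (archi_boundP (normr_ge0 x))). Qed.

(** A box of side [b] that is not nice either is one of the few cubes with a bad
    average or has a corner close to the exceptional set. *)
Lemma almost_average_GAO (Phi : X -> R) gamma : G_AO Phi gamma ->
  almost_average (cell_integral Phi) gamma.
Proof.
move=> [uc ao] eps eps0; have [[K PhiK] _] := uc.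
have mPhi := measurable_unif_continuous uc.
have p4 : 0 < (2 * 4 ^+ d : R) by rewrite mulr_gt0// exprn_gt0.
(* The window used below has side at most 4 * Q, and two kinds of bad points. *)
pose e1 := eps / (2 * 4 ^+ d).
have e10 : 0 < e1 by rewrite divr_gt0.
have e1E : 2 * e1 * 4 ^+ d = eps by rewrite /e1; field; rewrite expf_neq0.
have e1eps : e1 <= eps.
  have : 1 <= 4 ^+ d :> R by rewrite exprn_ege1// ler1n.
  move=> h; have := ler_wpM2l (ltW e10) h; rewrite mulr1 -e1E; lra.
have [b [B0 [b0 B00 win]]] := ao e1 e10.
exists b => // D D0; have [xi [Q1 [xi0 few]]] := few_near_exc P e10.
pose Q0 := (b.+1 + B0 + Num.bound `|Q1| + Num.bound `|(D + b%:R) / (xi * 2)|)%N.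
exists Q0 => Q Q0Q s us sQ.
have Qb : (b < Q)%N by move: Q0Q; rewrite /Q0; clear; lia.
have QB0 : (B0 < Q)%N by move: Q0Q; rewrite /Q0; clear; lia.
(* The cube centered at y + q is the box of side b with lower corner y. *)
pose q : Zd := const_mx ((b./2)%:Z - 1).
pose B := (2 * (Q + b).+1)%N.
pose S := window R b B `&` [set z | cube_cells z b `<=` cells /\
  `|Defs.average (cube z b) Phi - gamma| <= e1].
have BB0 : (B0 < B)%N by move: QB0; rewrite /B; clear; lia.
pose Wl := zbox (window_corner b B) B.
have fin_S : finite_set S.
  apply: finite_setIl; apply: sub_finite_set (finite_seq Wl).
  exact: window_sub.
have cS : (count (fun z => ~~ `[< S z >]) Wl)%:R <= e1 * B%:R ^+ d.
  have : (nb_points S <= count (fun z => `[< S z >]) Wl)%N.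
    rewrite -size_filter; apply: nb_points_le => // z Sz.
    by rewrite mem_filter (window_sub Sz.1) andbT; exact/asboolP.
  have := win B BB0; rewrite -/S => winB.
  have := count_predC (fun z => `[< S z >]) Wl; rewrite size_zbox => /esym BE.
  rewrite -(ler_nat R); have : (B ^ d)%N%:R = B%:R ^+ d :> R by rewrite natrX.
  rewrite BE natrD; move: winB; rewrite mulrBl mul1r; lra.
pose p1 y := ~~ `[< S (y + q) >].
pose p2 y := `[< (dist_set (toR R y) (exc P) <= (D + b%:R)%:E)%E >].
have c1 : (count p1 s)%:R <= e1 * B%:R ^+ d.
  apply: le_trans cS; rewrite ler_nat -!size_filter.
  rewrite -(size_map (fun y => y + q)); apply: uniq_leq_size.
    by rewrite map_inj_uniq; [exact: filter_uniq|exact: addIr].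
  move=> _ /mapP[y + ->]; rewrite !mem_filter => /andP[p1y ys].
  apply/andP; split => //; apply: window_sub; have [yc yQ] := sQ y ys.
  have [hb1 hb2] : 2 * (b./2)%:R <= b%:R :> R /\ b%:R <= 2 * (b./2)%:R + 1 :> R.
    by rewrite -natrM natr1 !ler_nat; clear; lia.
  have vE j : toR R (y + q) 0 j = (y 0 j)%:~R + (b./2)%:R - 1.
    by rewrite !mxE rmorphD/= rmorphB/= -pmulrn; ring.
  have yR j : - Q%:R <= ((y 0 j)%:~R : R) <= Q%:R.
    have := yQ j; rewrite -(ler_int R) intr_norm -pmulrn => yQj.
    by rewrite -ler_norml.
  have bR : 1 <= b%:R :> R by rewrite ler1n.
  have BE : B%:R = 2 * (Q%:R + b%:R + 1) :> R.
    by rewrite /B natrM -[(Q + b).+1%:R]natr1 natrD.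
  split=> i; rewrite vE BE; apply/andP; split.
  - have := yc i; rewrite -lez1D -(ler_int R) => y3; move: y3; rewrite addr0 mulr1z; lra.
  - by have := yR (lshift d2 i); lra.
  - by have := yR (rshift d1 i); lra.
  - by have := yR (rshift d1 i); lra.
have QR : 0 < Q%:R :> R by rewrite ltr0n (leq_ltn_trans (leq0n b)).
have Q0R : (Num.bound `|Q1|)%:R <= Q%:R :> R.
  by rewrite ler_nat; move: Q0Q; rewrite /Q0; clear; lia.
have Q0R' : (Num.bound `|(D + b%:R) / (xi * 2)|)%:R <= Q%:R :> R.
  by rewrite ler_nat; move: Q0Q; rewrite /Q0; clear; lia.
have c2 : (count p2 s)%:R <= e1 * (2 * Q%:R) ^+ d.
  apply: few => //.
  - by apply: (le_trans (bound_ge Q1)); lra.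
  - by rewrite mulr_gt0.
  - rewrite mulrA mulrC -ler_pdivrMr ?mulr_gt0//.
    by apply: (le_trans (bound_ge _)).
  - move=> y ys; have [yc yQ] := sQ y ys.
    have yR j : - Q%:R <= ((y 0 j)%:~R : R) <= Q%:R.
      have := yQ j; rewrite -(ler_int R) intr_norm -pmulrn => yQj.
      by rewrite -ler_norml.
    split=> i; rewrite mxE.
      have := yR (lshift d2 i); have := ltW (yc i); rewrite -(ler_int R); lra.
    by have := yR (rshift d1 i); lra.
have sub : (count (predC (nice b D eps (cell_integral Phi) gamma)) s <=
    count p1 s + count p2 s)%N.
  rewrite -count_predUI; apply: leq_trans (leq_addr _ _); apply: leq_count_in => y ys /=.
  apply: contraNT; rewrite negb_or negbK => /andP[/asboolP[_ [cc av]] /asboolPn np2].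
  have [yc yQ] := sQ y ys.
  have gD v : v \in box0 d b -> good P D (y + v).
    move=> /box0P vb; apply: contrapT => /negP ng; apply: np2.
    apply: (@dist_set_shift y v); last first.
      apply: not_good ng => // i; rewrite mxE.
      by rewrite ltr_pwDl//; have /andP[] := vb (lshift d2 i).
    apply/ltW/row_norm_lt => [|j]; first by rewrite ltr0n.
    rewrite mxE -intr_norm -[b%:R]/(b%:Z%:~R) ltr_int.
    by have /andP[v0 v1] := vb j; rewrite ger0_norm.
  rewrite /nice; apply/andP; split; first by apply/allP.
  have bd : 0 < (b ^ d)%N%:R :> R by rewrite ltr0n expn_gt0 b0.
  have gk k : k \in zbox y b -> regular P k.
    by move=> /mapP[v vb ->]; exact: good_regular (gD v vb).
  move: av; rewrite /Defs.average /cube (@cube_cellsE y b)//.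
  rewrite fine_mu_region_seq ?zbox_uniq// Rintegral_region_seq ?zbox_uniq//; last first.
    exact: (integrable_region_seq _ mPhi PhiK).
  have -> : \sum_(k <- zbox y b) fine (mu (region [set k])) = (b ^ d)%N%:R.
    rewrite big_seq (eq_bigr (fun=> 1)); last by move=> k /gk; exact: fine_mu_regular.
    by rewrite -big_seq sumr_const_seq mul1r size_zbox.
  rewrite big_zbox; move: (\sum_(u <- _) _) => Sb av.
  have -> : Sb - (b ^ d)%:R * gamma = (b ^ d)%:R * ((b ^ d)%:R^-1 * Sb - gamma).
    by rewrite mulrBr mulrA divff ?mul1r// gt_eqF.
  by rewrite normrM gtr0_norm// mulrC ler_pM2r// (le_trans av).
apply: (@le_trans _ _ (e1 * B%:R ^+ d + e1 * (2 * Q%:R) ^+ d)).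
  apply: le_trans (lerD c1 c2); rewrite -natrD ler_nat.
  exact: sub.
have B4R : B%:R <= 4 * Q%:R :> R.
  have QbR : b%:R + 1 <= Q%:R :> R by rewrite natr1 ler_nat.
  by rewrite /B natrM -[(Q + b).+1%:R]natr1 natrD; clear -QbR; lra.
have B4 : B%:R ^+ d <= 4 ^+ d * Q%:R ^+ d :> R.
  by rewrite -exprMn; apply: lerXn2r => //; rewrite nnegrE ?ler0n ?mulr_ge0.
have Q4 : (2 * Q%:R) ^+ d <= 4 ^+ d * Q%:R ^+ d :> R.
  rewrite -exprMn; apply: lerXn2r; rewrite ?nnegrE ?mulr_ge0//.
  by rewrite ler_wpM2r// ler_nat.
have -> : eps * Q%:R ^+ d = e1 * (4 ^+ d * Q%:R ^+ d) + e1 * (4 ^+ d * Q%:R ^+ d).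
  by rewrite -[eps in LHS]e1E; ring.
by apply: lerD; rewrite ler_wpM2l// ltW.
Qed.

End almost_averages.

Lemma seq_threshold (I : eqType) (s : seq I) (Q : I -> nat -> Prop) :
  (forall i, i \in s -> exists W0, forall W, (W0 <= W)%N -> Q i W) ->
  exists W0, forall W, (W0 <= W)%N -> forall i, i \in s -> Q i W.
Proof.
elim: s => [_|i s IH H]; first by exists 0%N.
have [|W1 H1] := IH; first by move=> j js; apply: H; rewrite in_cons js orbT.
have [|W2 H2] := H i; first exact: mem_head.
exists (maxn W1 W2) => W; rewrite geq_max => /andP[W1W W2W] j.
by rewrite in_cons => /predU1P[->|/H1]; [exact: H2|apply].
Qed.

Section large_cubes.
Context (R : realType) (d1 d2 : nat) (P : phase_space R d1 d2).
Local Notation d := (d1 + d2)%N.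
Local Notation Zd := 'rV[int]_(d1 + d2).

(** If the sums of [f] over the boxes of side [b] with corners in [N] are at least
    [b^d * c], the sum over a larger box is bounded below by covering it with
    such boxes; the corners outside [N] cost at most [gamma] each. *)
Lemma cover_sum (f : Zd -> R) (x : Zd) (l b : nat) (c gamma : R) (N : pred Zd) :
  (0 < b)%N -> (b <= l)%N -> c <= gamma -> (forall k, 0 <= f k) ->
  (forall u, N (x + u) -> (b ^ d)%N%:R * c <= \sum_(v <- box0 d b) f (x + u + v)) ->
  \sum_(u <- box0 d (l - b)) (c - gamma * (~~ N (x + u))%:R) <=
  \sum_(u <- box0 d l) f (x + u).
Proof.
move=> b0 bl cg f0 H; have bd : 0 < (b ^ d)%N%:R :> R by rewrite ltr0n expn_gt0 b0.
rewrite -(ler_pM2l bd) (le_trans _ (sum_box_average x bl f0))// mulr_sumr.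
apply: ler_sum => u _; have [/H|_] := boolP (N (x + u)); first by rewrite mulr0 subr0.
rewrite mulr1 (@le_trans _ _ 0)//; last exact: sumr_ge0.
by rewrite pmulr_rle0// subr_le0.
Qed.

(** The boxes of the admissible cubes around the origin cell. *)
Definition central (a : Zd) (W : nat) : Prop :=
  (forall w, w \in zbox a W -> cells w) /\ origin_cell \in zbox a W.

Lemma central_range a W : central a W -> forall w, w \in zbox a W ->
  cells w /\ forall j, `|w 0 j| <= W%:Z.
Proof.
move=> [ac /zboxP ao] w wa; have wc := ac w wa; split => // j.
have /zboxP/(_ j) := wa; have := ao j; move: (wc).
rewrite -[j]fintype.splitK; case: (fintype.split j) => i /=.
  move=> /(_ i); rewrite /origin_cell row_mxEl mxE.
  by move: (w 0 _) (a 0 _); clear; lia.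
move=> _; rewrite /origin_cell row_mxEr mxE.
by move: (w 0 _) (a 0 _); clear; lia.
Qed.

Lemma pow_shift (b : nat) (eps : R) : 0 < eps -> exists W0, forall W, (W0 <= W)%N ->
  (b <= W)%N /\ (1 - eps) * W%:R ^+ d <= ((W - b) ^ d)%N%:R.
Proof.
move=> eps0; have [eta [eta0 eta4 etae]] := shrink_side d ltr01 eps0.
exists (b + Num.bound `|b%:R / (3 * eta)|)%N => W bW.
have bW' : (b <= W)%N by apply: leq_trans bW; exact: leq_addr.
split => //; rewrite natrX natrB//.
have Weta : b%:R <= 3 * eta * W%:R.
  rewrite mulrC -ler_pdivrMr ?mulr_gt0//; apply: (le_trans (bound_ge _)).
  by rewrite ler_nat; apply: leq_trans bW; exact: leq_addl.
apply: (@le_trans _ _ ((1 - 3 * eta) ^+ d * W%:R ^+ d)).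
  by rewrite ler_wpM2r ?exprn_ge0//; move: etae; rewrite expr1n.
rewrite -exprMn; apply: lerXn2r; rewrite ?nnegrE.
- by rewrite mulr_ge0//; lra.
- by rewrite subr_ge0 ler_nat.
- by rewrite mulrBl mul1r lerD2l lerN2.
Qed.

(** The average over large central boxes of functions almost above [G]. *)
Lemma density_sum G gamma (eps : R) : almost_average P G gamma -> 0 <= gamma ->
  0 < eps -> exists W0, forall W, (W0 <= W)%N -> forall a, central a W ->
  forall f : Zd -> R, (forall k, 0 <= f k) -> (forall k, regular P k -> G k - eps <= f k) ->
  W%:R ^+ d * (gamma - eps * (2 * gamma + 2)) <= \sum_(w <- zbox a W) f w.
Proof.
move=> aG g0 eps0; have [b b0 /(_ 0 (lexx _)) [Q0 H]] := aG eps eps0.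
have [W1 HW1] := pow_shift b eps0.
exists (maxn Q0 W1) => W; rewrite geq_max => /andP[Q0W W1W] a ca f f0 fG.
have [bW powW] := HW1 W W1W; rewrite big_zbox.
have sQ y : y \in zbox a (W - b) -> cells y /\ forall j, `|y 0 j| <= W%:Z.
  move=> /zboxP ya; apply: (central_range ca); apply/zboxP => j.
  by have := ya j; move: (y 0 j) (a 0 j); clear; lia.
have few := H W Q0W (zbox a (W - b)) (zbox_uniq _ _) sQ.
have := @cover_sum f a W b (gamma - 2 * eps) gamma (nice P b 0 eps G gamma) b0 bW _ f0.
move=> /(_ _ _) cov; apply: le_trans (cov _ _); last 2 first.
- by lra.
- move=> u /andP[/allP gD]; rewrite ler_norml => /andP[low _].
  apply: (@le_trans _ _ (\sum_(v <- box0 d b) (G (a + u + v) - eps))).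
    by rewrite sumrB sumr_const_seq size_box0; lra.
  rewrite big_seq [leRHS]big_seq; apply: ler_sum => v vb; apply: fG.
  exact: good_regular (gD v vb).
rewrite sumrB sumr_const_seq -mulr_sumr size_box0.
have -> : \sum_(u <- box0 d (W - b)) ((~~ nice P b 0 eps G gamma (a + u))%:R : R) =
    (count (predC (nice P b 0 eps G gamma)) (zbox a (W - b)))%:R.
  by rewrite -sumr_count big_zbox.
have := ler_wpM2l g0 few; have := ler_wpM2l g0 powW.
have : ((W - b) ^ d)%N%:R <= W%:R ^+ d :> R.
  by rewrite natrX; apply: lerXn2r; rewrite ?nnegrE// ler_nat leq_subr.
move=> h1 h2 h3; have := ler_wpM2l (ltW eps0) h1; move: h2 h3.
move: (W%:R ^+ d : R) (((W - b) ^ d)%N%:R : R) => B C h2 h3 h4.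
have -> : B * (gamma - eps * (2 * gamma + 2)) =
  gamma * ((1 - eps) * B) - 2 * (eps * B) - gamma * (eps * B) by ring.
by rewrite [(gamma - _) * C]mulrBl -[2 * eps * C]mulrA; lra.
Qed.

(** A weighted sum, over the [w] in a large central box, of the sums of [G] over
    the good points of the boxes of side [l] based at [w + t].  After covering
    the latter by boxes of side [b] and exchanging the sums, the boxes that are
    not nice are counted once for each position of the corner. *)
Lemma double_sum G gamma (eps : R) : almost_average P G gamma -> 0 <= gamma ->
  (forall k, regular P k -> 0 <= G k) -> 0 < eps ->
  exists2 b, (0 < b)%N & forall D, 0 <= D -> forall l, (b <= l)%N ->
  forall t : Zd, zorthant t -> exists W0, forall W, (W0 <= W)%N ->
  forall a, central a W -> forall (f : Zd -> R) K, (forall k, 0 <= f k <= K) ->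
  ((l - b) ^ d)%N%:R * ((gamma - eps) * \sum_(w <- zbox a W) f w
      - gamma * K * eps * (2 * W%:R) ^+ d) <=
  \sum_(w <- zbox a W) f w * \sum_(k <- zbox (w + t) l | good P D k) G k.
Proof.
move=> aG g0 G0 eps0; have [b b0 H] := aG eps eps0.
exists b => // D D0 l bl t /forallP t0; have [Q0 {}H] := H D D0.
exists (Q0 + l + \sum_(j < d) absz (t ord0 j))%N => W W0W a ca f K fK.
pose f2 k : R := if good P D k then G k else 0.
have f20 k : 0 <= f2 k by rewrite /f2; case: ifPn => // /good_regular /G0.
pose N := nice P b D eps G gamma.
have cov w : \sum_(u <- box0 d (l - b)) (gamma - eps - gamma * (~~ N (w + t + u))%:R) <=
    \sum_(k <- zbox (w + t) l | good P D k) G k.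
  rewrite [leRHS]big_mkcond/= big_zbox; apply: (@cover_sum f2 (w + t) l b _ _ N) => //; first by lra.
  move=> u /andP[/allP gD]; rewrite ler_norml => /andP[low _].
  rewrite big_seq (eq_bigr (fun v => G (w + t + u + v))).
    by rewrite -big_seq; lra.
  by move=> v /gD gv; rewrite /f2 gv.
apply: (@le_trans _ _ (\sum_(w <- zbox a W) \sum_(u <- box0 d (l - b))
    (f w * (gamma - eps) - gamma * K * (~~ N (w + t + u))%:R))); last first.
  apply: ler_sum => w _; have /andP[fw0 fwK] := fK w.
  apply: (@le_trans _ _ (f w * \sum_(u <- box0 d (l - b))
     (gamma - eps - gamma * (~~ N (w + t + u))%:R))); last exact: ler_wpM2l.
  rewrite mulr_sumr; apply: ler_sum => u _; rewrite [leRHS]mulrBr lerD2l lerN2.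
  rewrite mulrA [f w * gamma]mulrC; apply: ler_wpM2r => //.
  exact: ler_wpM2l.
rewrite exchange_big/= -size_box0 mulrC -sumr_const_seq.
rewrite big_seq [leRHS]big_seq; apply: ler_sum => u ul.
rewrite sumrB -mulr_suml -mulr_sumr [_ * (gamma - eps)]mulrC lerD2l lerN2.
have K0 : 0 <= K by have /andP[x y] := fK 0; exact: le_trans y.
rewrite -[leRHS]mulrA; apply: ler_wpM2l; first exact: mulr_ge0.
pose s := [seq w + (t + u) | w <- zbox a W].
have -> : \sum_(w <- zbox a W) ((~~ N (w + t + u))%:R : R) = (count (predC N) s)%:R.
  by rewrite -sumr_count [RHS]big_map; apply: eq_bigr => w _; rewrite /= addrA.
have -> : 2 * W%:R = (2 * W)%N%:R :> R by rewrite natrM.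
apply: H.
- by move: W0W; clear; lia.
- rewrite map_inj_uniq; [exact: zbox_uniq|exact: addIr].
- move=> _ /mapP[w /(central_range ca)[wc wW] ->]; move/box0P : ul => ul.
  split=> [i|j]; rewrite !mxE.
    by rewrite ltr_pwDl// addr_ge0//; have /andP[] := ul (lshift d2 i).
  have tj : (absz (t 0%R j) <= \sum_(j < d) absz (t ord0 j))%N.
    by rewrite (bigD1 j)//=; exact: leq_addr.
  have := ul j; have := wW j; move: W0W tj; move: (\sum_(_ < _) _)%N (w 0 j) (t 0 j) (u 0 j).
  by clear; lia.
Qed.

End large_cubes.

(** * Global global mixing *)

Section global_lower.
Context (R : realType) (d1 d2 : nat) (P : phase_space R d1 d2).
Local Notation d := (d1 + d2)%N.
Local Notation Zd := 'rV[int]_(d1 + d2).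
Local Notation Rd := 'rV[R]_(d1 + d2).
Local Notation X := (borel (total_space P)).
Local Notation M := (regular_fiber P).
Variables (T : X -> X) (L : nat -> R) (p : Rd -> R).
Hypothesis mT : measurable_fun setT T.
Hypotheses (L0 : forall n, 0 < L n) (Loo : L n @[n --> \oo] --> +oo).
Hypothesis dp : limit_density p.
Hypothesis hA : forall eps r : R, 0 < eps ->
  Defs.sup0 (errorA T L p eps r n) @[n --> \oo] --> 0%E.

Lemma box_side_lower (h e : R) (b : nat) : 0 < h -> 0 < e -> \forall n \near \oo,
  (b <= side (L n * h))%N /\
  h ^+ d - e <= (L n ^+ d)^-1 * ((side (L n * h) - b) ^ d)%N%:R.
Proof.
move=> h0 e0; have [eta [eta0 eta4 etae]] := shrink_side d h0 e0.
have := L_ge Loo ((b%:R + 1) / (3 * eta)); apply: filterS => n Ln.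
have Leta : b%:R + 1 <= 3 * eta * L n by rewrite mulrC -ler_pdivrMr// mulr_gt0.
have Lh0 : 0 < L n * h by rewrite mulr_gt0.
have S := side_gt (ltW Lh0).
have hb : 0 <= (h - 3 * eta) * L n by rewrite mulr_ge0 ?(ltW (L0 n))//; lra.
have key : (h - 3 * eta) * L n + b%:R <= (side (L n * h))%:R.
  by move: S; rewrite mulrBl; lra.
have bs : (b <= side (L n * h))%N by rewrite -(ler_nat R); lra.
split => //; rewrite ler_pdivlMl ?exprn_gt0// natrX natrB//.
apply: (@le_trans _ _ (L n ^+ d * (h - 3 * eta) ^+ d)).
  by rewrite ler_wpM2l// exprn_ge0// ltW.
rewrite -exprMn; apply: lerXn2r; rewrite ?nnegrE.
- by rewrite mulrC.
- by rewrite subr_ge0 ler_nat.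
- by rewrite mulrC; lra.
Qed.

Lemma corner_orthant (rho : R) (m : Zd) : 0 < rho -> zorthant m -> zorthant (corner rho m).
Proof.
move=> rho0 /forallP m0; apply/forallP => i; rewrite mxE.
by rewrite ceil_ge0 (lt_le_trans (ltrN10 _))// mulr_ge0 ?ler0z// ltW.
Qed.

Lemma nu_mean_le (psi : M -> R) (K : R) :
  measurable_fun [set: borel M] psi -> (forall y, 0 <= psi y <= K) -> nu_mean psi <= K.
Proof.
move=> mpsi psiK; have nuT : nu P [set: M] = 1%E := probability_setT (nu P).
have KE : \int[nu P]_(y in [set: borel M]) K = K * fine (nu P [set: M]).
  exact: Rintegral_cst.
have nufin : (nu P [set: M] < +oo)%E by rewrite nuT ltry.
rewrite nuT mulr1 in KE; rewrite -[leRHS]KE; apply: le_Rintegral => //.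
- apply: (integrable_bounded (K := K)) => // y.
  by have /andP[? ?] := psiK y; rewrite ger0_norm.
- exact: (@integrable_bounded _ _ _ (nu P) setT (cst K) `|K|).
- by move=> y _; have /andP[] := psiK y.
Qed.

Section observables.
Variables (Phi1 Phi2 : X -> R) (K gamma1 gamma2 : R).
Hypotheses (uc1 : bounded_unif_continuous Phi1) (uc2 : bounded_unif_continuous Phi2).
Hypotheses (Phi1K : forall x, 0 <= Phi1 x <= K) (Phi2K : forall x, 0 <= Phi2 x <= K).
Hypothesis ao1 : almost_average P (cell_integral Phi1) gamma1.
Hypothesis ao2 : almost_average P (cell_integral Phi2) gamma2.

Let mPhi1 := measurable_unif_continuous uc1.
Let mPhi2 := measurable_unif_continuous uc2.

(** The integrand of the global correlations at time [n]. *)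
Definition correlation n (x : X) : R := Phi1 x * Phi2 (iter n T x).

Lemma measurable_correlation n : measurable_fun setT (correlation n).
Proof.
apply: measurable_funM => //; exact: (measurableT_comp mPhi2 (measurable_iter mT n)).
Qed.

Lemma cell_correlation_ge n (w : regular_cell P) (psi : M -> R) :
  measurable_fun [set: borel M] psi ->
  (forall y, 0 <= psi y) -> (forall y, psi y <= Phi1 (existT _ (inl w) y)) ->
  \int[cell_measure (inl w : cell P)]_y (psi y * Phi2 (iter n T (existT _ (inl w) y))) <=
  cell_integral (correlation n) (val w).
Proof.
move=> mpsi psi0 psiPhi.
have cK x : `|correlation n x| <= K * K.
  have /andP[a1 b1] := Phi1K x; have /andP[a2 b2] := Phi2K (iter n T x).
  by rewrite /correlation ger0_norm ?mulr_ge0// ler_pM.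
have iw : measurable_fun [set: borel M] (existT _ (inl w) : borel M -> X).
  exact: (@measurable_existT _ _ _ P (inl w)).
rewrite (@cell_integral_site _ _ _ P (inl w) (correlation n) (K * K))//; last first.
  exact: measurable_correlation.
have nuT : cell_measure (inl w : cell P) setT = 1%E := probability_setT (nu P).
have nufin : (cell_measure (inl w : cell P) setT < +oo)%E by rewrite nuT ltry.
have mcor : measurable_fun [set: borel M] (fun y : borel M => correlation n (existT _ (inl w) y)).
  exact: (measurableT_comp (measurable_correlation n) iw).
apply: le_Rintegral => //.
- apply: (integrable_bounded (K := K * K)) => //.
    apply: measurable_funM => //.
    apply: (measurableT_comp mPhi2); exact: (measurableT_comp (measurable_iter mT n) iw).
  move=> y; have /andP[a1 b1] := Phi1K (existT _ (inl w) y).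
  have /andP[a2 b2] := Phi2K (iter n T (existT _ (inl w) y)).
  by rewrite ger0_norm ?mulr_ge0// ler_pM// (le_trans (psiPhi y)).
- by apply: (integrable_bounded (K := K * K)).
- move=> y _; apply: ler_wpM2r => //.
  by have /andP[] := Phi2K (iter n T (existT _ (inl w) y)).
Qed.

(** The lower bound for the correlations summed over a large central box. *)
Lemma global_lower (e : R) : 0 < e -> \forall n \near \oo,
  exists W0, forall W, (W0 <= W)%N -> forall a : Zd, central a W ->
  W%:R ^+ d * (gamma1 * gamma2 - e) <=
  \sum_(w <- zbox a W) cell_integral (correlation n) w.
Proof.
move=> e0.
have G10 k : regular P k -> 0 <= cell_integral Phi1 k.
  by move=> _; apply: Rintegral_ge0 => x _; have /andP[] := Phi1K x.
have G20 k : regular P k -> 0 <= cell_integral Phi2 k.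
  by move=> _; apply: Rintegral_ge0 => x _; have /andP[] := Phi2K x.
have g1 : 0 <= gamma1 := almost_average_ge0 G10 ao1.
have g2 : 0 <= gamma2 := almost_average_ge0 G20 ao2.
have g12 : 0 <= gamma1 * gamma2 by exact: mulr_ge0.
have K0 : 0 <= K by have /andP[x y] := Phi1K point; exact: le_trans y.
have div2 (s : R) : 0 <= s -> 0 < e / 2 / (s + 1) /\ s * (e / 2 / (s + 1)) <= e / 2.
  move=> s0; have s1 : 0 < s + 1 by lra.
  split; first by rewrite !divr_gt0.
  by rewrite mulrA ler_pdivrMr// mulrC ler_wpM2l; lra.
have [e'0 e'e] := div2 _ g12; set e' := _ / (gamma1 * gamma2 + 1) in e'0 e'e.
have [h [ms [c [h0 [ums c0] msO c_le]]]] := density_lower_step dp e'0.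
set C := \sum_(m <- ms) c m => hC.
have C0 : 0 <= C by apply: sumr_ge0 => m _.
have hd : 0 < h ^+ d by rewrite exprn_gt0.
have hC0 : 0 <= h ^+ d * C by rewrite mulr_ge0// ltW.
(* The error is at most e' * gamma1 * gamma2 for the Darboux sum, plus eps * Z,
   where h^d * C * Y comes from the double sum. *)
pose Y := gamma2 * (2 * gamma1 + 2) + K + gamma2 * K * 2 ^+ d.
have Y0 : 0 <= Y.
  by rewrite /Y !addr_ge0// ?mulr_ge0// ?addr_ge0// ?mulr_ge0// exprn_ge0.
pose Z := C * (gamma1 * gamma2) + h ^+ d * C * Y + (C * K + (size ms)%:R) * h ^+ d.
have Z0 : 0 <= Z.
  rewrite /Z !addr_ge0//; first exact: mulr_ge0; first exact: mulr_ge0.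
  by rewrite mulr_ge0 ?(ltW hd)// addr_ge0// mulr_ge0.
have [eps0 epsZ] := div2 _ Z0; set eps := _ / (Z + 1) in eps0 epsZ.
have [r1 [Psi1 [lPsi1 Psi10 Psi1Phi Phi1Psi]]] := lower_lipschitz uc1 Phi1K eps0.
have [r2 [Psi2 [lPsi2 Psi20 Psi2Phi Phi2Psi]]] := lower_lipschitz uc2 Phi2K eps0.
have [r3 r30 msr] := seq_bound ms h0.
pose r := Num.max r1 (Num.max r2 r3).
have r1r : r1 <= r by rewrite le_max lexx.
have r2r : r2 <= r by rewrite !le_max lexx orbT.
have r3r : r3 <= r by rewrite !le_max lexx !orbT.
have r0 : 0 < r by exact: lt_le_trans r3r.
have msr' m : m \in ms -> forall j : 'I_d, (`|m 0 j|%:~R + 1) * h < r.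
  by move=> mms j; apply: lt_le_trans r3r; exact: msr.
have [b b0 dsum] := double_sum ao2 g2 G20 eps0.
have [W1 HW1] := density_sum ao1 g1 eps0.
have mPsi1 k : measurable_fun [set: borel M] (Psi1 k).
  by apply: (@continuous_borel R M); apply: is_lipschitz_continuous; case: (lPsi1 k).
(* The means of the Lipschitz minorants of Phi1. *)
pose f k : R := if `[< regular P k >] then nu_mean (Psi1 k) else 0.
have Psi1K (w : regular_cell P) y : 0 <= Psi1 (val w) y <= K.
  rewrite Psi10 (le_trans (Psi1Phi w y))//.
  by have /andP[] := Phi1K (existT _ (inl w) y).
have fK k : 0 <= f k <= K.
  rewrite /f; case: ifPn => [/asboolP/regularP[w <-]|_]; last by rewrite lexx.
  have := nu_mean_le (mPsi1 _) (Psi1K w) => ->; rewrite andbT.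
  by apply: Rintegral_ge0 => y _; exact: Psi10.
have f0 k : 0 <= f k by have /andP[] := fK k.
have fG k : regular P k -> cell_integral Phi1 k - eps <= f k.
  move=> rk; rewrite /f asboolT//; have [w wk] := regularP rk; rewrite -wk.
  exact: nu_mean_ge mPhi1 Phi1K (lPsi1 _) (Phi1Psi w).
near=> n.
have LL (w : regular_cell P) : @local_limit _ _ _ P T L p n r 1 eps (inl w) (Psi1 (val w)) (val w).
  have : forall (w : regular_cell P) (phi : M -> R), lip_ball r phi ->
    @local_limit _ _ _ P T L p n r 1 eps (inl w) phi (val w).
    by near: n; exact: (local_limitA L0 (hA r ltr01) eps0).
  by apply; exact: lip_ball_le (lPsi1 _).
have [bs side_low] : (b <= side (L n * h))%N /\
    h ^+ d - eps <= (L n ^+ d)^-1 * ((side (L n * h) - b) ^ d)%N%:R.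
  by near: n; exact: box_side_lower.
set l := side (L n * h) in bs side_low.
have D0 : 0 <= 1 * L n by rewrite mul1r ltW.
have Lh0 : 0 < L n * h by rewrite mulr_gt0.
have [W2 HW2] : exists W0, forall W, (W0 <= W)%N -> forall m, m \in ms ->
  forall a, central a W -> forall (f : Zd -> R) K, (forall k, 0 <= f k <= K) ->
  ((l - b) ^ d)%N%:R * ((gamma2 - eps) * \sum_(w <- zbox a W) f w
      - gamma2 * K * eps * (2 * W%:R) ^+ d) <=
  \sum_(w <- zbox a W) f w * \sum_(k <- zbox (w + corner (L n * h) m) l |
     good P (1 * L n) k) cell_integral Phi2 k.
  apply: seq_threshold => m mms; apply: dsum => //.
  exact: corner_orthant (msO m mms).
exists (maxn W1 W2) => W; rewrite geq_max => /andP[W1W W2W] a ca.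
have F1 := HW1 W W1W a ca f f0 fG.
have F2 m : m \in ms -> _ := fun mms => HW2 W W2W m mms a ca f K fK.
pose const := eps * ((C * K + (size ms)%:R) * h ^+ d).
have const0 : 0 <= const.
  rewrite /const; apply: mulr_ge0; first exact: ltW.
  by apply: mulr_ge0; [rewrite addr_ge0// mulr_ge0|exact: ltW].
have cell w : \sum_(m <- ms) c m * (f w * box_average P L h 1 n w m (cell_integral Phi2))
    - const <= cell_integral (correlation n) w.
  have [rw|nrw] := pselect (regular P w); last first.
    rewrite big1 => [|m _]; last by rewrite /f asboolF// mul0r mulr0.
    rewrite sub0r (@le_trans _ _ 0) ?oppr_le0//; apply: Rintegral_ge0 => x _.
    have /andP[a1 _] := Phi1K x; have /andP[a2 _] := Phi2K (iter n T x).
    exact: mulr_ge0.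
  have [v vw] := regularP rw; rewrite -vw.
  apply: le_trans (cell_correlation_ge n (mPsi1 (val v)) (Psi10 _) (Psi1Phi v)).
  have := @core_lower_average _ _ _ P T L p mT L0 h ms c h0 c0 ums msO c_le n r 1
    eps eps (inl v) (Psi1 (val v)) (val v) K K Psi2 Phi2 (ltW eps0) (ltW eps0) r0
    msr' (LL v) (mPsi1 _) (Psi1K v) mPhi2
    Phi2K (fun k => lip_ball_le r2r (lPsi2 k)) Psi20 Psi2Phi Phi2Psi.
  apply: le_trans; rewrite /mean /=.
  have fE : f (val v) = \int[nu P]_y Psi1 (val v) y.
    by rewrite /f asboolT//; exact: regular_val.
  rewrite -fE sumrB; apply: lerB.
    by apply: ler_sum => m _; rewrite mulrA.
  rewrite -mulr_suml big_split/= sumr_const_seq -!mulr_suml -/C /const.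
  rewrite [leRHS]mulrA ler_wpM2r ?(ltW hd)// mulrDr lerD2r.
  rewrite mulrC ler_wpM2l ?(ltW eps0)// ler_wpM2l//.
  by have /andP[] := fK (val v).
set B : R := W%:R ^+ d in F1 *; have B0 : 0 <= B by rewrite exprn_ge0.
set F := \sum_(w <- zbox a W) f w in F1.
have FK : F <= K * B.
  rewrite /B -natrX -(size_zbox a) -sumr_const_seq; apply: ler_sum => w _.
  by have /andP[] := fK w.
have Ld : 0 < L n ^+ d by rewrite exprn_gt0.
set lam := (L n ^+ d)^-1 * ((l - b) ^ d)%N%:R in side_low.
have lam0 : 0 <= lam by rewrite /lam mulr_ge0// invr_ge0 ltW.
have lamh : lam <= h ^+ d.
  apply: (le_trans _ (box_size d1 d2 L0 n h0)); rewrite ler_pM2l ?invr_gt0// !natrX.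
  by apply: lerXn2r; rewrite ?nnegrE// ler_nat leq_subr.
have bracket : B * (gamma1 * gamma2 - eps * Y) <=
    (gamma2 - eps) * F - gamma2 * K * eps * (2 * W%:R) ^+ d.
  rewrite exprMn -/B /Y; have := ler_wpM2l g2 F1; have := ler_wpM2l (ltW eps0) FK.
  have -> : B * (gamma1 * gamma2 - eps * (gamma2 * (2 * gamma1 + 2) + K + gamma2 * K * 2 ^+ d)) =
    gamma2 * (B * (gamma1 - eps * (2 * gamma1 + 2))) - eps * (K * B) -
    gamma2 * K * eps * (2 ^+ d * B) by ring.
  by rewrite mulrBl; lra.
have avg m : m \in ms -> B * ((h ^+ d - eps) * (gamma1 * gamma2) - h ^+ d * (eps * Y)) <=
    \sum_(w <- zbox a W) f w * box_average P L h 1 n w m (cell_integral Phi2).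
  move=> mms; apply: (@le_trans _ _ (lam * (B * (gamma1 * gamma2 - eps * Y)))).
    have -> : lam * (B * (gamma1 * gamma2 - eps * Y)) =
      B * (lam * (gamma1 * gamma2) - lam * (eps * Y)) by ring.
    rewrite ler_wpM2l// lerB//; first exact: ler_wpM2r.
    by rewrite ler_wpM2r// mulr_ge0// ltW.
  apply: (le_trans (ler_wpM2l lam0 bracket)).
  have -> : \sum_(w <- zbox a W) f w * box_average P L h 1 n w m (cell_integral Phi2) =
    (L n ^+ d)^-1 * \sum_(w <- zbox a W) f w * \sum_(k <- zbox (w + corner (L n * h) m) l |
     good P (1 * L n) k) cell_integral Phi2 k.
    by rewrite mulr_sumr; apply: eq_bigr => w _; rewrite /box_average mulrCA.
  by rewrite /lam -[leLHS]mulrA; apply: ler_wpM2l; [rewrite invr_ge0 ltW|exact: F2].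
apply: (@le_trans _ _ (\sum_(w <- zbox a W) (\sum_(m <- ms) c m *
    (f w * box_average P L h 1 n w m (cell_integral Phi2)) - const))); last first.
  by apply: ler_sum => w _; exact: cell.
rewrite sumrB sumr_const_seq size_zbox natrX -/B exchange_big/=.
have sumC : C * (B * ((h ^+ d - eps) * (gamma1 * gamma2) - h ^+ d * (eps * Y))) <=
  \sum_(m <- ms) \sum_(w <- zbox a W) c m *
    (f w * box_average P L h 1 n w m (cell_integral Phi2)).
  rewrite /C mulr_suml big_seq [leRHS]big_seq; apply: ler_sum => m mms.
  by rewrite -mulr_sumr ler_wpM2l//; exact: avg.
apply: (@le_trans _ _ (C * (B * ((h ^+ d - eps) * (gamma1 * gamma2) - h ^+ d * (eps * Y)))
  - const * B)); last by rewrite lerD2r.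
have -> : C * (B * ((h ^+ d - eps) * (gamma1 * gamma2) - h ^+ d * (eps * Y))) - const * B =
   B * (h ^+ d * C * (gamma1 * gamma2) - Z * eps) by rewrite /const /Z; ring.
rewrite ler_wpM2l//; have := ler_wpM2r g12 (ltW hC); rewrite mulrBl mul1r.
by move: e'e epsZ; rewrite [e' * _]mulrC; lra.
Unshelve. all: by end_near. Qed.

End observables.
End global_lower.

Section upper_lower_limits.
Context (R : realType) (d1 d2 : nat) (P : phase_space R d1 d2).
Local Notation X := (borel (total_space P)).
Local Notation mu := (@mu R d1 d2 P).

(** Bounds on [F] for the sets of large measure bound its upper and lower limits,
    provided that there are sets of arbitrarily large measure. *)
Lemma limits_large_bounds (VV : set (set X)) (F : set X -> R) (c e : R) :
  (forall K : R, exists2 V, VV V & (K%:E < mu V)%E) ->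
  (exists K : R, forall V, VV V -> (K%:E < mu V)%E -> `|F V - c| <= e) ->
  ((c - e)%:E <= limsup_large VV F <= (c + e)%:E)%E /\
  ((c - e)%:E <= liminf_large VV F <= (c + e)%:E)%E.
Proof.
move=> unb [K FK].
have FK' V : VV V -> (K%:E < mu V)%E -> c - e <= F V <= c + e.
  by move=> VVV KV; have := FK V VVV KV; rewrite ler_distl.
have two K' : exists2 V, VV V & (K%:E < mu V)%E /\ (K'%:E < mu V)%E.
  have [V VVV KV] := unb (Num.max K K'); exists V => //; split; apply: le_lt_trans KV.
    by rewrite lee_fin le_max lexx.
  by rewrite lee_fin le_max lexx orbT.
split; apply/andP; split.
- apply: le_ereal_inf_tmp => _ [K' _ <-]; have [V VVV [KV K'V]] := two K'.
  apply: (@le_trans _ _ (F V)%:E); first by rewrite lee_fin; have /andP[] := FK' V VVV KV.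
  by apply: ereal_sup_ubound; exists V.
- apply: (@le_trans _ _ (ereal_sup [set (F V)%:E | V in VV `&` [set V | K%:E < mu V]%E])).
    by apply: ereal_inf_lbound; exists K.
  apply: ge_ereal_sup => _ [V [VVV KV] <-]; rewrite lee_fin.
  by have /andP[] := FK' V VVV KV.
- apply: (@le_trans _ _ (ereal_inf [set (F V)%:E | V in VV `&` [set V | K%:E < mu V]%E])).
    apply: le_ereal_inf_tmp => _ [V [VVV KV] <-]; rewrite lee_fin.
    by have /andP[] := FK' V VVV KV.
  by apply: ereal_sup_ubound; exists K.
- apply: ge_ereal_sup => _ [K' _ <-]; have [V VVV [KV K'V]] := two K'.
  apply: (@le_trans _ _ (F V)%:E); last by rewrite lee_fin; have /andP[] := FK' V VVV KV.
  by apply: ereal_inf_lbound; exists V.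
Qed.

Lemma cvg_ereal_dist (u : nat -> \bar R) (c : R) :
  (forall e, 0 < e -> \forall n \near \oo, ((c - e)%:E <= u n <= (c + e)%:E)%E) ->
  u n @[n --> \oo] --> c%:E.
Proof.
move=> H; have ufin : \forall n \near \oo, u n \is a fin_num.
  have := H 1 ltr01; apply: filterS => n /andP[l r].
  by rewrite fin_numElt (lt_le_trans (ltNyr _) l) (le_lt_trans r (ltry _)).
apply/fine_cvgP; split => //; apply/cvgrPdist_le => e e0.
near=> n; have un : u n \is a fin_num by near: n.
have : ((c - e)%:E <= u n <= (c + e)%:E)%E by near: n; exact: H.
by rewrite -(fineK un) !lee_fin /= ler_distlC.
Unshelve. all: by end_near. Qed.

End upper_lower_limits.

Section global_global.
Context (R : realType) (d1 d2 : nat) (P : phase_space R d1 d2).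
Local Notation d := (d1 + d2)%N.
Local Notation Zd := 'rV[int]_(d1 + d2).
Local Notation Rd := 'rV[R]_(d1 + d2).
Local Notation X := (borel (total_space P)).
Local Notation mu := (@mu R d1 d2 P).

(** The measure of a large central box is close to the number of its points. *)
Lemma mu_cube (e : R) : 0 < e -> exists W0, forall W, (W0 <= W)%N ->
  forall a : Zd, central a W ->
  `|fine (mu (region [set` zbox a W])) - W%:R ^+ d| <= e * W%:R ^+ d.
Proof.
move=> e0; have [A [A1 hA]] := cell_mass P.
have p2 : 0 < (2 ^+ d : R) by rewrite exprn_gt0.
have A0 : 0 < A by exact: lt_trans A1.
have eta0 : 0 < e / (A * 2 ^+ d) by rewrite divr_gt0// mulr_gt0.
have [xi [Q0 [xi0 few]]] := few_near_exc P eta0.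
exists (Num.bound `|Q0|).+1 => W W0W a ca.
have W0 : 0 < W%:R :> R by rewrite ltr0n (leq_trans _ W0W).
have QW : Q0 <= 2 * W%:R.
  apply: (le_trans (bound_ge _)); apply: (@le_trans _ _ W%:R).
    by rewrite ler_nat (leq_trans _ W0W).
  by rewrite ler_peMl ?ler1n// ltW.
rewrite fine_mu_region_seq ?zbox_uniq// -natrX -(size_zbox a W) -[(size _)%:R]mul1r.
rewrite -sumr_const_seq -sumrB (le_trans (ler_norm_sum _ _ _))//.
pose q k := `[< (dist_set (toR R k) (exc P) <= 0%:E)%E >].
apply: (@le_trans _ _ (A * (count q (zbox a W))%:R)).
  rewrite -sumr_count mulr_sumr big_seq [leRHS]big_seq; apply: ler_sum => k ka.
  have [kc _] := central_range ca ka.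
  have [rk|nrk] := pselect (regular P k).
    by rewrite fine_mu_regular// subrr normr0 mulr_ge0 ?(ltW A0).
  have ek : exc P k by apply: contrapT => nek; exact: nrk.
  rewrite /q asboolT; last exact: dist_exc0.
  have m0 : 0 <= fine (mu (region [set k])) by rewrite fine_ge0// measure_ge0.
  have mA : fine (mu (region [set k])) <= A.
    by rewrite -lee_fin fineK// ge0_fin_numE// mu_region1_fin.
  by rewrite mulr1 ler_norml; lra.
rewrite sumr_const_seq mul1r size_zbox natrX.
have := few (2 * W%:R) QW (mulr_gt0 (ltr0n _ 2) W0) (zbox a W) 0 (zbox_uniq _ _).
rewrite mulr_ge0 ?(ltW xi0) ?mulr_ge0// => /(_ isT) bad.
have {}bad : (count q (zbox a W))%:R <= e / (A * 2 ^+ d) * (2 * W%:R) ^+ d.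
  apply: bad => k /(central_range ca)[kc kW]; have kR j : `|(k 0 j)%:~R : R| <= W%:R.
    by rewrite -intr_norm -[W%:R]/(W%:Z%:~R) ler_int.
  split=> i; rewrite mxE.
    have := kR (lshift d2 i); have := ltW (kc i); rewrite -(ler_int R) ler_norml; lra.
  by have := kR (rshift d1 i); rewrite ler_norml; lra.
apply: (le_trans (ler_wpM2l (ltW A0) bad)); rewrite exprMn.
rewrite le_eqVlt; apply/orP; left; apply/eqP; field.
by rewrite !gt_eqF.
Qed.

Variables (T : X -> X) (L : nat -> R) (p : Rd -> R).
Hypothesis mT : measurable_fun setT T.
Hypotheses (L0 : forall n, 0 < L n) (Loo : L n @[n --> \oo] --> +oo).
Hypothesis dp : limit_density p.
Hypothesis hA : forall eps r : R, 0 < eps ->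
  Defs.sup0 (errorA T L p eps r n) @[n --> \oo] --> 0%E.

Section observables.
Variables (Phi1 Phi2 : X -> R) (gamma1 gamma2 : R).
Hypotheses (ao1 : G_AO Phi1 gamma1) (ao2 : G_AO Phi2 gamma2).

Let uc1 := ao1.1.
Let uc2 := ao2.1.
Let mPhi1 := measurable_unif_continuous uc1.
Let mPhi2 := measurable_unif_continuous uc2.

(** With [b] equal to [1] and [-1], lower and upper bounds for the correlations of
    signed observables. *)
Lemma correlation_lower (K e b : R) : `|b| = 1 -> 0 < e ->
  (forall x, `|Phi1 x| <= K) -> (forall x, `|Phi2 x| <= K) ->
  \forall n \near \oo, exists W0, forall W, (W0 <= W)%N -> forall a : Zd, central a W ->
  W%:R ^+ d * (b * (gamma1 * gamma2) - e) <=
  b * \int[mu]_(x in region [set` zbox a W]) (Phi1 x * Phi2 (iter n T x)).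
Proof.
move=> b1 e0 Phi1K Phi2K; have K0 : 0 <= K := le_trans (normr_ge0 _) (Phi1K point).
have e20 : 0 < e / 2 by rewrite divr_gt0.
have bb : b * b = 1 by rewrite -expr2 -real_normK ?num_real// b1 expr1n.
(* (K + Phi1) (K + b Phi2') + (K - Phi1) (K - b Phi2') = 2 K^2 + 2 b Phi1 Phi2',
   where Phi2' is the composition of Phi2 with the n-th iterate. *)
pose A1 s x := K + s * Phi1 x; pose A2 s x := K + (s * b) * Phi2 x.
have A1K s x : `|s| = 1 -> 0 <= A1 s x <= K + K.
  move=> s1; have : `|s * Phi1 x| <= K by rewrite normrM s1 mul1r.
  by rewrite ler_norml /A1; lra.
have A2K s x : `|s| = 1 -> 0 <= A2 s x <= K + K.
  move=> s1; have : `|(s * b) * Phi2 x| <= K by rewrite !normrM s1 b1 !mul1r.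
  by rewrite ler_norml /A2; lra.
have low s : `|s| = 1 -> \forall n \near \oo, exists W0, forall W, (W0 <= W)%N ->
    forall a : Zd, central a W ->
    W%:R ^+ d * ((K + s * gamma1) * (K + s * b * gamma2) - e / 2) <=
    \sum_(w <- zbox a W) cell_integral (correlation T (A1 s) (A2 s) n) w.
  move=> s1; apply: (global_lower mT L0 Loo dp hA (K := K + K)) => //.
  - exact: unif_continuous_affine.
  - exact: unif_continuous_affine.
  - by move=> x; exact: A1K.
  - by move=> x; exact: A2K.
  - apply: almost_average_ext (almost_average_affine K _ (almost_average_GAO ao1)).
      by move=> k rk; rewrite (cell_integral_affine _ _ mPhi1 Phi1K).
    by rewrite s1.
  - apply: almost_average_ext (almost_average_affine K _ (almost_average_GAO ao2)).
      by move=> k rk; rewrite (cell_integral_affine _ _ mPhi2 Phi2K).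
    by rewrite normrM s1 b1 mulr1.
have K1 : 0 < K * K + 1 by rewrite ltr_wpDl// mulr_ge0.
have e30 : 0 < e / 2 / (K * K + 1) by rewrite divr_gt0.
have [W3 HW3] := mu_cube e30.
have low1 := low 1 (normr1 _); have low2 := low (-1) (etrans (normrN 1) (normr1 _)).
near=> n.
have [W1 HW1] : exists W0, forall W, (W0 <= W)%N -> forall a : Zd, central a W ->
    W%:R ^+ d * ((K + 1 * gamma1) * (K + 1 * b * gamma2) - e / 2) <=
    \sum_(w <- zbox a W) cell_integral (correlation T (A1 1) (A2 1) n) w by near: n.
have [W2 HW2] : exists W0, forall W, (W0 <= W)%N -> forall a : Zd, central a W ->
    W%:R ^+ d * ((K + -1 * gamma1) * (K + -1 * b * gamma2) - e / 2) <=
    \sum_(w <- zbox a W) cell_integral (correlation T (A1 (-1)) (A2 (-1)) n) w by near: n.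
exists (maxn W1 (maxn W2 W3)) => W; rewrite !geq_max => /and3P[W1W W2W W3W] a ca.
have := HW1 W W1W a ca; have := HW2 W W2W a ca; have := HW3 W W3W a ca.
set V := region [set` zbox a W]; have mV : measurable V by exact: measurable_region.
have mA1 s : measurable_fun setT (A1 s).
  exact: measurable_unif_continuous (unif_continuous_affine K s uc1).
have mA2 s : measurable_fun setT (A2 s).
  exact: measurable_unif_continuous (unif_continuous_affine K (s * b) uc2).
have int_cor s : `|s| = 1 -> mu.-integrable V (EFin \o correlation T (A1 s) (A2 s) n).
  move=> s1; apply: (@integrable_region_seq _ _ _ P _ _ ((K + K) * (K + K))).
    apply: measurable_funM => //; exact: (measurableT_comp (mA2 s) (measurable_iter mT n)).
  move=> x; have /andP[x1 x2] := A1K s x s1; have /andP[x3 x4] := A2K s (iter n T x) s1.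
  by rewrite /correlation ger0_norm ?mulr_ge0// ler_pM.
have i1 := int_cor 1 (normr1 _); have i2 := int_cor (-1) (etrans (normrN 1) (normr1 _)).
rewrite -(Rintegral_region_seq (zbox_uniq a W) i1) -(Rintegral_region_seq (zbox_uniq a W) i2).
rewrite -/V => HV h2 h1.
have iP : mu.-integrable V (EFin \o (fun x => Phi1 x * Phi2 (iter n T x))).
  apply: (@integrable_region_seq _ _ _ P _ _ (K * K)).
    apply: measurable_funM => //; exact: (measurableT_comp mPhi2 (measurable_iter mT n)).
  by move=> x; rewrite normrM ler_pM.
have iK : mu.-integrable V (EFin \o (fun=> 2 * (K * K) : R)).
  by apply: (@integrable_region_seq _ _ _ P _ (fun=> 2 * (K * K)) `|2 * (K * K)|).
have ibP : mu.-integrable V (EFin \o (fun x => 2 * b * (Phi1 x * Phi2 (iter n T x)))).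
  exact: (integrableZl mV (2 * b) iP).
have sumE : \int[mu]_(x in V) correlation T (A1 1) (A2 1) n x +
    \int[mu]_(x in V) correlation T (A1 (-1)) (A2 (-1)) n x =
    2 * (K * K) * fine (mu V) + 2 * b * \int[mu]_(x in V) (Phi1 x * Phi2 (iter n T x)).
  rewrite -RintegralD// -RintegralZl// -Rintegral_cst// -RintegralD//.
  by apply: eq_Rintegral => x _; rewrite /correlation /A1 /A2; ring.
set J := \int[mu]_(x in V) (Phi1 x * Phi2 (iter n T x)) in sumE *.
move: HV; rewrite ler_norml => /andP[_ HV].
have B0 : 0 <= (W%:R : R) ^+ d by rewrite exprn_ge0.
have KV : K * K * (fine (mu V) - W%:R ^+ d) <= e / 2 * W%:R ^+ d.
  apply: (le_trans (ler_wpM2l (mulr_ge0 K0 K0) HV)); rewrite mulrA ler_wpM2r//.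
  by rewrite mulrA ler_pdivrMr// mulrC ler_wpM2l ?(ltW e20)// lerDl.
have := lerD h1 h2; rewrite sumE -mulrDr.
have -> : (K + 1 * gamma1) * (K + 1 * b * gamma2) - e / 2 +
  ((K + -1 * gamma1) * (K + -1 * b * gamma2) - e / 2) =
  2 * (K * K) + 2 * (b * (gamma1 * gamma2)) - e by field.
move: KV; rewrite mulrBr !mulrBr mulrDr; move: (fine _) (W%:R ^+ d) => m B; lra.
Unshelve. all: by end_near. Qed.

(** The averages of the correlations over the large central cubes. *)
Lemma correlation_limit (e : R) : 0 < e -> \forall n \near \oo,
  exists W0, forall W, (W0 <= W)%N -> forall a : Zd, central a W ->
  `|Defs.average (region [set` zbox a W]) (fun x => Phi1 x * Phi2 (iter n T x)) -
    gamma1 * gamma2| <= e.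
Proof.
move=> e0; have [[K1 Phi1K1] _] := uc1; have [[K2 Phi2K2] _] := uc2.
pose K := Num.max K1 K2.
have Phi1K x : `|Phi1 x| <= K by rewrite le_max Phi1K1.
have Phi2K x : `|Phi2 x| <= K by rewrite le_max Phi2K2 orbT.
pose g := `|gamma1 * gamma2|.
have g0 : 0 <= g by exact: normr_ge0.
have g1 : 0 < g + 1 by rewrite /g ltr_wpDl.
have e40 : 0 < e / 4 by rewrite divr_gt0.
pose e3 := Num.min (1 / 2) (e / 4 / (g + 1)).
have e30 : 0 < e3 by rewrite lt_min; apply/andP; split; [lra|rewrite divr_gt0].
have e32 : e3 <= 1 / 2 by rewrite ge_min lexx.
have e3g : e3 * g <= e / 4.
  apply: (@le_trans _ _ (e / 4 / (g + 1) * g)).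
    by rewrite ler_wpM2r// ge_min lexx orbT.
  by rewrite mulrAC ler_pdivrMr// ler_wpM2l ?(ltW e40)//; lra.
have [W3 HW3] := mu_cube e30.
have low1 := correlation_lower (normr1 _) e40 Phi1K Phi2K.
have low2 := correlation_lower (etrans (normrN 1) (normr1 _)) e40 Phi1K Phi2K.
near=> n.
have [W1 HW1] : exists W0, forall W, (W0 <= W)%N -> forall a : Zd, central a W ->
  W%:R ^+ d * (1 * (gamma1 * gamma2) - e / 4) <=
  1 * \int[mu]_(x in region [set` zbox a W]) (Phi1 x * Phi2 (iter n T x)) by near: n.
have [W2 HW2] : exists W0, forall W, (W0 <= W)%N -> forall a : Zd, central a W ->
  W%:R ^+ d * (-1 * (gamma1 * gamma2) - e / 4) <=
  -1 * \int[mu]_(x in region [set` zbox a W]) (Phi1 x * Phi2 (iter n T x)) by near: n.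
exists (maxn W1 (maxn W2 W3)).+1 => W WW a ca.
have [W0 /and3P[W1W W2W W3W]] : (0 < W)%N /\ [&& W1 <= W, W2 <= W & W3 <= W]%N.
  by split; [exact: leq_ltn_trans WW|move: WW; rewrite !gtn_max => /and3P[/ltnW-> /ltnW-> /ltnW->]].
have := HW1 W W1W a ca; have := HW2 W W2W a ca; have := HW3 W W3W a ca.
rewrite /Defs.average; set J := Rintegral _ _ _; set m := fine _.
have : 0 < (W%:R : R) ^+ d by rewrite exprn_gt0// ltr0n.
move: (W%:R ^+ d) => B B0; rewrite !mul1r !mulN1r ler_norml => /andP[m1 m2] J2 J1.
have m0 : 1 / 2 * B <= m.
  have : e3 * B <= 1 / 2 * B by rewrite ler_wpM2r// ltW.
  by lra.
have mgt0 : 0 < m by lra.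
have -> : m^-1 * J - gamma1 * gamma2 = (J - m * (gamma1 * gamma2)) / m.
  by rewrite mulrBl mulrC mulrAC divff ?mul1r// gt_eqF.
rewrite normrM normfV (gtr0_norm mgt0) ler_pdivrMr//.
have -> : J - m * (gamma1 * gamma2) = (J - B * (gamma1 * gamma2)) - (m - B) * (gamma1 * gamma2) by ring.
have D1 : `|J - B * (gamma1 * gamma2)| <= e / 4 * B.
  by rewrite ler_norml; move: J1 J2; rewrite !mulrBr mulrN; lra.
have D2 : `|(m - B) * (gamma1 * gamma2)| <= e / 4 * B.
  rewrite normrM -/g; apply: (@le_trans _ _ (e3 * B * g)).
    by rewrite ler_wpM2r// ler_norml m1.
  by rewrite mulrAC ler_wpM2r// ltW.
apply: (le_trans (ler_normB _ _)); apply: (le_trans (lerD D1 D2)).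
have := ler_wpM2l (ltW e0) m0; lra.
Unshelve. all: by end_near. Qed.

End observables.
End global_global.

Section central_cubes.
Context (R : realType) (d1 d2 : nat) (P : phase_space R d1 d2).
Local Notation d := (d1 + d2)%N.
Local Notation Zd := 'rV[int]_(d1 + d2).
Local Notation mu := (@mu R d1 d2 P).

(** The admissible cubes containing the origin cell, described by their lower
    corner rather than by their center. *)
Lemma central_cubeP V : @central_cubes R d1 d2 P V ->
  exists (a : Zd) W, central a W /\ V = region [set` zbox a W].
Proof.
move=> [z [w [w0 zc zo ->]]]; pose a := z - const_mx ((w./2)%:Z - 1).
have E : cube_cells z w = [set` zbox a w] by apply: cube_cellsE => //; rewrite subrK.
exists a, w; rewrite /cube E; split => //; split.
  by move=> k ka; apply: zc; rewrite E.
by move: zo; rewrite E.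
Qed.

Lemma central_cubeI (a : Zd) W : (0 < W)%N -> central a W ->
  @central_cubes R d1 d2 P (region [set` zbox a W]).
Proof.
move=> W0 [ac ao]; exists (a + const_mx ((W./2)%:Z - 1)), W.
rewrite /cube (cube_cellsE (y := a))//; split => // k; exact: ac.
Qed.

Lemma central_origin W : (0 < W)%N -> central (origin_cell : Zd) W.
Proof.
move=> W0; split; last by apply/zboxP => j; rewrite lexx ltrDl.
move=> k /zboxP ko i; have /andP[+ _] := ko (lshift d2 i).
by rewrite row_mxEl mxE; apply: lt_le_trans.
Qed.

Hypothesis d_gt0 : (0 < d)%N.

(** Positivity of the dimension is needed for the volume [W^d] to grow with [W]. *)
Lemma central_unbounded (K : R) : exists2 V, @central_cubes R d1 d2 P V & (K%:E < mu V)%E.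
Proof.
have h : 0 < 1 / 2 :> R by rewrite divr_gt0.
have [W0 HW0] := mu_cube P h.
pose W := (W0 + (Num.bound `|(2 * K)%R|%R).+1)%N; have Wgt0 : (0 < W)%N by rewrite /W addnS.
have ca := central_origin Wgt0; exists (region [set` zbox (origin_cell : Zd) W]).
  exact: central_cubeI.
have := HW0 W (leq_addr _ _) _ ca; rewrite ler_norml => /andP[+ _].
have KW : 2 * K < W%:R.
  apply: (le_lt_trans (ler_norm _)); apply: (lt_le_trans (archi_boundP (normr_ge0 _))).
  by rewrite ler_nat /W addnS ltnW// ltnS leq_addl.
have WW : W%:R <= W%:R ^+ d :> R.
  by rewrite -[leLHS]expr1 ler_weXn2l// ler1n.
have mfin : (mu (region [set` zbox (origin_cell : Zd) W]) < +oo)%E := mu_region_seq _ _.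
have mf : mu (region [set` zbox (origin_cell : Zd) W]) \is a fin_num.
  by rewrite ge0_fin_numE.
by move=> low; rewrite -(fineK mf) lte_fin; lra.
Qed.

(** A central box of large measure has a large side. *)
Lemma central_large (W0 : nat) : exists K : R, forall (a : Zd) W, central a W ->
  (K%:E < mu (region [set` zbox a W]))%E -> (W0 <= W)%N.
Proof.
have [A [A1 hA]] := cell_mass P; exists (A * W0%:R ^+ d) => a W ca.
rewrite leqNgt => KV; apply/negP => WW0; move: KV; apply/negP; rewrite -leNgt.
have mf : mu (region [set` zbox a W]) \is a fin_num.
  by rewrite ge0_fin_numE// mu_region_seq.
rewrite -(fineK mf) lee_fin fine_mu_region_seq ?zbox_uniq//.
have A0 : 0 <= A by rewrite ltW// (lt_trans ltr01).
apply: (@le_trans _ _ (\sum_(k <- zbox a W) A)).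
  apply: ler_sum => k _; rewrite -lee_fin fineK//.
  by rewrite ge0_fin_numE// mu_region1_fin.
rewrite sumr_const_seq size_zbox natrX ler_wpM2l//.
by apply: lerXn2r; rewrite ?nnegrE// ler_nat ltnW.
Qed.

End central_cubes.

Theorem theorem2p8 (R : realType) (d1 d2 : nat) (hd : (0 < d1 + d2)%N)
    (P : phase_space R d1 d2)
    (T : borel (total_space P) -> borel (total_space P))
    (hT : preserves_mu T) :
  (AMLLT T -> local_global_mixing_GO T) /\
  (AMLLT T -> global_global_mixing_GAO T).
Proof.
have [mT _] := hT; split.
  move=> [L [p [L0 Loo dp hA hB]]] phi Phi gamma iphi GO.
  exact: (local_global_limit mT L0 Loo dp hA hB GO iphi).
move=> [L [p [L0 Loo dp hA _]]] Phi1 Phi2 gamma1 gamma2 ao1 ao2 corr.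
have H e : 0 < e -> \forall n \near \oo,
    ((gamma1 * gamma2 - e)%:E <= limsup_large (@central_cubes R d1 d2 P) (corr n) <=
     (gamma1 * gamma2 + e)%:E)%E /\
    ((gamma1 * gamma2 - e)%:E <= liminf_large (@central_cubes R d1 d2 P) (corr n) <=
     (gamma1 * gamma2 + e)%:E)%E.
  move=> e0; have := correlation_limit mT L0 Loo dp hA ao1 ao2 e0.
  apply: filterS => n [W0 HW0]; apply: limits_large_bounds.
    exact: central_unbounded.
  have [K HK] := central_large P W0; exists K => V /central_cubeP[a [W [ca ->]]] KV.
  by apply: HW0 => //; exact: HK KV.
by split; apply: cvg_ereal_dist => e e0; have := H e e0; apply: filterS => n [].
Qed.
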